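(* Let $(X,d,\mu)$ be a space of homogeneous type and let $\mathcal{F}$ be a family of pairs $(f,g)$ of measurable non-negative functions on $X$. Suppose that for some $1\le p_0<\infty$, for every $v\in A_{p_0}(X)$ and all $(f,g)\in\mathcal{F}$, $$\Big(\int_X g^{p_0}v\,d\mu\Big)^{1/p_0}\le C_0\,N\big([v]_{A_{p_0}}\big)\Big(\int_X f^{p_0}v\,d\mu\Big)^{1/p_0}$$ with some positive constant $C_0$ not depending on $(f,g)$ and $v$, and a positive non-decreasing function $N$. Then for any $1<p<\infty$, $1\le s<\infty$, $\theta>0$ and any integrable weight $w$ on $X$ with $w\in A_p(X)$, there is a positive constant $C$ independent of $(f,g)$ such that for all $(f,g)\in\mathcal{F}$, $$\|g\|_{L^{p),s,\theta}_w}\le C\,\|f\|_{L^{p),s,\theta}_w}.$$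
   Context: Space of homogeneous type $(X,d,\mu)$: $d:X\times X\to[0,\infty)$ is a quasi-metric ($d(x,y)=0$ iff $x=y$; $d(x,y)=d(y,x)$; $d(x,y)\le\kappa(d(x,z)+d(z,y))$ for a constant $\kappa>0$), balls $B(x,r)=\{y: d(x,y)<r\}$ are measurable with positive measure, and $\mu$ is doubling: $\mu(B(x,2r))\le D_\mu\,\mu(B(x,r))$ for all $x\in X$, $r>0$. It is assumed throughout that the class of continuous functions is dense in $L^1(X)$. A weight is a $\mu$-a.e. positive, locally integrable function; $w(E)=\int_E w\,d\mu$. For $1<p<\infty$, $p'=p/(p-1)$, $w\in A_p(X)$ means $$[w]_{A_p}=\sup_B\Big(\frac1{\mu(B)}\int_B w\,d\mu\Big)\Big(\frac1{\mu(B)}\int_B w^{1-p'}d\mu\Big)^{p-1}<\infty,$$ supremum over all balls $B\subset X$. $w\in A_1(X)$ means $Mw\le Cw$ a.e., where $Mg(x)=\sup_{B\ni x}\frac1{\mu(B)}\int_B|g|\,d\mu$, and $[w]_{A_1}$ is the best constant. Weighted Lorentz space: for $1\le p,s<\infty$, $\|f\|_{L^{p,s}_w}=\Big(s\int_0^\infty\big(w\{x:|f(x)|>\tau\}\big)^{s/p}\tau^{s-1}d\tau\Big)^{1/s}$. Weighted grand Lorentz space: for $1<p<\infty$, $\theta>0$, $$\|f\|_{L^{p),s,\theta}_w}=\sup_{0<\varepsilon<p-1}\varepsilon^{\frac{\theta}{p-\varepsilon}}\|f\|_{L^{p-\varepsilon,s}_w}.$$ *)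

(* Defs.v *)
From HB Require Import structures.
From mathcomp Require Import all_boot all_order all_algebra.
From mathcomp Require Import all_classical all_reals all_analysis.

Set Implicit Arguments.
Unset Strict Implicit.
Unset Printing Implicit Defensive.

Import Order.TTheory GRing.Theory Num.Theory.
Import numFieldNormedType.Exports.

Local Open Scope classical_set_scope.
Local Open Scope ring_scope.

Section quasi_metric.
Context {R : realType} {T : Type}.
Variable rho : T -> T -> R.

Record is_quasi_metric (kappa : R) : Prop := IsQuasiMetric {
  qm_ge0 : forall x y, 0 <= rho x y;
  qm_eq0 : forall x y, rho x y = 0 <-> x = y;
  qm_sym : forall x y, rho x y = rho y x;
  qm_triangle : forall x y z, rho x y <= kappa * (rho x z + rho z y) }.

Definition qball (x : T) (r : R) : set T := [set y | rho x y < r].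

Definition qballs : set (set T) :=
  [set B | exists x r, 0 < r /\ B = qball x r].

(* Every ball of a quasi-metric is a neighbourhood of its centre, so this is
   continuity for the topology induced by rho, although balls need not be
   open. *)
Definition qcontinuous (h : T -> R) : Prop :=
  forall x e, 0 < e ->
    exists2 r, 0 < r & forall y, rho x y < r -> `|h x - h y| < e.

End quasi_metric.

Section homogeneous_type.
Context {R : realType} {d : measure_display} {X : measurableType d}.
Variables (rho : X -> X -> R) (mu : {measure set X -> \bar R}).

(* Finiteness of the measure of balls is not a field: if one ball has infinite
   measure then so does every ball, and then no non-zero continuous function
   is integrable. *)
Record homogeneous_type : Prop := HomogeneousType {
  ht_quasi_metric : exists2 kappa, 0 < kappa & is_quasi_metric rho kappa;
  ht_measurable : forall x r, 0 < r -> measurable (qball rho x r);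
  ht_positive : forall x r, 0 < r -> (0 < mu (qball rho x r))%E;
  ht_doubling : exists D : R, forall x r, 0 < r ->
    (mu (qball rho x (2 * r)) <= D%:E * mu (qball rho x r))%E }.

Definition continuous_dense_L1 : Prop :=
  forall f : X -> R, mu.-integrable setT (EFin \o f) ->
  forall e : R, 0 < e -> exists h : X -> R,
    [/\ qcontinuous rho h, mu.-integrable setT (EFin \o h)
      & (\int[mu]_x `|f x - h x|%:E < e%:E)%E].

Definition is_weight (w : X -> R) : Prop :=
  [/\ {ae mu, forall x, 0 < w x},
      measurable_fun setT w
    & forall B, qballs rho B -> mu.-integrable B (EFin \o w)].

Definition avg (B : set X) (f : X -> R) : \bar R :=
  ((mu B)^-1 * \int[mu]_(x in B) (f x)%:E)%E.

Definition maximal (g : X -> R) (x : X) : \bar R :=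
  ereal_sup [set avg B (fun y => `|g y|) | B in [set B | qballs rho B /\ B x]].

Definition A1_bound (w : X -> R) (C : R) : Prop :=
  {ae mu, forall x, (maximal w x <= (C * w x)%:E)%E}.

Definition conj_exp (p : R) : R := p / (p - 1).

Definition Ap_const (p : R) (w : X -> R) : \bar R :=
  if p == 1 then ereal_inf [set C%:E | C in A1_bound w]
  else ereal_sup [set
    (avg B w * (avg B (fun x => (w x `^ (1 - conj_exp p))%R)) `^ (p - 1)%R)%E
    | B in qballs rho].

Definition in_Ap (p : R) (w : X -> R) : Prop :=
  is_weight w /\
  if p == 1 then exists C, A1_bound w C else (Ap_const p w < +oo)%E.

Definition wmeas (w : X -> R) (E : set X) : \bar R :=
  (\int[mu]_(x in E) (w x)%:E)%E.

Definition lorentz_norm (p s : R) (w f : X -> R) : \bar R :=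
  ((s%:E * \int[lebesgue_measure]_(t in `]0%R, +oo[)
      ((wmeas w [set x | (t < `|f x|)%R]) `^ (s / p)%R * (t `^ (s - 1))%:E))
    `^ (s^-1)%R)%E.

Definition grand_lorentz_norm (p s theta : R) (w f : X -> R) : \bar R :=
  ereal_sup [set
    ((eps `^ (theta / (p - eps)))%:E * lorentz_norm (p - eps) s w f)%E
    | eps in [set eps : R | 0 < eps < p - 1]].

End homogeneous_type.

(* Main.v *)
Require Import Defs.
From HB Require Import structures.
From mathcomp Require Import all_boot all_order all_algebra.
From mathcomp Require Import all_classical all_reals all_analysis.
From mathcomp Require Import measurable_realfun.
From mathcomp Require Import ring lra.

(** The theorem is an extrapolation theorem: boundedness on [L^p0(v)] for all
    [v] in [A_p0] yields boundedness in the weighted grand Lorentz norm.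

    Fix [w] in [A_p]. The class is open, [w] is in [A_q1] for some [q1 < p],
    because the dual weight satisfies a reverse Hoelder inequality
    ([Ap_reverse_holder], [Ap_open]); and the classes are nested, so that [w] is
    in [A_q2] with [q2 = 2 p > p] ([Ap_nest]). By Muckenhoupt's theorem
    ([Ap_maximal]) the maximal operator [M] is bounded on [L^q(w)] for
    [q = q1, q2], and its dual [h |-> M (h w) / w] on [L^q'(w)]. The Rubio de
    Francia iteration ([rdf]) of these operators dominates a given function by
    one of comparable norm that is an A_1 weight, or becomes one after
    multiplication by [w]. If [phi] and [psi] are such A_1 weights, then
    [phi^(1 - p0) psi] is in [A_p0] with a controlled constant
    ([factored_in_Ap]), and the hypothesis applies to it.

    Take [phi] above [f] and [psi] above [w] on the set where [g > t]. The
    pointwise inequality [g <= g^p0 phi^(1 - p0) + phi] turns the hypothesis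
    into [int g psi <= C int phi psi] ([weighted_bound_duality]). Splitting [f]
    at the height [t] and using the exponent [q1] above [t] and [q2] below, one
    obtains
      [w (g > t) <= C (t^(-q1) int_(f > t) f^q1 w + t^(-q2) int_(f <= t) f^q2 w)],
    which is [distribution_bound]. Thus the distribution function of [g] is
    bounded as if [g] were the image of [f] under a linear operator of weak
    types [(q1, q1)] and [(q2, q2)], although there is no operator at all.

    Decomposing the two integrals dyadically bounds the distribution function
    of [g] by a series of dilates of that of [f], and the Lorentz norms of
    exponents [(q, s)] follow by scaling, with one constant for all [q] in an
    interval [[p - e0, p]] inside [(q1, q2)] ([lorentz_interpolation]). This is
    the part [eps <= e0] of the supremum that defines the grand norm. For
    [eps > e0] the norm with exponent [p - eps] is bounded by the one with
    exponent [p - e0], since [w] has finite total mass ([lorentz_norm_embed]).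

    The analysis is carried out for a countable family of balls
    ([ball_family]), closed under dilation up to constants, which contains a
    comparable ball around every ball ([ball_family_exists]). Maximal functions
    are then countable suprema and hence measurable. The density of continuous
    functions is used twice: it provides a ball of finite measure
    ([finite_ball_exists]), and it gives [f <= M f] almost everywhere
    ([Mx_ae_ge]), which the reverse Hoelder inequality rests on. *)

Set Implicit Arguments.
Unset Strict Implicit.
Unset Printing Implicit Defensive.

Import Order.TTheory GRing.Theory Num.Theory.
Import numFieldNormedType.Exports.

Local Open Scope classical_set_scope.
Local Open Scope ring_scope.

(** * Non-negative measurable functions *)

Section nonneg_measurable.
Context {d : measure_display} {X : measurableType d} {R : realType}.
Local Open Scope ereal_scope.

(** The functions whose integrals can be manipulated without further
    hypotheses. *)
Definition nnm (f : X -> \bar R) : Prop :=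
  measurable_fun setT f /\ forall x, 0 <= f x.

Definition inde (A : set X) (x : X) : \bar R := (\1_A x)%:E.

Lemma inde_ge0 A x : 0 <= inde A x.
Proof. by rewrite lee_fin indicE. Qed.

Lemma inde_in (A : set X) x : A x -> inde A x = 1.
Proof. by move=> Ax; rewrite /inde indicE mem_set. Qed.

Lemma inde_out (A : set X) x : ~ A x -> inde A x = 0.
Proof. by move=> Ax; rewrite /inde indicE memNset. Qed.

Lemma inde_le1 (A : set X) x : inde A x <= 1.
Proof. by rewrite lee_fin indicE; case: (_ \in _). Qed.

Lemma nnm_ge0 f x : nnm f -> 0 <= f x. Proof. by case. Qed.

Lemma nnm_cst (c : \bar R) : 0 <= c -> nnm (fun=> c).
Proof. by move=> c0; split. Qed.

Lemma nnm_inde A : measurable A -> nnm (inde A).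
Proof.
move=> mA; split; last exact: inde_ge0.
by apply/measurable_EFinP; exact: measurable_indic.
Qed.

Lemma nnm_EFin (f : X -> R) : measurable_fun setT f -> (forall x, (0 <= f x)%R) ->
  nnm (fun x => (f x)%:E).
Proof.
by move=> mf f0; split=> [|x]; [exact/measurable_EFinP|rewrite lee_fin].
Qed.

Lemma nnmD f g : nnm f -> nnm g -> nnm (fun x => f x + g x).
Proof.
move=> [mf f0] [mg g0]; split => [|x]; first exact: emeasurable_funD.
exact: adde_ge0.
Qed.

Lemma nnmM f g : nnm f -> nnm g -> nnm (fun x => f x * g x).
Proof.
move=> [mf f0] [mg g0]; split => [|x]; first exact: emeasurable_funM.
exact: mule_ge0.
Qed.

Lemma nnmX f a : nnm f -> nnm (fun x => f x `^ a).
Proof.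
move=> [mf f0]; split => [|x]; last exact: poweR_ge0.
exact: (measurableT_comp (measurable_poweR a)).
Qed.

Lemma nnm_series (f : nat -> X -> \bar R) : (forall n, nnm (f n)) ->
  nnm (fun x => \sum_(n <oo) f n x).
Proof.
move=> mf; split => [|x]; last by apply: nneseries_ge0 => n _ _; case: (mf n).
by apply: (@ge0_emeasurable_sum _ _ _ _ f xpredT) => [n x _ _|n _]; case: (mf n).
Qed.

Lemma nnm_sup (f : nat -> X -> \bar R) : (forall n, nnm (f n)) ->
  nnm (fun x => ereal_sup (range (fun n => f n x))).
Proof.
move=> mf; split => [|x]; last first.
  by apply: le_ereal_sup_tmp; exists (f 0%N x); [exists 0%N|case: (mf 0%N)].
have := @measurable_fun_esups _ _ _ setT f (fun n => (mf n).1) 0%N.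
congr (measurable_fun _ _); apply/funext => x; rewrite /esups /=.
by congr ereal_sup; apply/seteqP; split=> y [n _ <-]; exists n.
Qed.

Lemma nnm_gt (f : X -> \bar R) a : nnm f -> measurable [set x | a < f x].
Proof.
move=> [mf _]; rewrite -[X in measurable X]setTI.
exact: emeasurable_fun_o_infty.
Qed.

End nonneg_measurable.

Ltac nnm_step := match goal with
  | H : nnm ?f |- nnm ?f => exact: H
  | H : nnm ?f |- nnm (fun x => ?f x) => exact: H
  | H : forall n, nnm (?f n) |- nnm (?f _) => exact: H
  | H : forall n, nnm (?f n) |- nnm (fun x => ?f _ x) => exact: H
  | |- nnm (fun=> ?c) => apply: nnm_cst
  | |- nnm (inde _) => apply: nnm_inde
  | |- nnm (fun x => inde _ x) => apply: nnm_inde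
  | |- nnm (fun x => @GRing.add _ _ _) => apply: nnmD
  | |- nnm (fun x => mule _ _) => apply: nnmM
  | |- nnm (fun x => poweR _ _) => apply: nnmX
  | |- nnm (fun x => lim _) => apply: nnm_series => ?
  | |- nnm (fun x => (?f x)%:E) => apply: nnm_EFin
  end.
Ltac nnm := repeat (cbv beta; nnm_step); cbv beta; rewrite // ?lee_fin ?powR_ge0 //.

Section integral.
Context {d : measure_display} {X : measurableType d} {R : realType}.
Variable mu : {measure set X -> \bar R}.
Local Open Scope ereal_scope.
Implicit Types f g : X -> \bar R.

Lemma int_ge0 f : nnm f -> 0 <= \int[mu]_x f x.
Proof. by move=> [_ f0]; apply: integral_ge0 => x _. Qed.

Lemma int_le f g : nnm f -> nnm g -> (forall x, f x <= g x) ->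
  \int[mu]_x f x <= \int[mu]_x g x.
Proof.
by move=> [mf f0] [mg g0] fg; apply: ge0_le_integral => // x _; exact: fg.
Qed.

Lemma int_ae_le f g : nnm f -> nnm g -> {ae mu, forall x, f x <= g x} ->
  \int[mu]_x f x <= \int[mu]_x g x.
Proof.
move=> [mf f0] [mg g0] fg; apply: ae_ge0_le_integral => //.
by apply: filterS fg => x + _.
Qed.

Lemma intD f g : nnm f -> nnm g ->
  \int[mu]_x (f x + g x) = \int[mu]_x f x + \int[mu]_x g x.
Proof. by move=> [mf f0] [mg g0]; rewrite ge0_integralD. Qed.

Lemma intZ (k : \bar R) f : 0 <= k -> nnm f ->
  \int[mu]_x (k * f x) = k * \int[mu]_x f x.
Proof. by move=> k0 [mf f0]; rewrite ge0_integralZl. Qed.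

Lemma int_series (f : nat -> X -> \bar R) : (forall n, nnm (f n)) ->
  \int[mu]_x (\sum_(n <oo) f n x) = \sum_(n <oo) \int[mu]_x f n x.
Proof.
by move=> nf; rewrite integral_nneseries// => [n|n x _]; case: (nf n).
Qed.

Lemma int_inde (A : set X) f :
  \int[mu]_(x in A) f x = \int[mu]_x (inde A x * f x).
Proof.
rewrite integral_mkcond epatch_indic.
by apply: eq_integral => x _; rewrite muleC.
Qed.

Lemma int_subset f (A B : set X) : nnm f -> measurable A -> measurable B ->
  A `<=` B -> \int[mu]_(x in A) f x <= \int[mu]_(x in B) f x.
Proof.
move=> [mf f0] mA mB AB; apply: ge0_subset_integral => //.
exact: measurable_funS mf.
Qed.

Lemma int_in_ge0 f (A : set X) : nnm f -> 0 <= \int[mu]_(x in A) f x.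
Proof. by move=> [_ f0]; apply: integral_ge0 => x _. Qed.

Lemma int_in_le f g (A : set X) : nnm f -> nnm g -> measurable A ->
  (forall x, A x -> f x <= g x) ->
  \int[mu]_(x in A) f x <= \int[mu]_(x in A) g x.
Proof.
move=> [mf f0] [mg g0] mA fg; apply: ge0_le_integral => //.
  exact: measurable_funS mf.
exact: measurable_funS mg.
Qed.

Lemma int_inD f g (A : set X) : nnm f -> nnm g -> measurable A ->
  \int[mu]_(x in A) (f x + g x) = \int[mu]_(x in A) f x + \int[mu]_(x in A) g x.
Proof.
move=> [mf f0] [mg g0] mA; rewrite ge0_integralD//.
  exact: measurable_funS mf.
exact: measurable_funS mg.
Qed.

Lemma int_inZ (k : \bar R) f (A : set X) : 0 <= k -> nnm f -> measurable A ->
  \int[mu]_(x in A) (k * f x) = k * \int[mu]_(x in A) f x.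
Proof.
move=> k0 [mf f0] mA; rewrite ge0_integralZl//.
exact: measurable_funS mf.
Qed.

Lemma int_in_series (f : nat -> X -> \bar R) (A : set X) :
  (forall n, nnm (f n)) -> measurable A ->
  \int[mu]_(x in A) (\sum_(n <oo) f n x) = \sum_(n <oo) \int[mu]_(x in A) f n x.
Proof.
move=> nf mA; rewrite integral_nneseries// => [n|n x _]; last by case: (nf n).
by apply: (measurable_funS (E := setT)) => //; case: (nf n).
Qed.

Lemma int_cst (c : \bar R) (A : set X) : 0 <= c -> measurable A ->
  \int[mu]_(x in A) c = c * mu A.
Proof. by move=> c0 mA; rewrite integral_cst. Qed.

Lemma int_in_gt0 (u : X -> R) (A : set X) : measurable_fun setT u ->
  (forall x, (0 < u x)%R) -> measurable A -> 0 < mu A ->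
  0 < \int[mu]_(x in A) (u x)%:E.
Proof.
move=> mu_ u0 mA A0.
have nu : nnm (fun x => (u x)%:E) by apply: nnm_EFin => // x; exact: ltW.
rewrite lt_neqAle int_in_ge0// andbT eq_sym; apply/eqP => H.
have mu_u : measurable_fun A (fun x => (u x)%:E).
  exact: measurable_funS nu.1.
have /(ae_eq_integral_abs mu mA mu_u)[N [mN N0 AN]] :
    \int[mu]_(x in A) `|(u x)%:E| = 0.
  by rewrite -[RHS]H; apply: eq_integral => x _; rewrite gee0_abs//; case: nu.
have : mu A <= mu N.
  apply: le_measure; rewrite ?inE// => x Ax; apply: AN => /= /(_ Ax)/eqP.
  by rewrite eqe gt_eqF.
by rewrite N0 leNgt A0.
Qed.

(** Continuity from below: it passes from finite subfamilies to the whole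
    countable family. *)
Lemma int_bigcup_le f (A : nat -> set X) (c : \bar R) : nnm f ->
  (forall n, measurable (A n)) ->
  (forall N, \int[mu]_(x in \big[setU/set0]_(n < N) A n) f x <= c) ->
  \int[mu]_(x in \bigcup_n A n) f x <= c.
Proof.
move=> nf mA H.
pose U N := \big[setU/set0]_(n < N) A n.
have mU N : measurable (U N) by apply: bigsetU_measurable.
have UE x : inde (\bigcup_n A n) x * f x = limn (fun N => inde (U N) x * f x).
  apply/esym/cvg_lim => //.
  have [[n _ An]|nA] := pselect ((\bigcup_n A n) x).
    rewrite inde_in; last by exists n.
    apply: cvg_near_cst; exists n.+1 => // m /= nm.
    rewrite inde_in // /U -bigcup_mkord; exists n => //=.
  rewrite inde_out// mul0e; apply: cvg_near_cst; near=> m.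
  rewrite inde_out ?mul0e// /U -bigcup_mkord => -[n _ An]; apply: nA.
  by exists n.
rewrite int_inde.
under eq_integral do rewrite UE.
have nU N : nnm (fun x => inde (U N) x * f x) by nnm.
rewrite monotone_convergence//; last 3 first.
- by move=> N; case: (nU N).
- by move=> N x _; case: (nU N).
- move=> x _ m n mn; apply: lee_wpmul2r; first by case: nf.
  have [Um|nUm] := pselect (U m x); last by rewrite inde_out// inde_ge0.
  rewrite !inde_in//; move: Um; rewrite /U -!bigcup_mkord => -[i /= im Ai].
  by exists i => //=; exact: leq_trans mn.
apply: lime_le => [|]; last by near=> N; rewrite -int_inde; exact: H.
apply: ereal_nondecreasing_is_cvgn => m n mn; apply: int_le => // x.
apply: lee_wpmul2r; first by case: nf.
have [Um|nUm] := pselect (U m x); last by rewrite inde_out// inde_ge0.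
rewrite !inde_in//; move: Um; rewrite /U -!bigcup_mkord => -[i /= im Ai].
by exists i => //=; exact: leq_trans mn.
Unshelve. all: by end_near. Qed.

End integral.

(** * Powers and dyadic series of extended reals *)

Section powers.
Context {R : realType}.
Local Open Scope ereal_scope.
Implicit Types x y : \bar R.

Lemma le_powR (x y r : R) : (0 <= r -> 0 <= x -> x <= y -> x `^ r <= y `^ r)%R.
Proof.
by move=> r0 x0 xy; rewrite ge0_ler_powR// nnegrE (le_trans x0).
Qed.

Lemma le_poweR x y (r : R) : (0 <= r)%R -> 0 <= x -> x <= y ->
  x `^ r <= y `^ r.
Proof.
move=> r0 x0 xy; apply: gt0_ler_poweR => //.
  by rewrite in_itv /= x0 leey.
by rewrite in_itv /= (le_trans x0 xy) leey.
Qed.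

Lemma poweRK x (r : R) : (r != 0)%R -> 0 <= x -> (x `^ r) `^ r^-1 = x.
Proof. by move=> r0 x0; rewrite -poweRrM mulfV// poweRe1. Qed.

Lemma poweRVK x (r : R) : (r != 0)%R -> 0 <= x -> (x `^ r^-1) `^ r = x.
Proof. by move=> r0 x0; rewrite -poweRrM mulVf// poweRe1. Qed.

Lemma powR_exprn (x q : R) n : (0 <= x)%R -> ((x ^+ n) `^ q = (x `^ q) ^+ n)%R.
Proof.
by move=> x0; rewrite -(powR_mulrn n x0) -(powR_mulrn n (powR_ge0 x q)) -!powRrM mulrC.
Qed.

Lemma poweRV_le_mul x y (q c : R) : (0 < q)%R -> (0 <= c)%R -> 0 <= x -> 0 <= y ->
  x `^ q^-1 <= c%:E * y `^ q^-1 -> x <= (c `^ q)%:E * y.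
Proof.
move=> q0 c0 x0 y0 /(le_poweR (ltW q0) (poweR_ge0 _ _)).
by rewrite poweRVK ?gt_eqF// poweRM ?lee_fin ?poweR_ge0// poweRVK ?gt_eqF.
Qed.

Lemma geometric_eseries (rho : R) : (0 <= rho < 1)%R ->
  \sum_(n <oo) (rho ^+ n)%:E = ((1 - rho)^-1)%:E.
Proof.
move=> /andP[r0 r1].
have rn : (`|rho| < 1)%R by rewrite ger0_norm.
have -> : (fun n => \sum_(0 <= i < n) (rho ^+ i)%:E) =
    EFin \o series (geometric 1 rho).
  apply/funext => n /=; rewrite /series/= sumEFin; congr EFin.
  by apply: eq_bigr => i _; rewrite mul1r.
rewrite EFin_lim; last exact: is_cvg_geometric_series.
by have /cvg_lim -> := @cvg_geometric_series R 1 rho rn; rewrite ?div1r.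
Qed.

Lemma nneseries_ge_term (b : nat -> \bar R) j : (forall n, 0 <= b n) ->
  b j <= \sum_(n <oo) b n.
Proof.
move=> b0; apply: le_trans (nneseries_lim_ge j.+1 _) => //.
by rewrite big_nat_recr//= leeDr// sume_ge0.
Qed.

(** Replaces Jensen's inequality, and works for every exponent [q > 0]: each
    term is at most the [q]-th root of the right-hand series, and the weights
    are summable. *)
Lemma poweR_geometric_series (rho q : R) (b : nat -> \bar R) :
  (0 <= rho < 1)%R -> (0 < q)%R -> (forall n, 0 <= b n) ->
  (\sum_(n <oo) ((rho ^+ n)%:E * b n)) `^ q <=
    (((1 - rho)^-1) `^ q)%:E * \sum_(n <oo) (b n `^ q).
Proof.
move=> r01 q0 b0; have /andP[r0 r1] := r01.
set S := \sum_(n <oo) (b n `^ q).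
have S0 : 0 <= S by apply: nneseries_ge0 => n _ _; exact: poweR_ge0.
have c0 : (0 < ((1 - rho)^-1) `^ q)%R by rewrite powR_gt0// invr_gt0 subr_gt0.
have [->|Sfin] := eqVneq S +oo; first by rewrite gt0_muley ?lte_fin ?leey.
have {}Sfin : S \is a fin_num by rewrite ge0_fin_numE// lt_neqAle Sfin leey.
have bS n : b n <= S `^ q^-1.
  rewrite -[leLHS](@poweRK _ q)// ?gt_eqF//; apply: le_poweR.
  - by rewrite invr_ge0 ltW.
  - exact: poweR_ge0.
  - by apply: (@nneseries_ge_term (fun n => b n `^ q)) => m; exact: poweR_ge0.
have -> : (((1 - rho)^-1) `^ q)%:E * S = (((1 - rho)^-1)%:E * S `^ q^-1) `^ q.
  rewrite poweRM ?poweR_ge0 ?lee_fin ?invr_ge0 ?subr_ge0 1?ltW//.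
  by rewrite poweRVK ?gt_eqF// poweR_EFin.
apply: le_poweR; first exact: ltW.
  by apply: nneseries_ge0 => n _ _; rewrite mule_ge0// lee_fin exprn_ge0.
apply: (@le_trans _ _ (\sum_(n <oo) ((fine (S `^ q^-1))%:E * (rho ^+ n)%:E))).
  apply: lee_nneseries => [n _ _|n _].
    by rewrite mule_ge0// lee_fin exprn_ge0.
  rewrite fineK ?fin_num_poweR// muleC lee_wpmul2r// lee_fin exprn_ge0//.
rewrite nneseriesZl; last by move=> n _; rewrite lee_fin exprn_ge0.
by rewrite geometric_eseries// fineK ?fin_num_poweR// muleC.
Qed.

Lemma poweRD_le x y (q : R) : (0 < q)%R -> 0 <= x -> 0 <= y ->
  (x + y) `^ q <= (2 `^ q)%:E * (x `^ q + y `^ q).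
Proof.
move=> q0 x0 y0.
have H a b : 0 <= a -> a <= b -> (a + b) `^ q <= (2 `^ q)%:E * (a `^ q + b `^ q).
  move=> a0 ab; have b0 := le_trans a0 ab.
  apply: (@le_trans _ _ ((2%:E * b) `^ q)).
    apply: le_poweR; [exact: ltW|exact: adde_ge0|].
    by rewrite mule_natl mule2n leeD2r.
  rewrite poweRM// poweR_EFin lee_wpmul2l ?lee_fin ?powR_ge0//.
  by rewrite leeDr// poweR_ge0.
have [xy|/ltW yx] := leP x y; first exact: H.
by rewrite addeC [X in _ * X]addeC; exact: H.
Qed.

Definition b2e (b : bool) : \bar R := if b then 1 else 0.

Lemma b2e_ge0 b : 0 <= b2e b. Proof. by case: b. Qed.

Lemma b2e_le (b c : bool) : (b -> c) -> b2e b <= b2e c.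
Proof. by case: b c => -[] H; rewrite ?lexx ?lee01 ?(H isT)//; have := H isT. Qed.

Lemma archi_exp (be x : R) : (2 <= be)%R -> exists n : nat, (x < be ^+ n)%R.
Proof.
move=> be2; exists (Num.bound `|x|).
apply: (@lt_le_trans _ _ ((Num.bound `|x|)%:R)).
  by apply: le_lt_trans (ler_norm x) _; exact: archi_boundP.
apply: (@le_trans _ _ (2 ^+ Num.bound `|x|)%R).
  by rewrite -natrX ler_nat ltnW// ltn_expl.
by apply: lerXn2r; rewrite ?nnegrE// (le_trans _ be2).
Qed.

Lemma exp_bracket (be t y : R) : (2 <= be)%R -> (0 < t)%R -> (t < y)%R ->
  exists j : nat, (be ^+ j * t < y <= be ^+ j.+1 * t)%R.
Proof.
move=> be2 t0 ty.
have ex : exists n : nat, (y <= be ^+ n * t)%R.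
  have [n yn] := archi_exp (y / t)%R be2.
  by exists n; rewrite -ler_pdivrMr// ltW.
case: (ex_minnP ex) => -[|m] ym mmin.
  by move: ym; rewrite mul1r leNgt ty.
exists m; rewrite ym andbT ltNge; apply/negP => /mmin.
by rewrite ltnn.
Qed.

Lemma dyadic_bracket_le (y t : R) : (0 < y)%R -> (y <= t)%R ->
  exists j : nat, (2 ^+ j * y <= t < 2 ^+ j.+1 * y)%R.
Proof.
move=> y0 yt; have t0 := lt_le_trans y0 yt.
have ex : exists n : nat, (t < 2 ^+ n.+1 * y)%R.
  have [n tn] := archi_exp (t / y)%R (lexx 2%R).
  exists n; rewrite -ltr_pdivrMr//; apply: lt_le_trans tn _.
  by rewrite ler_eXn2l ?ltr1n.
case: (ex_minnP ex) => -[|m] ym mmin; first by exists 0%N; rewrite mul1r yt ym.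
exists m.+1; rewrite ym andbT leNgt; apply/negP => /mmin.
by rewrite ltnn.
Qed.

(** If [be ^ j t < y <= be ^ j.+1 t], then the [j]-th term alone is at least
    [y ^ q / be ^ q]. An infinite [y] is exhausted by finite values. *)
Lemma le_exp_series (be t q : R) y : (2 <= be)%R -> (0 < t)%R -> (0 < q)%R -> t%:E < y ->
  y `^ q <= (be `^ q)%:E *
    \sum_(j <oo) (((be ^+ j * t) `^ q)%:E * b2e ((be ^+ j * t)%:E < y)).
Proof.
move=> be2 t0 q0; have be0 : (0 < be)%R by exact: lt_le_trans be2.
set S := fun y : \bar R =>
  \sum_(j <oo) (((be ^+ j * t) `^ q)%:E * b2e ((be ^+ j * t)%:E < y)).
have term0 (z : \bar R) j :
    0 <= ((be ^+ j * t) `^ q)%:E * b2e ((be ^+ j * t)%:E < z).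
  by rewrite mule_ge0 ?b2e_ge0// lee_fin powR_ge0.
have c0 : (0 < be `^ q)%R by rewrite powR_gt0.
have fin (z : R) : (t < z)%R -> z%:E `^ q <= (be `^ q)%:E * S z%:E.
  move=> tz; have [j /andP[jz zj]] := exp_bracket be2 t0 tz.
  apply: (@le_trans _ _ (((be `^ q)%:E * ((be ^+ j * t) `^ q)%:E))).
    rewrite poweR_EFin -EFinM lee_fin -powRM ?(ltW be0)//; last first.
      by rewrite mulr_ge0 ?exprn_ge0// ltW.
    apply: le_powR; [exact: ltW|by rewrite ltW// (lt_trans t0)|].
    by rewrite mulrA -exprS.
  rewrite lee_wpmul2l ?lee_fin ?powR_ge0//.
  apply: le_trans (nneseries_ge_term j (term0 z%:E)).
  by rewrite lte_fin jz mule1.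
case: y => [y|_|//]; first by rewrite lte_fin; exact: fin.
rewrite poweRyr ?gt_eqF// leye_eq; apply/eqP/eqyP => r r0.
have Sle : S (((2 * t) `^ q + r) `^ q^-1)%:E <= S +oo.
  apply: lee_nneseries => [j _ _|j _]; first exact: term0.
  rewrite lee_wpmul2l ?lee_fin ?powR_ge0//.
  by apply: b2e_le; rewrite ltry.
apply: le_trans (_ : (be `^ q)%:E * S (((2 * t) `^ q + r) `^ q^-1)%:E <= _); last first.
  by rewrite lee_wpmul2l ?lee_fin ?powR_ge0.
have t2 : (0 <= 2 * t)%R by rewrite mulr_ge0// ltW.
have z0 : (0 <= (2 * t) `^ q + r)%R by rewrite addr_ge0 ?powR_ge0// ltW.
have tz : (t < ((2 * t) `^ q + r) `^ q^-1)%R.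
  apply: (@lt_le_trans _ _ (2 * t)%R); first by rewrite mulr_natl mulr2n ltrDl.
  rewrite -[leLHS]powRr1// -(@mulfV _ q) ?gt_eqF// powRrM.
  by apply: le_powR; rewrite ?powR_ge0 ?invr_ge0 ?lerDl// ltW.
apply: le_trans (fin _ tz).
by rewrite poweR_EFin -powRrM mulVf ?gt_eqF// powRr1 ?lee_fin ?lerDr ?powR_ge0.
Qed.

Lemma le_dyadic_series (t q : R) y : (0 < t)%R -> (0 < q)%R -> t%:E < y ->
  y `^ q <= (2 `^ q)%:E *
    \sum_(j <oo) (((2 ^+ j * t) `^ q)%:E * b2e ((2 ^+ j * t)%:E < y)).
Proof. exact: le_exp_series. Qed.

(** Conversely, the terms that occur form a geometric progression, dominated by
    its last term. The induction on the partial sums needs two bounds: one that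
    refers to [y], and one that refers to the next height and survives adding a
    term. *)
Lemma dyadic_series_le (t a : R) y : (0 < t)%R -> (0 < a)%R -> 0 <= y ->
  \sum_(j <oo) (((2 ^+ j * t) `^ a)%:E * b2e ((2 ^+ j * t)%:E < y)) <=
  ((1 - 2 `^ (- a))^-1)%:E * y `^ a.
Proof.
move=> t0 a0 y0; set C := ((1 - 2 `^ (- a))^-1)%R.
have c1 : ((2:R) `^ (- a) < 1)%R.
  rewrite powRN invf_lt1 ?powR_gt0//.
  have : (1 `^ a < (2:R) `^ a)%R by apply: gt0_ltr_powR; rewrite ?nnegrE ?ltr1n.
  by rewrite powR1.
have C0 : (0 < C)%R by rewrite invr_gt0 subr_gt0.
have CE : (C * 2 `^ (- a) + 1 = C)%R.
  by rewrite /C; field; rewrite subr_eq0 eq_sym lt_eqF.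
case: y y0 => [y|_|//]; last first.
  by rewrite poweRyr ?gt_eqF// gt0_muley ?lte_fin ?leey.
rewrite lee_fin => y0.
have tn n : (0 <= 2 ^+ n * t)%R by rewrite mulr_ge0 ?exprn_ge0// ltW.
apply: lime_le.
  apply: is_cvg_nneseries => n _ _.
  by rewrite mule_ge0 ?b2e_ge0// lee_fin powR_ge0.
apply: nearW => n; rewrite poweR_EFin -EFinM.
suff : \sum_(0 <= j < n) (((2 ^+ j * t) `^ a)%:E * b2e ((2 ^+ j * t)%:E < y%:E))
    <= (C * y `^ a)%:E /\
  \sum_(0 <= j < n) (((2 ^+ j * t) `^ a)%:E * b2e ((2 ^+ j * t)%:E < y%:E))
    <= (C * ((2 ^+ n * t) `^ a * 2 `^ (- a)))%:E by case.
elim: n => [|n [ih1 ih2]].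
  by rewrite big_geq// !lee_fin !mulr_ge0 ?powR_ge0// ltW.
rewrite big_nat_recr//= lte_fin.
have -> : ((2 ^+ n.+1 * t) `^ a * 2 `^ (- a) = (2 ^+ n * t) `^ a)%R.
  rewrite exprS -mulrA powRM// mulrAC -powRD ?subrr ?powRr0 ?mul1r//.
  by rewrite pnatr_eq0 implybT.
case: ltP => ny /=; last first.
  rewrite mule0 adde0; split => //; apply: (le_trans ih2).
  rewrite lee_fin ler_wpM2l// ?(ltW C0)// ler_piMr ?powR_ge0//.
  exact: ltW.
rewrite mule1; have H : \sum_(0 <= i < n) (((2 ^+ i * t) `^ a)%:E *
     b2e ((2 ^+ i * t)%:E < y%:E)) + ((2 ^+ n * t) `^ a)%:E <=
     (C * (2 ^+ n * t) `^ a)%:E.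
  rewrite -CE mulrDl mul1r EFinD leeD2r// (le_trans ih2)//.
  by rewrite lee_fin mulrA mulrAC.
split; last exact: H.
apply: (le_trans H); rewrite lee_fin ler_wpM2l// ?(ltW C0)//.
by apply: le_powR; [exact: ltW|exact: tn|exact: ltW].
Qed.

(** Below [t] one term of the series suffices, the one with
    [t / 2 ^ j.+1 < y <= t / 2 ^ j]. *)
Lemma le_dyadic_series_down (t q y : R) : (0 < t)%R -> (0 < q)%R ->
  (0 <= y <= t)%R ->
  (y `^ q)%:E <= \sum_(j <oo) (((t / 2 ^+ j) `^ q)%:E *
     b2e ((t / 2 ^+ j.+1)%:E < y%:E)).
Proof.
move=> t0 q0 /andP[y0 yt].
have term0 j : 0 <= ((t / 2 ^+ j) `^ q)%:E * b2e ((t / 2 ^+ j.+1)%:E < y%:E).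
  by rewrite mule_ge0 ?b2e_ge0// lee_fin powR_ge0.
have [y00|yN0] := eqVneq y 0%R.
  rewrite {1}y00 powR0 ?gt_eqF//; apply: nneseries_ge0 => n _ _; exact: term0.
have {}y0 : (0 < y)%R by rewrite lt_neqAle eq_sym yN0.
have [j /andP[jy yj]] := dyadic_bracket_le y0 yt.
apply: le_trans (nneseries_ge_term j term0).
rewrite lte_fin ltr_pdivrMr ?exprn_gt0//.
rewrite [(y * _)%R]mulrC yj mule1 lee_fin; apply: le_powR; [exact: ltW|exact: ltW|].
by rewrite ler_pdivlMr ?exprn_gt0// mulrC.
Qed.

End powers.

(** * Countable families of balls and their maximal operators *)

Section family.
Context {d : measure_display} {X : measurableType d} {R : realType}.
Variable mu : {measure set X -> \bar R}.

(** All the geometry that the analysis uses. The map [star] is a dilation: it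
    sends a ball to one that contains every ball of at most twice the radius
    meeting it. The family is countable so that maximal functions are
    measurable, although balls need not be open. *)
Record ball_family (B : nat -> set X) (r : nat -> R) (star : nat -> nat)
    (K : R) : Prop := BallFamily {
  bf_meas : forall n, measurable (B n);
  bf_gt0 : forall n, (0 < mu (B n))%E;
  bf_fin : forall n, (mu (B n) < +oo)%E;
  bf_r0 : forall n, 0 < r n;
  bf_star_r : forall n, 2 * r n < r (star n);
  bf_engulf : forall m n, B m `&` B n !=set0 -> r m <= 2 * r n ->
    B m `<=` B (star n);
  bf_doubling : forall n, (mu (B (star n)) <= K%:E * mu (B n))%E;
  bf_join : forall x y, exists m, B m x /\ B m y }.

Variables (B : nat -> set X) (r : nat -> R) (star : nat -> nat) (K : R).
Hypothesis BF : ball_family B r star K.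
Local Notation mB := (bf_meas BF).

Lemma bf_nonempty n : B n !=set0.
Proof.
apply/set0P; apply/eqP => Bn0.
by have := bf_gt0 BF n; rewrite Bn0 measure0 ltxx.
Qed.

Lemma bf_sub_star n : B n `<=` B (star n).
Proof.
apply: (bf_engulf BF); first by rewrite setIid; exact: bf_nonempty.
by rewrite ler_peMl ?ler1n// ltW// (bf_r0 BF).
Qed.

Lemma bf_star_r_gt n : r n < r (star n).
Proof.
apply: le_lt_trans (bf_star_r BF n).
by rewrite ler_peMl ?ler1n// ltW// (bf_r0 BF).
Qed.

Lemma max_radius (s : seq nat) n : n \in s ->
  exists2 m, m \in s & forall k, k \in s -> r k <= r m.
Proof.
elim: s n => // a s ih n _; case: s ih => [_|b s ih].
  by exists a => [|k]; rewrite !inE// => /eqP ->.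
have [m ms mmax] := ih b (mem_head _ _).
have [am|/ltW ma] := leP (r a) (r m).
  exists m => [|k]; first by rewrite inE ms orbT.
  by rewrite inE => /orP[/eqP ->//|/mmax].
exists a => [|k]; first exact: mem_head.
by rewrite inE => /orP[/eqP ->//|/mmax km]; exact: le_trans ma.
Qed.

(** Vitali's covering lemma for finitely many balls: keep a ball of maximal
    radius, discard all those it meets, and repeat. *)
Lemma vitali_finite (s : seq nat) : exists t : seq nat,
  [/\ {subset t <= s}, uniq t, trivIset [set` t] B &
      forall n, n \in s -> exists2 m, m \in t & B n `<=` B (star m)].
Proof.
have [k] := ubnP (size s); elim: k s => // k ih s sk.
case: s sk => [|a s] sk; first by exists [::]; split => //= i j; rewrite /= in_nil.
have [m ms mmax] := max_radius (mem_head a s).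
set P := fun n => ~~ `[< B n `&` B m !=set0 >].
have Pm : ~~ P m by rewrite negbK; apply/asboolP; rewrite setIid; exact: bf_nonempty.
have : (size ([seq n <- a :: s | P n]) < k)%N.
  rewrite -ltnS; apply: leq_trans sk; rewrite ltnS size_filter.
  rewrite ltn_neqAle count_size andbT -all_count; apply/negP => /allP/(_ _ ms).
  by rewrite (negbTE Pm).
move=> /ih[t [ts ut dt cov]].
have Pt n : n \in t -> P n by move=> /ts; rewrite mem_filter => /andP[].
exists (m :: t); split.
- move=> n; rewrite inE => /orP[/eqP -> //|/ts].
  by rewrite mem_filter => /andP[].
- by rewrite /= ut andbT; apply/negP => /Pt; exact/negP.
- move=> i j /=; rewrite !inE => /orP[/eqP ->|it] /orP[/eqP ->|jt] //.
  + move=> mj; exfalso; have /negP := Pt _ jt; apply; apply/asboolP.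
    by rewrite setIC.
  + by move=> im; exfalso; have /negP := Pt _ it; apply; apply/asboolP.
  + by apply: dt.
- move=> n ns; have [Pn|/negPn/asboolP nm] := boolP (P n).
    have /cov[l lt nl] : n \in [seq n <- a :: s | P n] by rewrite mem_filter Pn.
    by exists l => //; rewrite inE lt orbT.
  exists m; first exact: mem_head.
  apply: (bf_engulf BF) => //; apply: (le_trans (mmax _ ns)).
  by rewrite ler_peMl ?ler1n// ltW// (bf_r0 BF).
Qed.

Record good_weight (u : X -> R) : Prop := GoodWeight {
  gw_meas : measurable_fun setT u;
  gw_gt0 : forall x, 0 < u x;
  gw_fin : forall n, (\int[mu]_(x in B n) (u x)%:E < +oo)%E }.

Definition wr (u : X -> R) (n : nat) : R :=
  fine (\int[mu]_(x in B n) (u x)%:E)%E.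

Local Open Scope ereal_scope.

(** Means and maximal functions are taken with respect to the measure [u dmu].
    Besides [u = 1], Muckenhoupt's theorem uses [u = w] and the dual weight. *)
Definition av (u : X -> R) (f : X -> \bar R) (n : nat) : \bar R :=
  ((wr u n)^-1)%:E * \int[mu]_(x in B n) (f x * (u x)%:E).

Definition Mx (u : X -> R) (f : X -> \bar R) (x : X) : \bar R :=
  ereal_sup (range (fun n => inde (B n) x * av u f n)).

Lemma nnm_weight u : good_weight u -> nnm (fun x => (u x)%:E).
Proof.
by move=> gu; apply: nnm_EFin => [|x]; [exact: gw_meas|rewrite ltW// gw_gt0].
Qed.

Lemma int_weight_gt0 u (A : set X) : good_weight u -> measurable A ->
  0 < mu A -> 0 < \int[mu]_(x in A) (u x)%:E.
Proof. by move=> gu; apply: int_in_gt0 => [|x]; [exact: gw_meas gu|exact: gw_gt0]. Qed.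

Lemma wrE u n : good_weight u -> \int[mu]_(x in B n) (u x)%:E = (wr u n)%:E.
Proof.
move=> gu; rewrite /wr fineK// ge0_fin_numE ?(gw_fin gu)//.
exact: int_in_ge0 (nnm_weight gu).
Qed.

Lemma wr_gt0 u n : good_weight u -> (0 < wr u n)%R.
Proof.
move=> gu; rewrite -lte_fin -wrE//.
exact: int_weight_gt0 (mB n) (bf_gt0 BF n).
Qed.

Lemma av_ge0 u f n : good_weight u -> nnm f -> 0 <= av u f n.
Proof.
move=> gu nf; rewrite mule_ge0//; first by rewrite lee_fin invr_ge0 ltW ?wr_gt0.
by have nu := nnm_weight gu; apply: int_in_ge0; nnm.
Qed.

Lemma nnm_Mx u f : good_weight u -> nnm f -> nnm (Mx u f).
Proof.
move=> gu nf; apply: nnm_sup => n; apply: nnmM.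
  exact: nnm_inde (mB n).
exact: nnm_cst (av_ge0 n gu nf).
Qed.

Lemma Mx_ge u f n x : B n x -> av u f n <= Mx u f x.
Proof.
move=> Bx; apply: le_ereal_sup_tmp; exists (inde (B n) x * av u f n).
  by exists n.
by rewrite inde_in// mul1e.
Qed.

Lemma Mx_le u f x c : 0 <= c -> (forall n, B n x -> av u f n <= c) ->
  Mx u f x <= c.
Proof.
move=> c0 H; apply: ge_ereal_sup => _ [n _ <-].
have [Bx|nBx] := pselect (B n x); first by rewrite inde_in// mul1e H.
by rewrite inde_out// mul0e.
Qed.

Lemma Mx_gt u f x c : 0 <= c -> c < Mx u f x ->
  exists2 n, B n x & c < av u f n.
Proof.
move=> c0 /ereal_sup_gt[_ [n _ <-]].
have [Bx|nBx] := pselect (B n x); first by rewrite inde_in// mul1e; exists n.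
by rewrite inde_out// mul0e ltNge c0.
Qed.

Lemma av_mono u f g n : good_weight u -> nnm f -> nnm g ->
  (forall x, B n x -> f x <= g x) -> av u f n <= av u g n.
Proof.
move=> gu nf ng fg; have nu := nnm_weight gu.
rewrite lee_wpmul2l//; first by rewrite lee_fin invr_ge0 ltW ?wr_gt0.
apply: int_in_le; [by nnm|by nnm|exact: mB|].
by move=> x Bx; rewrite lee_wpmul2r// ?fg//; case: nu.
Qed.

Lemma Mx_mono u f g x : good_weight u -> nnm f -> nnm g ->
  (forall x, f x <= g x) -> Mx u f x <= Mx u g x.
Proof.
move=> gu nf ng fg; apply: Mx_le; first by case: (nnm_Mx gu ng).
by move=> n Bx; apply: le_trans (Mx_ge _ _ Bx); exact: av_mono.
Qed.

Lemma avD u f g n : good_weight u -> nnm f -> nnm g ->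
  av u (fun x => f x + g x) n = av u f n + av u g n.
Proof.
move=> gu nf ng; have nu := nnm_weight gu; rewrite /av -muleDr//; last first.
  by apply: ge0_adde_def; rewrite inE int_in_ge0//; nnm.
congr (_ * _); rewrite -int_inD; [|by nnm|by nnm|exact: mB].
by apply: eq_integral => x _; rewrite ge0_muleDl//; [case: nf|case: ng].
Qed.

Lemma Mx_subadditive u f g x : good_weight u -> nnm f -> nnm g ->
  Mx u (fun x => f x + g x) x <= Mx u f x + Mx u g x.
Proof.
move=> gu nf ng; have := nnm_Mx gu nf; have := nnm_Mx gu ng.
move=> [_ g0] [_ f0]; apply: Mx_le; first exact: adde_ge0.
by move=> n Bx; rewrite avD// leeD// Mx_ge.
Qed.

Lemma av_series u (f : nat -> X -> \bar R) n : good_weight u ->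
  (forall k, nnm (f k)) ->
  av u (fun x => \sum_(k <oo) f k x) n = \sum_(k <oo) av u (f k) n.
Proof.
move=> gu nf; have nu := nnm_weight gu.
rewrite /av nneseriesZl; last by move=> k _; apply: int_in_ge0; nnm.
congr (_ * _); rewrite -int_in_series; [|by move=> k; nnm|exact: mB].
apply: eq_integral => x _; rewrite muleC -nneseriesZl//; last first.
  by move=> k _; case: (nf k).
by apply: eq_eseriesr => k _; rewrite muleC.
Qed.

Lemma Mx_series u (f : nat -> X -> \bar R) x : good_weight u ->
  (forall k, nnm (f k)) ->
  Mx u (fun x => \sum_(k <oo) f k x) x <= \sum_(k <oo) Mx u (f k) x.
Proof.
move=> gu nf; apply: Mx_le.
  by apply: nneseries_ge0 => k _ _; case: (nnm_Mx gu (nf k)).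
move=> n Bx; rewrite av_series//; apply: lee_nneseries => k _.
  by move=> _; exact: av_ge0.
exact: Mx_ge.
Qed.

Lemma avZ u (c : R) f n : good_weight u -> nnm f -> (0 <= c)%R ->
  av u (fun x => c%:E * f x) n = c%:E * av u f n.
Proof.
move=> gu nf c0; have nu := nnm_weight gu; rewrite /av muleCA; congr (_ * _).
rewrite -int_inZ ?lee_fin//; [|by nnm|exact: mB].
by apply: eq_integral => x _; rewrite muleA.
Qed.

Lemma MxZ u (c : R) f x : good_weight u -> nnm f -> (0 <= c)%R ->
  Mx u (fun x => c%:E * f x) x <= c%:E * Mx u f x.
Proof.
move=> gu nf c0; apply: Mx_le.
  by rewrite mule_ge0 ?lee_fin//; case: (nnm_Mx gu nf).
by move=> n Bx; rewrite avZ// lee_wpmul2l ?lee_fin// Mx_ge.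
Qed.

Lemma int_bigsetU_le (f : X -> \bar R) (F : nat -> set X) (s : seq nat) :
  nnm f -> (forall n, measurable (F n)) ->
  \int[mu]_(x in \big[setU/set0]_(i <- s) F i) f x <=
  \sum_(i <- s) \int[mu]_(x in F i) f x.
Proof.
move=> nf mF; elim: s => [|a s ih]; first by rewrite !big_nil integral_set0.
have mU : measurable (\big[setU/set0]_(i <- s) F i) by exact: bigsetU_measurable.
rewrite !big_cons; apply: (@le_trans _ _
    (\int[mu]_(x in F a) f x + \int[mu]_(x in \big[setU/set0]_(i <- s) F i) f x)).
  set U := \big[setU/set0]_(i <- s) F i in mU *.
  rewrite (int_inde mu (F a `|` U)) (int_inde mu (F a)) (int_inde mu U).
  rewrite -intD; [|by nnm|by nnm].
  have nU : nnm (fun x => inde (F a `|` U) x * f x).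
    by apply: nnmM => //; apply: nnm_inde; exact: measurableU.
  have nFU : nnm (fun x => inde (F a) x * f x + inde U x * f x) by nnm.
  apply: (int_le mu nU nFU).
  move=> x; rewrite -ge0_muleDl ?inde_ge0//; apply: lee_wpmul2r; first by case: nf.
  have [|nFaU] := pselect ((F a `|` U) x).
    by case=> H; rewrite [leLHS]inde_in; [|by left| |by right];
      rewrite (inde_in H) ?leeDl ?leeDr// inde_ge0.
  by rewrite inde_out// adde_ge0// inde_ge0.
by rewrite leeD2l.
Qed.

Lemma int_trivIset_le (f : X -> \bar R) (F : nat -> set X) (s : seq nat)
    (D : set X) :
  nnm f -> (forall n, measurable (F n)) -> uniq s -> trivIset [set` s] F ->
  measurable D -> (forall i, i \in s -> F i `<=` D) ->
  \sum_(i <- s) \int[mu]_(x in F i) f x <= \int[mu]_(x in D) f x.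
Proof.
move=> nf mF us ts mD FD.
have mU : measurable (\big[setU/set0]_(i <- s) F i) by exact: bigsetU_measurable.
rewrite -ge0_integral_bigsetU//; last 2 first.
- exact: measurable_funS nf.1.
- by move=> x _; case: nf.
apply: int_subset => // x; rewrite -bigcup_seq => -[i /= si].
exact: FD.
Qed.

Definition dbl (u : X -> R) (L : R) := forall n, (wr u (star n) <= L * wr u n)%R.

(** Rejected balls are replaced by the empty set, so that a subfamily is again
    indexed by the natural numbers. *)
Definition sel (Q : nat -> bool) (n : nat) : set X := if Q n then B n else set0.

Lemma sel_measurable (Q : nat -> bool) n : measurable (sel Q n).
Proof. by rewrite /sel; case: (Q n) => //; exact: mB. Qed.

Lemma bigsetU_sel (Q : nat -> bool) N : exists s : seq nat, (forall n, n \in s -> Q n) /\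
  \big[setU/set0]_(n < N) sel Q n = \big[setU/set0]_(n <- s) B n.
Proof.
exists [seq n <- iota 0 N | Q n]; split=> [n|]; first by rewrite mem_filter => /andP[].
rewrite big_filter -(big_mkord xpredT (fun n => sel Q n)) /index_iota subn0.
rewrite [RHS]big_mkcond; apply: eq_bigr => n _.
by rewrite /sel.
Qed.

(** Reduction of an estimate for a countable union of balls to disjoint
    finite subfamilies. *)
Lemma vitali_int_le (Q : nat -> bool) (f : X -> \bar R) (c : \bar R) : nnm f ->
  (forall t : seq nat, uniq t -> trivIset [set` t] B ->
     (forall n, n \in t -> Q n) ->
     \sum_(n <- t) \int[mu]_(x in B (star n)) f x <= c) ->
  \int[mu]_(x in \bigcup_n sel Q n) f x <= c.
Proof.
move=> nf H; apply: int_bigcup_le => // [n|N]; first exact: sel_measurable.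
have [s [sQ ->]] := bigsetU_sel Q N.
have [t [ts ut dt cov]] := vitali_finite s.
apply: le_trans (H t ut dt (fun n nt => sQ _ (ts _ nt))).
have mU : measurable (\big[setU/set0]_(n <- t) B (star n)).
  by apply: bigsetU_measurable => n _; exact: mB.
apply: le_trans (int_bigsetU_le t nf (fun n => mB (star n))).
apply: int_subset => //; first by apply: bigsetU_measurable => n _; exact: mB.
move=> x; rewrite -!bigcup_seq => -[n /= /cov[m mt nm] Bx].
by exists m => //=; exact: nm.
Qed.

Lemma Mx_levelE u f (l : \bar R) : 0 <= l ->
  [set x | l < Mx u f x] = \bigcup_n sel (fun n => l < av u f n) n.
Proof.
move=> l0; apply/seteqP; split=> x /=.
  by move=> /Mx_gt[//|n Bx ln]; exists n => //; rewrite /sel ln.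
move=> [n _]; rewrite /sel; case: ifP => // ln Bx.
exact: lt_le_trans (Mx_ge _ _ Bx).
Qed.

(** For disjoint balls on which the mean of [f] exceeds [l], the dilated balls
    have total weight at most [L] times that of the balls themselves, which is
    at most [L / l] times the integral of [f]. *)
Lemma Mx_weak_type u f (L l : R) : good_weight u -> dbl u L -> (0 <= L)%R ->
  nnm f -> (0 < l)%R ->
  l%:E * \int[mu]_(x in [set x | l%:E < Mx u f x]) (u x)%:E <=
  L%:E * \int[mu]_x (f x * (u x)%:E).
Proof.
move=> gu uL L0 nf l0; have nu := nnm_weight gu.
rewrite muleC -lee_pdivlMr//.
rewrite Mx_levelE; last by rewrite lee_fin ltW.
apply: (vitali_int_le nu) => t ut dt tQ.
rewrite lee_pdivlMr// muleC.
apply: (@le_trans _ _ (L%:E * \sum_(n <- t) \int[mu]_(x in B n) (f x * (u x)%:E))).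
  rewrite !ge0_sume_distrr; last 2 first.
  - by move=> n _; apply: int_in_ge0; nnm.
  - by move=> n _; apply: int_in_ge0; nnm.
  rewrite big_seq [leRHS]big_seq; apply: lee_sum => n nt.
  have := tQ _ nt; rewrite /av muleC lte_pdivlMr ?wr_gt0// => /ltW lB.
  rewrite wrE//; apply: (@le_trans _ _ (l%:E * (L%:E * (wr u n)%:E))).
    by rewrite lee_wpmul2l ?lee_fin ?(ltW l0)// uL.
  by rewrite muleCA lee_wpmul2l ?lee_fin.
rewrite lee_wpmul2l ?lee_fin//; apply: int_trivIset_le => //.
- by nnm.
- exact: mB.
Qed.

End family.

(** * The maximal theorem for doubling weights *)

Section strong.
Context {d : measure_display} {X : measurableType d} {R : realType}.
Variable mu : {measure set X -> \bar R}.
Local Open Scope ereal_scope.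

Lemma mule_poweRB1 (x : \bar R) (q : R) : 0 <= x -> (1 < q)%R ->
  x * x `^ (q - 1) = x `^ q.
Proof.
move=> x0 q1; have q0 : (0 < q)%R by exact: lt_trans q1.
case: x x0 => [x||//]; last first.
  by rewrite !poweRyr ?mulyy ?gt_eqF// subr_gt0.
by rewrite lee_fin => x0; rewrite !poweR_EFin -EFinM mulr_powRB1.
Qed.

Lemma nneseriesZr (a : nat -> \bar R) (k : \bar R) : (forall n, 0 <= a n) ->
  0 <= k -> \sum_(n <oo) (a n * k) = (\sum_(n <oo) a n) * k.
Proof.
move=> a0; case: k => [k k0|_|//].
  by under eq_eseriesr do rewrite muleC; rewrite nneseriesZl// muleC.
have [aN|/existsNP[n an]] := pselect (forall n, a n = 0).
  by rewrite !eseries0 ?mul0e// => n _ _; rewrite aN ?mul0e.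
have an0 : 0 < a n by rewrite lt_neqAle a0 andbT eq_sym; exact/eqP.
rewrite gt0_muley; last exact: lt_le_trans (nneseries_ge_term n a0).
by apply: (@nneseries_pinfty _ _ xpredT n) => [i _|//|]; rewrite ?mule_ge0// gt0_muley.
Qed.

Lemma b2e_inde (f : X -> \bar R) (c : \bar R) x :
  b2e (c < f x) = inde [set x | c < f x] x :> \bar R.
Proof.
have [cf|fc] := boolP (c < f x); first by rewrite inde_in.
by rewrite inde_out//= (negbTE fc).
Qed.

Lemma nnm_b2e (f : X -> \bar R) (c : \bar R) : nnm f ->
  nnm (fun x => b2e (c < f x) : \bar R).
Proof.
move=> nf; rewrite (_ : (fun x => _) = inde [set x | c < f x]); last first.
  by apply/funext => x; exact: b2e_inde.
by apply: nnm_inde; exact: nnm_gt.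
Qed.

Variables (B : nat -> set X) (r : nat -> R) (star : nat -> nat) (K : R).
Hypothesis BF : ball_family mu B r star K.
Local Notation mB := (bf_meas BF).
Local Notation good := (good_weight mu B).
Local Notation M := (Mx mu B).
Local Notation dbl := (dbl mu B star).

Lemma Mx_cst u (c : R) x : good u -> (0 <= c)%R -> M u (fun=> c%:E) x <= c%:E.
Proof.
move=> gu c0; apply: Mx_le; rewrite ?lee_fin// => n Bx.
have nu := nnm_weight gu.
rewrite /av int_inZ ?lee_fin//; last exact: mB.
have wr0 := wr_gt0 BF n gu.
by rewrite wrE// muleCA -!EFinM mulVf ?gt_eqF// mulr1.
Qed.

(** The part of [f] below [l / 2] adds at most [l / 2] to the maximal
    function. *)
Lemma Mx_level_le u f (l : R) x : good u -> nnm f -> (0 < l)%R ->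
  l%:E < M u f x ->
  (l / 2)%:E < M u (fun y => b2e ((l / 2)%:E < f y) * f y) x.
Proof.
move=> gu nf l0 lM; have l20 : (0 <= l / 2)%R by rewrite divr_ge0// ltW.
set g := fun y => _; have ng : nnm g by apply: nnmM => //; exact: nnm_b2e.
have : M u f x <= M u g x + (l / 2)%:E.
  apply: (@le_trans _ _ (M u (fun y => g y + (l / 2)%:E) x)).
    apply: (Mx_mono BF x gu nf); first by nnm; apply: nnm_b2e.
    move=> y; rewrite /g; case: ltP => /= h; last by rewrite mul0e add0e.
    by rewrite mul1e leeDl// lee_fin.
  have nc : nnm (fun _ : X => (l / 2)%:E) by nnm.
  apply: le_trans (Mx_subadditive BF x gu ng nc) _.
  by rewrite leeD2l//; exact: Mx_cst.
move=> /(lt_le_trans lM); rewrite {1}(splitr l) EFinD.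
by rewrite lteD2rE.
Qed.

(** The maximal theorem, by the layer cake formula over dyadic levels; the
    levels start at [t] and [t] is sent to [0]. *)
Lemma Mx_strong_type u (L q : R) : good u -> dbl u L -> (0 <= L)%R ->
  (1 < q)%R -> exists2 C : R, (0 < C)%R & forall f, nnm f ->
    \int[mu]_x (M u f x `^ q * (u x)%:E) <=
    C%:E * \int[mu]_x (f x `^ q * (u x)%:E).
Proof.
move=> gu uL L0 q1; have nu := nnm_weight gu.
have q0 : (0 < q)%R by exact: lt_trans q1.
have q10 : (0 < q - 1)%R by rewrite subr_gt0.
set c := ((1 - 2 `^ (- (q - 1)))^-1)%R.
pose C := (2 `^ q * (2 * L * 2 `^ (q - 1)) * `|c| + 1)%R.
exists C; first by rewrite ltr_wpDl// !mulr_ge0// powR_ge0.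
move=> f nf; have nM := nnm_Mx BF gu nf.
set I := \int[mu]_x (f x `^ q * (u x)%:E).
have I0 : 0 <= I by apply: int_ge0; nnm.
have step (t : R) : (0 < t)%R ->
    \int[mu]_(x in [set x | t%:E < M u f x]) (M u f x `^ q * (u x)%:E) <= C%:E * I.
  move=> t0; have tj j : (0 < 2 ^+ j * t)%R by rewrite mulr_gt0// exprn_gt0.
  have nb j : nnm (fun x => b2e ((2 ^+ j * t)%:E < M u f x) : \bar R).
    exact: nnm_b2e.
  have nb2 j : nnm (fun x => b2e ((2 ^+ j * t / 2)%:E < f x) : \bar R).
    exact: nnm_b2e.
  have npow j (a : R) : 0 <= ((2 ^+ j * t) `^ a)%:E by rewrite lee_fin powR_ge0.
  apply: (@le_trans _ _ (\int[mu]_x ((2 `^ q)%:E * \sum_(j <oo)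
     (((2 ^+ j * t) `^ q)%:E * b2e ((2 ^+ j * t)%:E < M u f x) * (u x)%:E)))).
    rewrite int_inde; apply: int_le.
    - by nnm; apply: nnm_gt.
    - by nnm.
    - move=> x; have [tM|tM] := pselect (t%:E < M u f x); last first.
        rewrite inde_out// mul0e mule_ge0 ?lee_fin ?powR_ge0//.
        apply: nneseries_ge0 => j _ _.
        by rewrite !mule_ge0 ?b2e_ge0// lee_fin ltW// (gw_gt0 gu).
      rewrite inde_in// mul1e.
      under eq_eseriesr do rewrite muleC.
      rewrite nneseriesZl; last by move=> j _; rewrite mule_ge0 ?b2e_ge0.
      rewrite muleCA muleC lee_wpmul2l//; first by case: nu.
      exact: le_dyadic_series.
  rewrite intZ ?lee_fin ?powR_ge0//; last by nnm; apply: npow.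
  rewrite int_series; last by move=> j; nnm; apply: npow.
  apply: (@le_trans _ _ ((2 `^ q)%:E * \sum_(j <oo)
     ((2 * L * 2 `^ (q - 1))%:E * \int[mu]_x (((2 ^+ j * (t / 2)) `^ (q - 1))%:E *
         b2e ((2 ^+ j * (t / 2))%:E < f x) * f x * (u x)%:E)))).
    rewrite lee_wpmul2l ?lee_fin ?powR_ge0//.
    apply: lee_nneseries => [j _ _|j _]; first by apply: int_ge0; nnm; apply: npow.
    under eq_integral do rewrite -muleA.
    rewrite intZ ?npow//; last by nnm.
    under [in leRHS]eq_integral do rewrite -!muleA.
    have jE : (2 ^+ j * (t / 2) = 2 ^+ j * t / 2)%R by rewrite mulrA.
    rewrite jE intZ ?lee_fin ?powR_ge0//; last by nnm.
    have -> : \int[mu]_x (b2e ((2 ^+ j * t)%:E < M u f x) * (u x)%:E) =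
        \int[mu]_(x in [set x | (2 ^+ j * t)%:E < M u f x]) (u x)%:E.
      by rewrite [RHS]int_inde; apply: eq_integral => x _; rewrite b2e_inde.
    set g := fun y => b2e ((2 ^+ j * t / 2)%:E < f y) * f y.
    have ng : nnm g by rewrite /g; nnm.
    have := Mx_weak_type BF gu uL L0 ng (divr_gt0 (tj j) (ltr0n R 2)).
    set J := \int[mu]_(x in _) _; set J' := \int[mu]_x (g x * _) => H.
    have JJ : \int[mu]_(x in [set x | (2 ^+ j * t)%:E < M u f x]) (u x)%:E <= J.
      apply: int_subset => //; [exact: nnm_gt| |].
        by apply: nnm_gt; exact: (nnm_Mx BF).
      by move=> x /=; exact: Mx_level_le.
    apply: (@le_trans _ _ (((2 ^+ j * t) `^ q)%:E * J)).
      by rewrite lee_wpmul2l.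
    have -> : ((2 ^+ j * t) `^ q =
        (2 * 2 `^ (q - 1) * (2 ^+ j * t / 2) `^ (q - 1)) * (2 ^+ j * t / 2))%R.
      set y := (2 ^+ j * t / 2)%R.
      have -> : (2 ^+ j * t = 2 * y)%R by rewrite /y; field.
      have y0 : (0 < y)%R by rewrite /y divr_gt0.
      rewrite powRM ?(ltW y0)// -[in LHS](mulr_powRB1 (ler0n _ 2) q0).
      by rewrite -(mulr_powRB1 (ltW y0) q0); ring.
    have E : \int[mu]_x (b2e ((2 ^+ j * t / 2)%:E < f x) * (f x * (u x)%:E)) = J'.
      by apply: eq_integral => x _; rewrite /g muleA.
    rewrite E EFinM -muleA; apply: le_trans (lee_wpmul2l _ H) _.
      by rewrite lee_fin !mulr_ge0// powR_ge0.
    rewrite !muleA -!EFinM lee_wpmul2r//.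
      by apply: int_ge0; nnm.
    by rewrite lee_fin le_eqVlt; apply/orP; left; apply/eqP; ring.
  have t20 : (0 < t / 2)%R by rewrite divr_gt0.
  have np2 j : 0 <= ((2 ^+ j * (t / 2)) `^ (q - 1))%:E by rewrite lee_fin powR_ge0.
  have nb3 j : nnm (fun x => b2e ((2 ^+ j * (t / 2))%:E < f x) : \bar R).
    exact: nnm_b2e.
  rewrite nneseriesZl; last by move=> j _; apply: int_ge0; nnm; apply: np2.
  rewrite -int_series; last by move=> j; nnm; apply: np2.
  rewrite muleA -EFinM.
  apply: (@le_trans _ _ ((2 `^ q * (2 * L * 2 `^ (q - 1)))%:E *
      \int[mu]_x (`|c|%:E * (f x `^ q * (u x)%:E)))).
    rewrite lee_wpmul2l ?lee_fin ?mulr_ge0 ?powR_ge0//.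
    apply: int_le; [by nnm; apply: np2|by nnm|].
    move=> x; under eq_eseriesr do rewrite -muleA.
    have fu0 : 0 <= f x * (u x)%:E by case: (nnmM nf nu).
    have f0 : 0 <= f x by case: nf.
    rewrite nneseriesZr//; last by move=> j; rewrite mule_ge0 ?b2e_ge0.
    rewrite -(mule_poweRB1 f0 q1) !muleA; apply: lee_wpmul2r; first by case: nu.
    rewrite muleAC; apply: lee_wpmul2r => //.
    apply: le_trans (dyadic_series_le t20 q10 f0) _.
    by rewrite lee_wpmul2r ?poweR_ge0// lee_fin ler_norm.
  rewrite intZ; [|by rewrite lee_fin|by nnm].
  rewrite muleA -EFinM lee_wpmul2r// lee_fin -/c /C.
  by rewrite lerDl.
(* Where the maximal function vanishes the integrand does, and the other points
   lie above one of the heights 1 / (n + 1). *)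
have M0E : \int[mu]_x (M u f x `^ q * (u x)%:E) =
    \int[mu]_(x in \bigcup_n [set x | (n.+1%:R^-1)%:E < M u f x])
      (M u f x `^ q * (u x)%:E).
  rewrite [RHS]int_inde; apply: eq_integral => x _.
  have [|nx] := pselect ((\bigcup_n [set x | (n.+1%:R^-1)%:E < M u f x]) x).
    by move=> H; rewrite inde_in// mul1e.
  rewrite inde_out// mul0e.
  suff -> : M u f x = 0 by rewrite poweR0r ?gt_eqF// mul0e.
  apply/eqP; rewrite eq_le (nnm_ge0 x nM) andbT leNgt; apply/negP => M0.
  apply: nx; have [fy|fy] := eqVneq (M u f x) +oo.
    by exists 0%N => //=; rewrite fy ltry.
  have Mfin : M u f x \is a fin_num by rewrite ge0_fin_numE ?lt_neqAle ?fy ?leey ?(nnm_ge0 x nM).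
  have M0' : (0 < fine (M u f x))%R by rewrite -lte_fin fineK.
  exists (Num.bound (fine (M u f x))^-1) => //=.
  rewrite -(fineK Mfin) lte_fin invf_plt ?posrE//.
  apply: (@lt_trans _ _ (Num.bound (fine (M u f x))^-1)%:R).
    by apply: archi_boundP; rewrite invr_ge0 ltW.
  by rewrite ltr_nat.
rewrite M0E; apply: int_bigcup_le; first by nnm.
  by move=> n; exact: nnm_gt.
move=> N; apply: le_trans (step (N.+1%:R^-1)%R _); last by rewrite invr_gt0.
apply: int_subset; [by nnm| |exact: nnm_gt|].
  by apply: bigsetU_measurable => n _; exact: nnm_gt.
move=> x; rewrite -(bigcup_mkord N (fun n => [set x | (n.+1%:R^-1)%:E < M u f x])) => -[n /= nN]; apply: le_lt_trans.
by rewrite lee_fin lef_pV2 ?posrE// ler_nat ltnS ltnW.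
Qed.

End strong.

(** * Muckenhoupt classes on a family of balls *)

Section muckenhoupt.
Context {d : measure_display} {X : measurableType d} {R : realType}.
Variable mu : {measure set X -> \bar R}.
Variables (B : nat -> set X) (r : nat -> R) (star : nat -> nat) (K : R).
Hypothesis BF : ball_family mu B r star K.
Local Notation mB := (bf_meas BF).
Local Notation good := (good_weight mu B).
Local Notation M := (Mx mu B).
Local Notation dbl := (dbl mu B star).
Local Notation wr := (wr mu B).

Definition w1 : X -> R := fun=> 1.

Lemma powR_exp (x a : R) : 0 < x -> x `^ a = expR (a * ln x).
Proof. by move=> x0; rewrite /powR gt_eqF. Qed.

Lemma exp_ln (x : R) : 0 < x -> expR (ln x) = x.
Proof. by move=> x0; rewrite lnK// posrE. Qed.

Lemma good_w1 : good w1.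
Proof.
split; [exact: measurable_cst|by []|move=> n].
rewrite (int_cst mu (c := 1%E)) ?lee01//; last exact: mB.
by rewrite mul1e (bf_fin BF).
Qed.

Lemma wr_w1 n : mu (B n) = (wr w1 n)%:E.
Proof.
rewrite -wrE; last exact: good_w1.
by rewrite (int_cst mu (c := 1%E)) ?lee01 ?mul1e//; exact: mB.
Qed.

Lemma good_weight_powR (w : X -> R) g :
  measurable_fun setT w -> (forall x, 0 < w x) ->
  (forall n, (\int[mu]_(x in B n) (w x `^ g)%:E < +oo)%E) ->
  good (fun x => w x `^ g).
Proof.
move=> mw w0 wfin; split => //; last by move=> x; exact: powR_gt0.
exact: (measurableT_comp (measurable_powR g)).
Qed.

(** The class [A_p] with [p = 1 / a], stated for the pair of the weight [w] and
    of its dual weight [s = w ^ (1 - p')]. Taking the [1/p]-th power of the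
    usual condition makes it symmetric in [w] and [s], and taking logarithms
    makes it linear. *)
Record Ap (a : R) (w s : X -> R) : Prop := ApClass {
  ap_a : 0 < a < 1;
  ap_w : good w;
  ap_s : good s;
  ap_dual : forall x, a * ln (w x) + (1 - a) * ln (s x) = 0;
  ap_bound : exists c, forall n,
    a * ln (wr w n) + (1 - a) * ln (wr s n) <= c + ln (wr w1 n) }.

Lemma Ap_sym a w s : Ap a w s -> Ap (1 - a) s w.
Proof.
case=> /andP[a0 a1] gw gs ws [c H]; split => //.
- by rewrite subr_gt0 a1 ltrBlDr ltrDl.
- by move=> x; rewrite subKr addrC.
- by exists c => n; rewrite subKr addrC.
Qed.

Lemma Ap_ln_dual a w s x : Ap a w s -> ln (w x) = - (1 - a) / a * ln (s x).
Proof.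
case=> /andP[a0 _] _ _ /(_ x) E _; apply: (mulfI (lt0r_neq0 a0)).
move: E; move: (ln (w x)) (ln (s x)) => p q pq.
have -> : a * p = - ((1 - a) * q) by apply/eqP; rewrite -addr_eq0 pq.
by field; rewrite gt_eqF.
Qed.

(** The weight of a subset that fills a fixed proportion of a ball: integrate
    the elementary inequality [1 <= t w + t ^ (- a / (1 - a)) s] and optimise
    in [t]. *)
Lemma Ap_lower a w s (dl : R) : Ap a w s -> 0 < dl ->
  exists2 k : R, 0 < k & forall n (E : set X), measurable E -> E `<=` B n ->
    ((dl * wr w1 n)%:E <= mu E)%E ->
    ((k * wr w n)%:E <= \int[mu]_(x in E) (w x)%:E)%E.
Proof.
move=> [/andP[a0 a1] gw gs ws [c H]] dl0.
have b0 : 0 < 1 - a by rewrite subr_gt0.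
have dl2 : 0 < dl / 2 by rewrite divr_gt0.
exists (expR ((ln (dl / 2) - c) / a)); first exact: expR_gt0.
move=> n E mE EB dE.
have m0 : 0 < wr w1 n by apply: (wr_gt0 BF); exact: good_w1.
have W0 : 0 < wr w n by apply: (wr_gt0 BF).
have S0 : 0 < wr s n by apply: (wr_gt0 BF).
set m := wr w1 n in m0 dE *; set W := wr w n in W0 *; set S := wr s n in S0 *.
(* With this value the term containing [s] in [key] accounts for at most half
   of the lower bound [dl * m] of [mu E]. *)
set t := (1 - a) / a * (ln S - ln (dl / 2) - ln m).
have nw := nnm_weight gw; have ns := nnm_weight gs.
have key : (mu E <= (expR t)%:E * \int[mu]_(x in E) (w x)%:E +
    (expR (- t * a / (1 - a)))%:E * \int[mu]_(x in E) (s x)%:E)%E.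
  rewrite -int_inZ ?lee_fin ?expR_ge0// -int_inZ ?lee_fin ?expR_ge0//.
  rewrite -int_inD//; [|by nnm; exact: expR_ge0|by nnm; exact: expR_ge0].
  rewrite -[leLHS]mul1e -(int_cst mu (c := 1%E))//; apply: int_in_le => //.
    by nnm; rewrite ?expR_ge0.
  move=> x Ex; rewrite -!EFinM -EFinD lee_fin.
  rewrite -{1}(exp_ln (gw_gt0 gw x)) -{1}(exp_ln (gw_gt0 gs x)) -!expRD.
  have : (0 <= t + ln (w x)) || (0 <= - t * a / (1 - a) + ln (s x)).
    rewrite -implyNb -ltNge; apply/implyP => tw.
    suff : 0 <= (1 - a) * (- t * a / (1 - a) + ln (s x)) by rewrite pmulr_rge0.
    rewrite mulrDr mulrCA mulfV ?gt_eqF// mulr1.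
    have -> : (1 - a) * ln (s x) = - (a * ln (w x)).
      by apply/eqP; rewrite -addr_eq0 addrC ws.
    have : 0 <= a * - (t + ln (w x)) by rewrite mulr_ge0 ?oppr_ge0// ltW.
    lra.
  case/orP => h.
    by apply: ler_wpDr; rewrite ?expR_ge0// -[leLHS]expR0 ler_expR.
  by apply: ler_wpDl; rewrite ?expR_ge0// -[leLHS]expR0 ler_expR.
have sE : ((expR (- t * a / (1 - a)))%:E * \int[mu]_(x in E) (s x)%:E <=
    (dl / 2 * m)%:E)%E.
  apply: (@le_trans _ _ ((expR (- t * a / (1 - a)))%:E * S%:E)%E).
    rewrite lee_wpmul2l ?lee_fin ?expR_ge0// /S -wrE//.
    by apply: int_subset => //; exact: mB.
  rewrite -EFinM lee_fin -{1}(exp_ln S0) -expRD -[leRHS]exp_ln ?mulr_gt0//.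
  rewrite ler_expR [ln (_ * m)]lnM ?posrE// /t.
  by rewrite le_eqVlt; apply/orP; left; apply/eqP; field; rewrite !gt_eqF.
have : ((dl / 2 * m)%:E <= (expR t)%:E * \int[mu]_(x in E) (w x)%:E)%E.
  have := le_trans dE (le_trans key (leeD2l _ sE)).
  have -> : dl * m = dl / 2 * m + dl / 2 * m by field.
  by rewrite EFinD leeD2rE.
rewrite -lee_pdivrMl ?expR_gt0//; apply: le_trans.
rewrite lee_fin -{1}(exp_ln W0) -expRN -expRD -[dl / 2 * m]exp_ln ?mulr_gt0//.
rewrite -expRD ler_expR [ln (_ * m)]lnM ?posrE// /t.
have := H n; rewrite -/m -/W -/S => Hn.
rewrite -(ler_pM2l a0).
have -> : a * ((ln (dl / 2) - c) / a + ln W) = ln (dl / 2) - c + a * ln W.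
  by field; rewrite gt_eqF.
have -> : a * (- ((1 - a) / a * (ln S - ln (dl / 2) - ln m)) +
    (ln (dl / 2) + ln m)) =
    ln (dl / 2) + ln m - (1 - a) * ln S.
  by field; rewrite gt_eqF.
lra.
Qed.

(** Since [mu] is doubling, [B n] fills a fixed proportion of
    [B (star n)]. *)
Lemma Ap_dbl a w s : Ap a w s -> exists2 L : R, 0 <= L & dbl w L.
Proof.
move=> A; have K0 : 0 < K.
  have := bf_gt0 BF (star 0); rewrite ltNge; apply: contraNT; rewrite -leNgt => K0.
  apply: le_trans (bf_doubling BF 0%N) _.
  by rewrite mule_le0_ge0// ?lee_fin// ltW// (bf_gt0 BF).
have [k k0 H] := Ap_lower A (ltac:(by rewrite invr_gt0) : 0 < K^-1).
exists k^-1 => [|n]; first by rewrite invr_ge0 ltW.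
have gw := ap_w A.
rewrite ler_pdivlMl// -lee_fin -(wrE n gw).
apply: H => //; [exact: mB|exact: (bf_sub_star BF)|].
rewrite EFinM -wr_w1 lee_pdivrMl//; exact: (bf_doubling BF).
Qed.

Local Open Scope ereal_scope.

Lemma nnm_invw w : good w -> nnm (fun x => ((w x)^-1)%:E : \bar R).
Proof.
move=> gu; apply: nnm_EFin => [|x]; last by rewrite invr_ge0 ltW// (gw_gt0 gu).
rewrite (_ : (fun x => _) = (fun x => w x `^ (-1))%R); last first.
  by apply/funext => x; rewrite powR_inv1// ltW// (gw_gt0 gu).
exact: (measurableT_comp (measurable_powR (-1))) (gw_meas gu).
Qed.

(** Muckenhoupt's theorem, after Lerner: [Mf] is dominated by a composition of
    the maximal operators taken with respect to [s] and to [w], both doubling. *)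
Lemma Ap_maximal a w s : Ap a w s -> exists2 C : R, (0 < C)%R &
  forall f, nnm f -> \int[mu]_x (M w1 f x `^ a^-1 * (w x)%:E) <=
    C%:E * \int[mu]_x (f x `^ a^-1 * (w x)%:E).
Proof.
move=> A; have [Lw Lw0 dw] := Ap_dbl A; have [Ls Ls0 ds] := Ap_dbl (Ap_sym A).
have [/andP[a0 a1] gw gs ws [c H]] := A.
set b := (1 - a)%R in ws H *; have b0 : (0 < b)%R by rewrite subr_gt0.
have b1 : (b < 1)%R by rewrite ltrBlDr ltrDl.
have [Cw Cw0 Mw] := Mx_strong_type BF gw dw Lw0 (ltac:(by rewrite invf_gt1) : 1 < b^-1)%R.
have [Cs Cs0 Ms] := Mx_strong_type BF gs ds Ls0 (ltac:(by rewrite invf_gt1) : 1 < a^-1)%R.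
set e := expR (c / a).
exists (e `^ b^-1 * (Cw * Cs))%R; first by rewrite !mulr_gt0// powR_gt0 ?expR_gt0.
move=> f nf; have g1 := good_w1.
have nw := nnm_weight gw; have ns := nnm_weight gs.
have niw := nnm_invw gw; have nis := nnm_invw gs.
pose F := M s (fun x => f x * ((s x)^-1)%:E).
have nfs : nnm (fun x => f x * ((s x)^-1)%:E) by nnm.
have nF : nnm F by exact: (nnm_Mx BF).
pose g x := F x `^ (b / a) * ((w x)^-1)%:E.
have ng : nnm g by rewrite /g; nnm.
pose G := M w g.
have nG : nnm G by exact: (nnm_Mx BF).
have nM := nnm_Mx BF g1 nf.
(* The [s]-mean [be] of [f / s] over a ball is at most [F] at every point of the
   ball, so that [m * be ^ (b / a)] is at most the integral of [F ^ (b / a)],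
   which is a [w]-mean of [g]. *)
have pointwise x : M w1 f x `^ a^-1 <= (e `^ b^-1)%:E * G x `^ b^-1.
  have G0 : 0 <= G x by case: nG.
  have e0 : 0 <= e%:E by rewrite lee_fin expR_ge0.
  have -> : (e `^ b^-1)%:E * G x `^ b^-1 = ((e%:E * G x) `^ (a / b)) `^ a^-1.
    rewrite -poweR_EFin -poweRM// -poweRrM; congr (_ `^ _).
    by field; rewrite !gt_eqF.
  apply: le_poweR; [by rewrite invr_ge0 ltW|by case: nM|].
  apply: Mx_le => [|n Bx]; first exact: poweR_ge0.
  set m := wr w1 n; set W := wr w n; set S := wr s n.
  have m0 : (0 < m)%R by exact: (wr_gt0 BF).
  have W0 : (0 < W)%R by exact: (wr_gt0 BF).
  have S0 : (0 < S)%R by exact: (wr_gt0 BF).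
  set be := av mu B s (fun x => f x * ((s x)^-1)%:E) n.
  have be0 : 0 <= be by exact: (av_ge0 BF).
  have -> : av mu B w1 f n = (S / m)%:E * be.
    rewrite /be /av -/S -/m muleA -EFinM mulrAC mulfV ?gt_eqF// mul1r.
    congr (_ * _); apply: eq_integral => y _.
    by rewrite mule1 -muleA -EFinM mulVf ?mule1// gt_eqF// (gw_gt0 gs).
  have h1 : m%:E * be `^ (b / a) <= W%:E * G x.
    apply: (@le_trans _ _ (\int[mu]_(x in B n) F x `^ (b / a))).
      rewrite muleC -wr_w1 -int_cst ?poweR_ge0//; last exact: mB.
      apply: int_in_le; [by nnm; exact: poweR_ge0|by nnm|exact: mB|].
      move=> y By; apply: le_poweR => //; first by rewrite divr_ge0// ltW.
      exact: Mx_ge.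
    apply: (@le_trans _ _ (W%:E * av mu B w g n)); last first.
      by rewrite lee_wpmul2l ?lee_fin ?(ltW W0)//; exact: Mx_ge.
    rewrite /av -/W muleA -EFinM mulfV ?gt_eqF// mul1e le_eqVlt; apply/orP; left.
    apply/eqP; apply: eq_integral => y _.
    by rewrite /g -muleA -EFinM mulVf ?mule1// gt_eqF// (gw_gt0 gw).
  have h2 : ((S / m)%:E * be) `^ (b / a) <= e%:E * G x.
    rewrite poweRM//; last by rewrite lee_fin divr_ge0// ltW.
    rewrite poweR_EFin.
    have h3 : be `^ (b / a) <= (W / m)%:E * G x.
      by rewrite [(W / m)%R]mulrC EFinM -muleA lee_pdivlMl.
    apply: (@le_trans _ _ (((S / m) `^ (b / a))%:E * ((W / m)%:E * G x))).
      by apply: lee_wpmul2l h3; rewrite lee_fin powR_ge0.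
    rewrite muleA -EFinM lee_wpmul2r// lee_fin.
    have SM0 : (0 < S / m)%R by rewrite divr_gt0.
    have WM0 : (0 < W / m)%R by rewrite divr_gt0.
    rewrite powR_exp// -[X in (_ * X)%R]exp_ln// -expRD ler_expR.
    rewrite !ln_div ?posrE//.
    have := H n; rewrite -/m -/W -/S => Hn.
    rewrite -(ler_pM2l a0).
    have -> : (a * (b / a * (ln S - ln m) + (ln W - ln m)) =
       a * ln W + b * ln S - ln m)%R by rewrite /b; field; rewrite gt_eqF.
    have -> : (a * (c / a) = c)%R by field; rewrite gt_eqF.
    by rewrite lerBlDr.
  rewrite -[leLHS](@poweRK _ _ (b / a)%R) ?gt_eqF ?divr_gt0//; last first.
    by rewrite mule_ge0// lee_fin divr_ge0// ltW.
  rewrite invf_div; apply: le_poweR h2; last exact: poweR_ge0.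
  by rewrite divr_ge0// ltW.
apply: (@le_trans _ _ (\int[mu]_x ((e `^ b^-1)%:E * (G x `^ b^-1 * (w x)%:E)))).
  apply: int_le; [by nnm|by nnm|].
  by move=> x; rewrite muleA; apply: lee_wpmul2r => //; case: nw.
rewrite intZ ?lee_fin ?powR_ge0//; last by nnm.
rewrite EFinM -muleA; apply: lee_wpmul2l; first by rewrite lee_fin powR_ge0.
apply: le_trans (Mw g ng) _; rewrite EFinM -muleA.
apply: lee_wpmul2l; first by rewrite lee_fin ltW.
have -> : \int[mu]_x (g x `^ b^-1 * (w x)%:E) = \int[mu]_x (F x `^ a^-1 * (s x)%:E).
  apply: eq_integral => x _; rewrite /g poweRM ?poweR_ge0//; last first.
    by case: niw.
  rewrite -poweRrM -muleA.
  have -> : (b / a / b = a^-1)%R by field; rewrite !gt_eqF.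
  congr (_ * _); rewrite poweR_EFin -EFinM; congr EFin.
  have w0 := gw_gt0 gw x; have s0 := gw_gt0 gs x.
  rewrite powR_exp ?invr_gt0// lnV ?posrE// -[X in (_ * X)%R]exp_ln// -expRD.
  rewrite -[RHS]exp_ln//; congr expR.
  by rewrite (Ap_ln_dual x A) /b; field; rewrite -/b !gt_eqF.
apply: le_trans (Ms _ nfs) _.
apply: lee_wpmul2l; first by rewrite lee_fin ltW.
rewrite le_eqVlt; apply/orP; left; apply/eqP.
apply: eq_integral => x _; rewrite poweRM//; [|by case: nf|by case: nis].
rewrite -muleA; congr (_ * _); rewrite poweR_EFin -EFinM; congr EFin.
have w0 := gw_gt0 gw x; have s0 := gw_gt0 gs x.
rewrite powR_exp ?invr_gt0// lnV ?posrE// -[X in (_ * X)%R]exp_ln// -expRD.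
rewrite -[RHS]exp_ln//; congr expR.
by rewrite (Ap_ln_dual x A) /b; field; rewrite gt_eqF.
Qed.

(** Both the nesting of the classes and their openness come from comparing the
    means of [s ^ g] with the [g]-th power of the means of [s]. *)
Lemma Ap_power a w s (g c' : R) : Ap a w s -> (0 < g)%R ->
  good (fun x => s x `^ g)%R ->
  (forall n, ln (wr (fun x => s x `^ g)%R n) <=
     c' + ln (wr w1 n) + g * (ln (wr s n) - ln (wr w1 n)))%R ->
  Ap (g * a / (1 - a + g * a)) w (fun x => s x `^ g)%R.
Proof.
move=> [/andP[a0 a1] gw gs ws [c H]] g0 gs' Hs.
have b0 : (0 < 1 - a)%R by rewrite subr_gt0.
have D0 : (0 < 1 - a + g * a)%R by rewrite addr_gt0// mulr_gt0.
set D := (1 - a + g * a)%R in D0 *.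
have DE : (1 - g * a / D = (1 - a) / D)%R by rewrite /D; field; rewrite -/D gt_eqF.
split => //.
- by rewrite divr_gt0 ?mulr_gt0//= ltr_pdivrMr// mul1r /D ltrDr.
- move=> x; rewrite DE powR_exp ?(gw_gt0 gs)// expRK.
  have -> : (g * a / D * ln (w x) + (1 - a) / D * (g * ln (s x)) =
     g / D * (a * ln (w x) + (1 - a) * ln (s x)))%R by field; rewrite gt_eqF.
  by rewrite ws mulr0.
- exists ((1 - a) / D * c' + g / D * c)%R => n; rewrite DE.
  have Hn := H n; have Hsn := Hs n.
  move: Hn Hsn.
  set W := ln (wr w n); set S := ln (wr s n); set m := ln (wr w1 n).
  set S' := ln (wr (fun _ => _) n) => Hn Hsn.
  rewrite -(ler_pM2l D0).
  have -> : (D * (g * a / D * W + (1 - a) / D * S') = g * a * W + (1 - a) * S')%R.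
    by field; rewrite gt_eqF.
  have -> : (D * ((1 - a) / D * c' + g / D * c + m) =
     (1 - a) * c' + g * c + (1 - a + g * a) * m)%R.
    by rewrite -/D; field; rewrite gt_eqF.
  have h1 := ler_wpM2l (ltW b0) Hsn.
  have h2 := ler_wpM2l (ltW g0) Hn.
  move: h1 h2; nra.
Qed.

End muckenhoupt.

(** * Lebesgue differentiation *)

Section differentiation.
Context {d : measure_display} {X : measurableType d} {R : realType}.
Variable mu : {measure set X -> \bar R}.
Variables (B : nat -> set X) (r : nat -> R) (star : nat -> nat) (K : R).
Hypothesis BF : ball_family mu B r star K.
Local Notation mB := (bf_meas BF).
Local Notation M := (Mx mu B w1).

(** The sets of the family take the place of neighbourhoods, since these are
    the sets over which averages are taken. *)
Definition bcontinuous (h : X -> R) : Prop := forall x e, 0 < e ->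
  exists n, B n x /\ forall y, B n y -> `|h x - h y| < e.

Definition dense_bcontinuous : Prop :=
  forall f : X -> R, mu.-integrable setT (EFin \o f) ->
  forall e : R, 0 < e -> exists h : X -> R,
    [/\ bcontinuous h, mu.-integrable setT (EFin \o h)
      & (\int[mu]_x `|f x - h x|%:E < e%:E)%E].

Lemma ball_family_K_ge1 : 1 <= K.
Proof.
rewrite -lee_fin -(@lee_pmul2r _ (mu (B 0%N))) ?(bf_gt0 BF) ?mul1e//; last first.
  by rewrite ge0_fin_numE ?(bf_fin BF).
apply: le_trans (bf_doubling BF 0%N).
by apply: le_measure; rewrite ?inE; [exact: mB|exact: mB|exact: (bf_sub_star BF)].
Qed.

Lemma dbl_w1 : dbl mu B star w1 K.
Proof. by move=> n; rewrite -lee_fin EFinM -!(wr_w1 BF) (bf_doubling BF). Qed.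

Local Open Scope ereal_scope.

(** The means of [h] over small sets of the family approach its value. *)
Lemma Mx_bcontinuous (h : X -> R) x : bcontinuous h -> measurable_fun setT h ->
  `|h x|%:E <= M (fun y => `|h y|%:E) x.
Proof.
move=> ch mh; apply/lee_addgt0Pr => e e0.
have [n [Bx hn]] := ch x e e0.
have g1 := good_w1 BF.
have nh : nnm (fun y => `|h y|%:E : \bar R).
  by apply: nnm_EFin => //; exact: measurableT_comp.
have m0 : (0 < wr mu B w1 n)%R by exact: (wr_gt0 BF).
suff : `|h x|%:E <= av mu B w1 (fun y => `|h y|%:E) n + e%:E.
  by move=> /le_trans; apply; rewrite leeD2r//; exact: Mx_ge.
have -> : e%:E = av mu B w1 (fun=> e%:E) n.
  rewrite /av; under eq_integral do rewrite mule1.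
  rewrite (int_cst mu (c := e%:E)) ?lee_fin ?(ltW e0)//; last exact: mB.
  by rewrite (wr_w1 BF) muleCA -!EFinM mulVf ?mulr1// gt_eqF.
have ne : nnm (fun _ : X => e%:E) by nnm; exact: ltW.
rewrite -(avD BF)// /av lee_pdivlMl//.
rewrite -(wr_w1 BF) muleC -int_cst ?lee_fin//; last exact: mB.
have nw1 := nnm_weight g1.
apply: int_in_le; [by nnm; exact: ltW|by nnm; exact: ltW|exact: mB|].
move=> y By; rewrite mule1 -EFinD lee_fin.
have := hn _ By.
have := lerB_dist (h x) (h y); lra.
Qed.

(** The half of Lebesgue's differentiation theorem that concerns the maximal
    function. The exceptional sets are controlled by the weak type inequality
    for the difference between [f] and a continuous approximation. *)
Lemma Mx_ae_ge (f : X -> R) : dense_bcontinuous -> (forall x, 0 <= f x)%R ->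
  mu.-integrable setT (EFin \o f) ->
  {ae mu, forall x, (f x)%:E <= M (fun y => (f y)%:E) x}.
Proof.
move=> dn f0 fi; have g1 := good_w1 BF.
have mf : measurable_fun setT f by exact/measurable_EFinP/(measurable_int mu).
have nf : nnm (fun x => (f x)%:E : \bar R) by nnm.
have nM := nnm_Mx BF g1 nf.
have K1 := ball_family_K_ge1; have K0 : (0 <= K)%R by exact: le_trans K1.
pose N k := [set x | (2 / k.+1%:R)%:E < (f x)%:E - M (fun y => (f y)%:E) x].
have mN k : measurable (N k).
  rewrite -[N k]setTI; apply: emeasurable_fun_o_infty => //.
  by apply: emeasurable_funB; [exact: nf.1|exact: nM.1].
have N0 k : mu (N k) = 0.
  have t0 : (0 < k.+1%:R^-1 :> R)%R by rewrite invr_gt0.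
  set t := (k.+1%:R^-1)%R in t0.
  apply/eqP; rewrite eq_le measure_ge0 andbT; apply/lee_addgt0Pr => e e0.
  rewrite add0e.
  have e'0 : (0 < e * t / (1 + K))%R.
    by rewrite divr_gt0 ?mulr_gt0// ltr_wpDr.
  have [h [ch hi fh]] := dn f fi _ e'0.
  have mh : measurable_fun setT h by exact/measurable_EFinP/(measurable_int mu).
  have ng : nnm (fun x => `|f x - h x|%:E : \bar R).
    by apply: nnm_EFin => //; apply: measurableT_comp => //; exact: measurable_funB.
  have nh : nnm (fun x => `|h x|%:E : \bar R).
    by apply: nnm_EFin => //; exact: measurableT_comp.
  pose g : X -> \bar R := fun x => `|f x - h x|%:E.
  have {}ng : nnm g by [].
  set N1 := [set x | t%:E < g x]; set N2 := [set x | t%:E < M g x].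
  have mN1 : measurable N1 by exact: nnm_gt.
  have mN2 : measurable N2 by apply: nnm_gt; exact: (nnm_Mx BF).
  have NN : N k `<=` N1 `|` N2.
    move=> x Nx; apply: contrapT => /not_orP[/negP + /negP].
    rewrite -!leNgt => n1 n2; move: Nx; rewrite /N /= ltNge => /negP; apply.
    have Mx_le : M (fun y => `|h y|%:E) x <= M (fun y => (f y)%:E) x + t%:E.
      apply: le_trans (leeD2l _ n2).
      apply: le_trans (Mx_subadditive BF x g1 nf ng).
      apply: (Mx_mono BF x g1 nh); first by nnm.
      move=> y; rewrite -EFinD lee_fin.
      have := ler_normB (f y) (f y - h y)%R; rewrite subKr.
      by rewrite [X in (_ <= X + _)%R]ger0_norm.
    have h2 := le_trans (Mx_bcontinuous x ch mh) Mx_le.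
    have fx : (f x)%:E <= M (fun y => (f y)%:E) x + (2 * t)%:E.
      apply: (@le_trans _ _ (`|h x|%:E + t%:E)).
        rewrite -EFinD lee_fin; move: n1; rewrite lee_fin.
        have := ler_norm (f x - h x)%R; have := ler_norm (h x); lra.
      rewrite mulr_natl mulr2n EFinD addeA leeD2r//.
    have [My|My] := eqVneq (M (fun y => (f y)%:E) x) +oo.
      by rewrite My /= leNye.
    rewrite leeBlDl// ge0_fin_numE ?(nnm_ge0 x nM)//.
    by rewrite lt_neqAle My leey.
  apply: (@le_trans _ _ (mu N1 + mu N2)).
    apply: le_trans (measureU2 _ _ _) => //.
    by apply: le_measure; rewrite ?inE//; exact: measurableU.
  have mu_int (A : set X) : measurable A -> mu A = \int[mu]_(x in A) (w1 x)%:E.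
    by move=> mA; rewrite (int_cst mu (c := 1)) ?mul1e ?lee01.
  set J := \int[mu]_x g x; have {}fh : J < (e * t / (1 + K))%:E by [].
  have b1 : t%:E * mu N1 <= J.
    rewrite -int_cst ?lee_fin ?(ltW t0)// /N1 [leLHS]int_inde.
    apply: int_le; [by nnm; exact: ltW|by []|].
    move=> x; have [N1x|N1x] := pselect (N1 x).
      by rewrite inde_in// mul1e ltW.
    by rewrite inde_out// mul0e; case: ng.
  have b2 : t%:E * mu N2 <= K%:E * J.
    have := Mx_weak_type BF g1 dbl_w1 K0 ng t0.
    by rewrite -mu_int//; under [in leRHS]eq_integral do rewrite mule1.
  rewrite -(@lee_pmul2l _ t%:E) ?lte_fin// ge0_muleDr ?measure_ge0//.
  apply: le_trans (leeD b1 b2) _.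
  rewrite -[X in X + _]mul1e -ge0_muleDl ?lee_fin//.
  apply: (@le_trans _ _ ((1 + K)%:E * (e * t / (1 + K))%:E)).
    by rewrite EFinD lee_wpmul2l -?EFinD ?lee_fin ?addr_ge0// ltW.
  rewrite -!EFinM lee_fin le_eqVlt; apply/orP; left; apply/eqP.
  by field; rewrite gt_eqF// ltr_wpDr.
exists (\bigcup_k N k); split.
- by apply: bigcup_measurable => k _; exact: mN.
- apply/eqP; rewrite eq_le measure_ge0 andbT.
  apply: (@le_trans _ _ (\sum_(k <oo) mu (N k))).
    apply: measure_sigma_subadditive => //.
    by apply: bigcup_measurable => k _; exact: mN.
  by rewrite eseries0.
move=> x /= /negP; rewrite -ltNge => Mf.
have Mfin : M (fun y => (f y)%:E) x \is a fin_num.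
  by rewrite ge0_fin_numE ?(nnm_ge0 x nM)// (lt_trans Mf)// ltry.
have del : (0 < f x - fine (M (fun y => (f y)%:E) x))%R.
  by rewrite subr_gt0 -lte_fin fineK.
set dl := (_ - _)%R in del.
exists (Num.bound (2 / dl)) => //; rewrite /N /= -(fineK Mfin) -EFinB -/dl lte_fin.
rewrite ltr_pdivrMr// mulrC -ltr_pdivrMr//.
apply: (@lt_trans _ _ (Num.bound (2 / dl))%:R).
  by apply: archi_boundP; rewrite divr_ge0// ltW.
by rewrite ltr_nat.
Qed.

End differentiation.

(** * Decay of the level sets of the maximal function *)

Lemma nneseries_shift_le {R : realType} (a : nat -> \bar R) :
  (forall n, 0 <= a n)%E ->
  (\sum_(n <oo) a n.+1 <= \sum_(n <oo) a n)%E.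
Proof.
move=> a0; have -> : (\sum_(n <oo) a n = a 0%N + \sum_(n <oo) a n.+1)%E.
  rewrite nneseries_recl// -(nneseries_addn 1)//; congr (_ + _)%E.
  by apply: eq_eseriesr => n _; rewrite addn1.
by rewrite leeDr.
Qed.

Section decay.
Context {d : measure_display} {X : measurableType d} {R : realType}.
Variable mu : {measure set X -> \bar R}.
Variables (B : nat -> set X) (r : nat -> R) (star : nat -> nat) (K : R).
Hypothesis BF : ball_family mu B r star K.
Local Notation mB := (bf_meas BF).
Local Notation M := (Mx mu B w1).
Local Notation wr := (wr mu B).
Local Notation good := (good_weight mu B).

Variables (s : X -> R) (L k : R) (b : nat).
Hypotheses (gs : good s) (L1 : 1 <= L) (sL : dbl mu B star s L) (k0 : 0 < k).
Hypothesis low : forall n (E : set X), measurable E -> E `<=` B n ->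
  (((2 * K)^-1 * wr w1 n)%:E <= mu E)%E ->
  ((k * wr s n)%:E <= \int[mu]_(x in E) (s x)%:E)%E.

Local Open Scope ereal_scope.

Let K1 : (1 <= K)%R := ball_family_K_ge1 BF.
Let K0 : (0 < K)%R. Proof. exact: lt_le_trans K1. Qed.
Let L0 : (0 < L)%R. Proof. exact: lt_le_trans L1. Qed.
Let g1 := good_w1 BF.
Let ns := nnm_weight gs.
Let wr0 n : (0 < wr w1 n)%R := wr_gt0 BF n g1.
Let bk j := iter j star b.

(** A cut-off that decays away from the ball [B b] but is almost constant on
    every ball that is not large compared with its distance to [B b]. Cutting
    [s] off sharply would spoil the estimates near the boundary of [B b]. *)
Definition cutoff (x : X) : \bar R :=
  \sum_(j <oo) (((2 * L)^-1 ^+ j)%:E * inde (B (iter j star b)) x).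

Let phi := cutoff.

Let lam0 j : 0 <= (((2 * L)^-1 ^+ j)%R)%:E.
Proof. by rewrite lee_fin exprn_ge0// invr_ge0 mulr_ge0// ltW. Qed.

Lemma nnm_cutoff : nnm phi.
Proof. by apply: nnm_series => j; nnm; exact: mB. Qed.
Let nphi := nnm_cutoff.

Definition cutw (x : X) : \bar R := phi x * (s x)%:E.

Lemma nnm_cutw : nnm cutw. Proof. by rewrite /cutw; nnm. Qed.
Let nsp := nnm_cutw.

Let av' := av mu B w1 cutw.

Let avE n : av' n = ((wr w1 n)^-1)%:E * \int[mu]_(x in B n) cutw x.
Proof. by congr (_ * _); apply: eq_integral => x _; rewrite mule1. Qed.

Lemma cutoff_ge1 x : B b x -> 1 <= phi x.
Proof.
move=> Bx; apply: le_trans (nneseries_ge_term 0%N _).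
  by rewrite expr0 inde_in// mule1.
by move=> j; rewrite mule_ge0 ?inde_ge0.
Qed.

Lemma wr_iter j : (wr s (bk j) <= L ^+ j * wr s b)%R.
Proof.
elim: j => [|j ih]; first by rewrite mul1r.
apply: (le_trans (sL _)); rewrite exprS -mulrA ler_wpM2l//.
exact: ltW.
Qed.

Lemma int_cutw_le : \int[mu]_x cutw x <= (2 * wr s b)%:E.
Proof.
have S0 := wr_gt0 BF b gs.
have -> : \int[mu]_x cutw x =
    \sum_(j <oo) ((((2 * L)^-1 ^+ j)%R)%:E * (wr s (bk j))%:E).
  transitivity (\int[mu]_x \sum_(j <oo)
      ((((2 * L)^-1 ^+ j)%R)%:E * (inde (B (bk j)) x * (s x)%:E))).
    apply: eq_integral => x _; rewrite /cutw muleC /phi /cutoff.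
    rewrite -nneseriesZl; last by move=> j _; rewrite mule_ge0 ?inde_ge0.
    by apply: eq_eseriesr => j _; rewrite muleC muleA.
  have nj j : nnm (fun x => inde (B (bk j)) x * (s x)%:E).
    by nnm; exact: mB.
  rewrite int_series; last by move=> j; apply: nnmM => //; apply: nnm_cst.
  apply: eq_eseriesr => j _; rewrite intZ//.
  by rewrite -wrE// [in RHS]int_inde.
apply: (@le_trans _ _ (\sum_(j <oo) ((wr s b)%:E * (((2^-1 : R) ^+ j)%R)%:E))).
  apply: lee_nneseries => [j _ _|j _].
    by rewrite mule_ge0// lee_fin ltW// (wr_gt0 BF).
  apply: (@le_trans _ _ ((((2 * L)^-1 ^+ j)%R)%:E * (L ^+ j * wr s b)%:E)).
    by rewrite lee_wpmul2l// lee_fin wr_iter.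
  rewrite -!EFinM lee_fin mulrA -exprMn invfM -mulrA mulVf ?gt_eqF// mulr1.
  by rewrite mulrC.
rewrite nneseriesZl; last by move=> j _; rewrite lee_fin exprn_ge0// invr_ge0.
rewrite geometric_eseries; last by rewrite invr_ge0 ler0n/= invf_lt1// ltr1n.
rewrite -EFinM lee_fin mulrC ler_wpM2r ?(ltW S0)//.
by have -> : ((1 - 2^-1)^-1 = 2 :> R)%R by field.
Qed.

(** A ball on which the mean of the cut-off weight exceeds this height is, up to
    a constant, not larger than its distance to [B b]. *)
Definition height := (K ^+ 2 * (2 * wr s b) / wr w1 b)%R.

Lemma height_gt0 : (0 < height)%R.
Proof. by rewrite divr_gt0// !mulr_gt0 ?exprn_gt0//; exact: (wr_gt0 BF). Qed.

Lemma bk_sub j : B b `<=` B (bk j).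
Proof.
elim: j => // j ih x /ih; exact: (bf_sub_star BF).
Qed.

Lemma bk_cover x : exists j, B (bk j) x.
Proof.
have [y By] := bf_nonempty BF b.
have [m [mx my]] := bf_join BF x y.
have [j jm] : exists j, (r m <= 2 ^+ j * r b)%R.
  have [j] := archi_exp (r m / r b)%R (lexx 2%R).
  by rewrite ltr_pdivrMr ?(bf_r0 BF)// => /ltW; exists j.
have rj : (2 ^+ j * r b <= r (bk j))%R.
  elim: {jm} j => [|j ih]; first by rewrite mul1r.
  apply: ltW; apply: le_lt_trans (bf_star_r BF _).
  by rewrite exprS -mulrA ler_wpM2l.
exists j.+1; apply: (bf_engulf BF) mx.
  by exists y; split => //; exact: (@bk_sub j).
apply: (le_trans jm); apply: (le_trans rj).
by rewrite ler_peMl ?ler1n// ltW// (bf_r0 BF).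
Qed.

Variable l : R.
Hypothesis hl : (height <= l)%R.
Let l0 : (0 < l)%R. Proof. exact: lt_le_trans height_gt0 hl. Qed.
Let Om t := [set x | t%:E < M cutw x].
Let Q n := l%:E < av' n.
Let mOm t : measurable (Om t).
Proof. by apply: nnm_gt; exact: (nnm_Mx BF). Qed.

(** A ball [B (star n)] much larger than [B (bk j)] would engulf [B b], and its
    measure would then be too large for a mean above [height], because the
    total mass of [cutw] is at most twice that of [s] on [B b]. *)
Lemma stopping_radius n j : Q n -> B (bk j) `&` B (star n) !=set0 ->
  (r (star n) <= 2 * r (bk j))%R.
Proof.
rewrite /Q avE lte_pdivlMl// => Qn ne; rewrite leNgt; apply/negP => rr.
have sub : B b `<=` B (star (star n)).
  move=> x /(@bk_sub j); apply: (bf_engulf BF) => //.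
  have h := bf_r0 BF (bk j); have h' := bf_r0 BF (star n).
  by apply: ltW; apply: lt_trans (_ : 2 * r (star n) > r (star n))%R; lra.
have mm : (wr w1 b <= K ^+ 2 * wr w1 n)%R.
  rewrite -lee_fin -(wr_w1 BF)//.
  apply: (@le_trans _ _ (mu (B (star (star n))))).
    by apply: le_measure; rewrite ?inE//; exact: mB.
  apply: (le_trans (bf_doubling BF _)); rewrite expr2 -mulrA EFinM.
  rewrite lee_wpmul2l ?lee_fin ?(ltW K0)// EFinM -(wr_w1 BF).
  exact: (bf_doubling BF).
have : (wr w1 n * l < 2 * wr s b)%R.
  rewrite -lte_fin EFinM; apply: (lt_le_trans Qn).
  apply: le_trans int_cutw_le.
  rewrite int_inde; apply: int_le; [by nnm; exact: mB|by []|].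
  by move=> x; rewrite -[leRHS]mul1e lee_wpmul2r ?inde_le1//; case: nsp.
apply/negP; rewrite -leNgt.
apply: (@le_trans _ _ (wr w1 n * height)%R); last by rewrite ler_wpM2l// ltW.
rewrite /height mulrA ler_pdivlMr// mulrAC -mulrA mulrA mulrCA.
have S0 : (0 <= 2 * wr s b)%R by rewrite mulr_ge0// ltW// (wr_gt0 BF).
have := ler_wpM2r S0 mm.
rewrite !mulrA => h; rewrite mulrC !mulrA; lra.
Qed.

(** Every [B (bk j)] that contains [x] meets [B (star n)], which is therefore
    engulfed by [B (bk j.+1)]. Shifting the series by one index costs the factor
    [2 L]. *)
Lemma cutoff_comparable n x y : Q n -> B (star n) x -> B (star n) y ->
  phi x <= (2 * L)%:E * phi y.
Proof.
move=> Qn nx ny; have L20 : (0 < 2 * L)%R by rewrite mulr_gt0.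
apply: (@le_trans _ _ ((2 * L)%:E * \sum_(j <oo)
   ((((2 * L)^-1 ^+ j.+1)%R)%:E * inde (B (bk j.+1)) y))).
  rewrite -nneseriesZl; last by move=> j _; rewrite mule_ge0 ?inde_ge0.
  apply: lee_nneseries => [j _ _|j _]; first by rewrite mule_ge0 ?inde_ge0.
  rewrite muleA -[X in _ <= X * _]EFinM exprS mulrA mulfV ?gt_eqF// mul1r lee_wpmul2l//.
  have [jx|jx] := pselect (B (bk j) x); last first.
    by rewrite inde_out// inde_ge0.
  rewrite inde_in// inde_in//; apply: (bf_engulf BF) ny; last first.
    by apply: stopping_radius => //; exists x.
  by exists x.
rewrite lee_wpmul2l ?lee_fin ?(ltW L20)//.
apply: (@nneseries_shift_le _ (fun j =>
  (((2 * L)^-1 ^+ j)%R)%:E * inde (B (bk j)) y)) => j.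
by rewrite mule_ge0 ?inde_ge0.
Qed.

(** The radius is maximal only up to the factor [2], because the largest radius
    need not be attained. *)
Definition maximal_ball n := Q n /\ exists x, B n x /\
  forall m, Q m -> B m x -> (r m <= 2 * r n)%R.

Let P n : bool := `[< maximal_ball n >].

Lemma Om_maximal : Om l = \bigcup_n sel B P n.
Proof.
apply/seteqP; split=> x.
  move=> /(@Mx_gt _ _ _ mu B w1 cutw x) [|n Bx Qn].
    by rewrite lee_fin ltW.
  have [j jx] := bk_cover x.
  pose S := [set r m | m in [set m | Q m /\ B m x]].
  have Sub m : Q m -> B m x -> (r m <= 2 * r (bk j))%R.
    move=> Qm mx; apply: le_trans (ltW (bf_star_r_gt BF m)) _.
    by apply: stopping_radius => //; exists x; split => //; exact: (bf_sub_star BF).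
  have hS : has_sup S.
    split; first by exists (r n); exists n.
    by exists (2 * r (bk j))%R => _ [m [Qm mx] <-]; exact: Sub.
  have rn0 := bf_r0 BF n.
  have sup0 : (0 < sup S)%R.
    apply: lt_le_trans rn0 _; apply: ub_le_sup; first by case: hS.
    by exists n.
  have [_ [m [Qm mx] <-] hm] := sup_adherent (divr_gt0 sup0 (ltr0n R 2)) hS.
  exists m => //; rewrite /sel /P asboolT//; split=> //; exists x; split=> //.
  move=> i Qi ix; have : (r i <= sup S)%R.
    by apply: ub_le_sup; [case: hS|exists i].
  lra.
move=> [n _]; rewrite /sel /P; case: asboolP => // -[Qn _] Bx.
rewrite /Om /=; exact: lt_le_trans Qn (Mx_ge _ _ _ Bx).
Qed.

(** By maximality, the mean over the larger ball [B (star n)] is at most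
    [l]. *)
Lemma maximal_ball_mean n : maximal_ball n ->
  \int[mu]_(x in B (star n)) cutw x <= (l * K * wr w1 n)%:E.
Proof.
move=> [Qn [x [Bx nmax]]].
have : ~ Q (star n).
  move=> /nmax => /(_ (bf_sub_star BF Bx)).
  by apply/negP; rewrite -ltNge (bf_star_r BF).
rewrite /Q avE lte_pdivlMl// => /negP; rewrite -leNgt => /le_trans; apply.
rewrite -EFinM lee_fin mulrC -mulrA ler_wpM2l ?(ltW l0)//.
exact: (dbl_w1 BF).
Qed.

Let l' := (2 * K ^+ 2 * l)%R.
Let l'0 : (0 < l')%R. Proof. by rewrite !mulr_gt0// exprn_gt0. Qed.

(** Let a ball through [y] have mean above [l']. If it is not larger than twice
    [B n], it lies inside [B (star n)]; otherwise its dilate still has mean above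
    [l], which maximality forbids. *)
Lemma maximal_ball_local n y : maximal_ball n -> B n y -> Om l' y ->
  l'%:E < M (fun x => inde (B (star n)) x * cutw x) y.
Proof.
move=> [Qn [x [Bx nmax]]] By /(@Mx_gt _ _ _ mu B w1 cutw y) [|m my l'm].
  by rewrite lee_fin ltW.
have [rmn|rnm] := leP (r m) (2 * r n)%R.
  apply: lt_le_trans (Mx_ge mu w1 _ my).
  suff -> : av mu B w1 (fun x => inde (B (star n)) x * cutw x) m =
      av mu B w1 cutw m by [].
  congr (_ * _); apply: eq_integral => z /set_mem mz.
  rewrite inde_in ?mul1e//; apply: (bf_engulf BF) mz => //.
  by exists y.
exfalso; have rn0 := bf_r0 BF n.
have nQ : ~ Q (star m).
  move=> /nmax; have /[swap]/[apply] : B (star m) x.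
    apply: (bf_engulf BF) Bx; first by exists y.
    by have := bf_r0 BF m; lra.
  have := bf_star_r BF m; have := bf_r0 BF m; lra.
move: nQ; rewrite /Q avE lte_pdivlMl// => /negP; rewrite -leNgt => h.
move: l'm; rewrite -/(av' m) avE lte_pdivlMl// => h'.
have : (wr w1 m)%:E * l'%:E < (wr w1 (star m))%:E * l%:E.
  apply: (lt_le_trans h'); apply: le_trans h.
  by apply: int_subset; [by []|exact: mB|exact: mB|exact: (bf_sub_star BF)].
rewrite -!EFinM lte_fin; apply/negP; rewrite -leNgt /l'.
have := dbl_w1 BF m => hm.
apply: (@le_trans _ _ (K * wr w1 m * l)%R); first by rewrite ler_wpM2r// ltW.
have -> : (wr w1 m * (2 * K ^+ 2 * l) = (2 * K) * (K * wr w1 m * l))%R by ring.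
have h0 : (0 <= K * wr w1 m * l)%R by rewrite !mulr_ge0// ltW.
by rewrite ler_peMl//; have := K1; lra.
Qed.

Lemma maximal_ball_measure n : maximal_ball n ->
  mu (B n `&` Om l') <= (wr w1 n / 2)%:E.
Proof.
move=> Pn; set f := fun x => inde (B (star n)) x * cutw x.
have nf : nnm f by rewrite /f; nnm; exact: mB.
have := Mx_weak_type BF g1 (dbl_w1 BF) (ltW K0) nf l'0.
rewrite [X in _ * X](int_cst mu (c := 1)) ?lee01//; last first.
  by apply: nnm_gt; exact: (nnm_Mx BF).
rewrite mul1e => weak.
have h : l'%:E * mu (B n `&` Om l') <= l'%:E * (wr w1 n / 2)%:E.
  apply: (@le_trans _ _ (l'%:E * mu [set x | l'%:E < M f x])).
    rewrite lee_wpmul2l ?lee_fin ?(ltW l'0)//; apply: le_measure; rewrite ?inE.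
    - by apply: measurableI => //; exact: mB.
    - by apply: nnm_gt; exact: (nnm_Mx BF).
    - by move=> y [By Oy]; exact: maximal_ball_local.
  apply: (le_trans weak); under eq_integral do rewrite mule1.
  rewrite -int_inde.
  apply: (@le_trans _ _ (K%:E * (l * K * wr w1 n)%:E)).
    by rewrite lee_wpmul2l ?lee_fin ?(ltW K0)//; exact: maximal_ball_mean.
  by rewrite -!EFinM lee_fin /l' le_eqVlt; apply/orP; left; apply/eqP; field.
by move: h; rewrite lee_pmul2l// lte_fin.
Qed.

Let C1 := ((2 * L) ^+ 2 / k)%R.

(** More than half of [B n] lies outside the higher level set by
    [maximal_ball_measure], hence carries a fixed proportion of the [s]-mass of
    [B (star n)]; on that ball the cut-off is almost constant. *)
Lemma maximal_ball_mass n : maximal_ball n ->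
  \int[mu]_(x in B (star n)) cutw x <=
  C1%:E * \int[mu]_(x in B n `\` Om l') cutw x.
Proof.
move=> Pn; have Qn := Pn.1; have L20 : (0 <= 2 * L)%R by rewrite mulr_ge0// ltW.
set E := B n `\` Om l'.
have mE : measurable E by apply: measurableD => //; exact: mB.
have Estar : E `<=` B (star n) by move=> x [Bx _]; exact: (bf_sub_star BF).
have muE : ((2 * K)^-1 * wr w1 (star n))%:E <= mu E.
  have h : (wr w1 n)%:E <= mu E + (wr w1 n / 2)%:E.
    rewrite -(wr_w1 BF).
    apply: (@le_trans _ _ (mu (E `|` (B n `&` Om l')))).
      by rewrite /E setUC setUIDK.
    apply: le_trans (measureU2 _ mE _) _; first by apply: measurableI => //; exact: mB.
    by rewrite leeD2l//; exact: maximal_ball_measure.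
  have wE : wr w1 n = (wr w1 n / 2 + wr w1 n / 2)%R by field.
  move: h; rewrite {1}wE EFinD leeD2rE// => h; apply: le_trans h.
  rewrite lee_fin invfM -mulrA mulrC ler_wpM2r ?invr_ge0//.
  by rewrite ler_pdivrMl//; exact: (dbl_w1 BF).
have [x0 Bx0] := bf_nonempty BF n.
have x0s : B (star n) x0 by exact: (bf_sub_star BF).
have px0 : 0 <= phi x0 by case: nphi.
apply: (@le_trans _ _ ((2 * L)%:E * (phi x0 * (wr s (star n))%:E))).
  rewrite -wrE// muleA -int_inZ ?mule_ge0 ?lee_fin//; last exact: mB.
  apply: int_in_le; [by []|by nnm; rewrite mule_ge0|exact: mB|].
  move=> x Bx; rewrite /cutw lee_wpmul2r//; first by case: ns.
  exact: cutoff_comparable Qn Bx x0s.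
have h1 : (wr s (star n))%:E <= (k^-1)%:E * \int[mu]_(x in E) (s x)%:E.
  by rewrite lee_pdivlMl// -EFinM; exact: low.
have h2 : phi x0 * \int[mu]_(x in E) (s x)%:E <=
    (2 * L)%:E * \int[mu]_(x in E) cutw x.
  rewrite -int_inZ// -int_inZ ?lee_fin//.
  apply: int_in_le => //; [by nnm|by nnm|].
  move=> x Ex; rewrite /cutw muleA lee_wpmul2r//; first by case: ns.
  exact: cutoff_comparable Qn x0s (Estar _ Ex).
have -> : C1%:E * \int[mu]_(x in E) cutw x =
    (2 * L)%:E * ((k^-1)%:E * ((2 * L)%:E * \int[mu]_(x in E) cutw x)).
  by rewrite !muleA -!EFinM; congr (_%:E * _); rewrite /C1; ring.
rewrite lee_wpmul2l ?lee_fin//.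
apply: (@le_trans _ _ (phi x0 * ((k^-1)%:E * \int[mu]_(x in E) (s x)%:E))).
  by rewrite lee_wpmul2l.
by rewrite muleCA lee_wpmul2l// lee_fin invr_ge0 ltW.
Qed.

Lemma level_mass : \int[mu]_(x in Om l) cutw x <=
  C1%:E * \int[mu]_(x in Om l `\` Om l') cutw x.
Proof.
have C10 : 0 <= C1%:E.
  by rewrite lee_fin divr_ge0 ?exprn_ge0 ?mulr_ge0 ?ltW.
rewrite {1}Om_maximal; apply: (vitali_int_le BF) => // t ut dt tP.
have tP' n : n \in t -> maximal_ball n by move=> /tP/asboolP.
have mD : measurable (Om l `\` Om l') by exact: measurableD.
have mBD n : measurable (B n `\` Om l') by apply: measurableD => //; exact: mB.
apply: (@le_trans _ _ (C1%:E * \sum_(n <- t) \int[mu]_(x in B n `\` Om l') cutw x)).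
  rewrite ge0_sume_distrr; last by move=> n _; exact: int_in_ge0.
  rewrite big_seq [leRHS]big_seq; apply: lee_sum => n nt.
  exact: maximal_ball_mass (tP' _ nt).
rewrite lee_wpmul2l//.
apply: int_trivIset_le => //.
- move=> i j it jt [x [[ix _] [jx _]]]; apply: dt => //; by exists x.
- move=> n nt x [Bx nx]; split => //.
  rewrite Om_maximal; exists n => //; rewrite /sel.
  by rewrite /P asboolT//; exact: tP'.
Qed.

End decay.

(** * Reverse Hoelder inequality, openness and nesting of the classes *)

Section reverse_holder.
Context {d : measure_display} {X : measurableType d} {R : realType}.
Variable mu : {measure set X -> \bar R}.
Variables (B : nat -> set X) (r : nat -> R) (star : nat -> nat) (K : R).
Hypothesis BF : ball_family mu B r star K.
Hypothesis dense : dense_bcontinuous mu B.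
Local Notation mB := (bf_meas BF).
Local Notation M := (Mx mu B w1).
Local Notation wr := (wr mu B).
Local Notation good := (good_weight mu B).
Local Open Scope ereal_scope.

Lemma ler_wln (x y : R) : (0 < x -> x <= y -> ln x <= ln y)%R.
Proof. by move=> x0 xy; rewrite ler_ln// posrE// (lt_le_trans x0). Qed.

(** Gehring's argument: the mass above the heights [(2 K ^ 2) ^ j * height]
    decays geometrically in [j]. *)
Lemma Ap_reverse_holder a w s : Ap mu B a w s ->
  exists2 e : R, (0 < e)%R & exists2 C : R, (0 < C)%R & forall b,
    \int[mu]_(x in B b) (s x `^ (1 + e))%:E <=
    (C * (wr w1 b * (wr s b / wr w1 b) `^ (1 + e)))%:E.
Proof.
move=> A; have A' := Ap_sym A; have gs := ap_s A.
have K1 := ball_family_K_ge1 BF; have K0 : (0 < K)%R by exact: lt_le_trans K1.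
have dl0 : (0 < (2 * K)^-1)%R by rewrite invr_gt0 mulr_gt0.
have [k k0 low] := Ap_lower BF A' dl0.
have [L L0 dL] := Ap_dbl BF A'.
pose L' := (L + 1)%R; have L'1 : (1 <= L')%R by rewrite lerDr.
have sL : dbl mu B star s L'.
  move=> n; apply: (le_trans (dL n)); rewrite ler_wpM2r ?lerDl//.
  by rewrite ltW// (wr_gt0 BF).
pose C1 := ((2 * L') ^+ 2 / k)%R.
have C10 : (0 < C1)%R by rewrite divr_gt0// exprn_gt0// mulr_gt0// (lt_le_trans _ L'1).
pose th := (1 - (1 + C1)^-1)%R.
have th01 : (0 < th < 1)%R.
  rewrite /th subr_gt0 invf_lt1 ?ltrDl ?addr_gt0// C10/=.
  by rewrite ltrBlDr ltrDl invr_gt0 addr_gt0.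
have /andP[th0 th1] := th01.
pose be := (2 * K ^+ 2)%R.
have be2 : (2 <= be)%R by rewrite /be ler_peMr// exprn_ege1.
have be0 : (0 < be)%R by exact: lt_le_trans be2.
have lnbe : (0 < ln be)%R by rewrite ln_gt0// (lt_le_trans _ be2)// ltr1n.
(* The exponent [e] satisfies [be ^ e = q] with [q * th < 1]: raising the heights
   to the power [e] does not destroy the decay of the masses. *)
pose q := (2 / (1 + th))%R.
have q1 : (1 < q)%R.
  rewrite /q ltr_pdivlMr; last by rewrite addr_gt0.
  by rewrite mul1r -[ltRHS](natrD _ 1 1) ltrD2l.
pose e := (ln q / ln be)%R.
have e0 : (0 < e)%R by rewrite divr_gt0// ln_gt0.
have qe : (be `^ e = q)%R.
  rewrite powR_exp// /e divfK ?gt_eqF// exp_ln//.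
  exact: lt_trans q1.
have qth : (0 <= q * th < 1)%R.
  rewrite mulr_ge0 ?ltW ?(lt_trans _ q1)//=.
  rewrite /q mulrAC ltr_pdivrMr; last by rewrite addr_gt0.
  by rewrite mul1r mulr_natl mulr2n ltrD2r.
pose C3 := (1 + q * (1 - q * th)^-1)%R.
have C30 : (0 < C3)%R.
  rewrite /C3 addr_gt0// mulr_gt0 ?(lt_trans _ q1)// invr_gt0 subr_gt0.
  by case/andP: qth.
exists e => //; exists (2 * C3 * (2 * K ^+ 2) `^ e)%R.
  by rewrite !mulr_gt0// powR_gt0.
move=> b; set S := wr s b; set m := wr w1 b.
have S0 : (0 < S)%R by exact: (wr_gt0 BF).
have m0 : (0 < m)%R by apply: (wr_gt0 BF); exact: good_w1 BF.
pose sp := cutw B star s L' b.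
have nsp : nnm sp by apply: (nnm_cutw BF).
have ns := nnm_weight gs.
pose h := height mu B K s b.
have h0 : (0 < h)%R by exact: (height_gt0 BF).
pose Om t := [set x | t%:E < M sp x].
have nM : nnm (M sp) by apply: (nnm_Mx BF) => //; exact: good_w1 BF.
have mOm t : measurable (Om t) by exact: nnm_gt.
pose I t := \int[mu]_(x in Om t) sp x.
have Ifin t : I t \is a fin_num.
  rewrite ge0_fin_numE; last exact: int_in_ge0.
  apply: (@le_lt_trans _ _ (2 * S)%:E); last exact: ltry.
  apply: le_trans (int_cutw_le BF b gs L'1 sL).
  apply: (@int_subset _ _ _ mu _ (Om t) setT) => //.
have I0 t : (0 <= fine (I t))%R by rewrite fine_ge0// int_in_ge0.
have step t : (h <= t)%R -> (fine (I (be * t)) <= th * fine (I t))%R.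
  move=> ht; have t0 : (0 < t)%R by exact: lt_le_trans ht.
  have := level_mass BF gs L'1 sL k0 low ht.
  rewrite -/C1 -/sp -/be.
  have Osub : Om (be * t)%R `<=` Om t.
    move=> x; apply: le_lt_trans; rewrite lee_fin ler_peMl ?(ltW t0)//.
    by rewrite (le_trans _ be2)// ler1n.
  have IE : I t = I (be * t)%R + \int[mu]_(x in Om t `\` Om (be * t)%R) sp x.
    rewrite /I -[in LHS](setDUK Osub) ge0_integral_setU//.
    - exact: measurableD.
    - by apply: measurable_funS nsp.1 => //; apply: measurableU => //; exact: measurableD.
    - by move=> x _; case: nsp.
    - by apply/disj_set2P; rewrite setDIK.
  set D := \int[mu]_(x in _ `\` _) _ in IE *.
  have D0 : 0 <= D by exact: int_in_ge0.
  have Dfin : D \is a fin_num.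
    rewrite ge0_fin_numE//; apply: (@le_lt_trans _ _ (I t)).
      by rewrite IE leeDr// int_in_ge0.
    by rewrite -ge0_fin_numE ?Ifin// int_in_ge0.
  rewrite -/(I t) -(fineK (Ifin t)) -(fineK Dfin) -EFinM lee_fin => ID.
  have : fine (I t) = (fine (I (be * t)) + fine D)%R.
    by rewrite IE fineD.
  have := I0 (be * t)%R; have : (0 <= fine D)%R by exact: fine_ge0.
  move: (fine (I t)) (fine (I (be * t)%R)) (fine D) ID => x y z ID z0 y0 xyz.
  suff h1 : ((1 + C1)^-1 * x <= x - y)%R.
    by rewrite /th mulrBl mul1r lerBrDr -lerBrDl.
  rewrite ler_pdivrMl; last by rewrite addr_gt0.
  have -> : (x - y = z)%R by rewrite xyz addrAC subrr add0r.
  by apply: (le_trans ID); rewrite mulrDl mul1r lerDr.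
have Ij j : (fine (I (be ^+ j * h)) <= th ^+ j * (2 * S))%R.
  elim: j => [|j ih].
    rewrite !mul1r -lee_fin fineK//.
    apply: le_trans (int_cutw_le BF b gs L'1 sL).
    by apply: (@int_subset _ _ _ mu _ (Om h) setT).
  have -> : (be ^+ j.+1 * h = be * (be ^+ j * h))%R by rewrite exprS mulrA.
  have -> : (th ^+ j.+1 * (2 * S) = th * (th ^+ j * (2 * S)))%R.
    by rewrite exprS mulrA.
  have hj : (h <= be ^+ j * h)%R.
    by rewrite ler_peMl ?(ltW h0)// exprn_ege1// (le_trans _ be2)// ler1n.
  by apply: (le_trans (step _ hj)); rewrite ler_wpM2l// ltW.
have main : \int[mu]_x (M sp x `^ e * sp x) <= (h `^ e * (2 * S) * C3)%:E.
  have nb j : nnm (fun x => b2e ((be ^+ j * h)%:E < M sp x) : \bar R) by exact: nnm_b2e.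
  apply: (@le_trans _ _ (\int[mu]_x ((h `^ e)%:E * sp x + q%:E *
     \sum_(j <oo) (((be ^+ j * h) `^ e)%:E *
        (b2e ((be ^+ j * h)%:E < M sp x) * sp x))))).
    have nr : nnm (fun x => (h `^ e)%:E * sp x + q%:E *
     \sum_(j <oo) (((be ^+ j * h) `^ e)%:E *
        (b2e ((be ^+ j * h)%:E < M sp x) * sp x))).
      by nnm; rewrite ltW// (lt_trans _ q1).
    apply: int_le => //; first by nnm.
    move=> x; have sp0 : 0 <= sp x by case: nsp.
    have Mx0 : 0 <= M sp x by case: nM.
    have ser0 j : 0 <= ((be ^+ j * h) `^ e)%:E *
        (b2e ((be ^+ j * h)%:E < M sp x) * sp x).
      by apply: mule_ge0; [rewrite lee_fin powR_ge0|exact: mule_ge0 (b2e_ge0 _) sp0].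
    have q0 : 0 <= q%:E by rewrite lee_fin ltW// (lt_trans _ q1).
    have [hM|Mh] := ltP h%:E (M sp x); last first.
      apply: (@le_trans _ _ ((h `^ e)%:E * sp x)).
        by rewrite lee_wpmul2r// -poweR_EFin; apply: le_poweR => //; exact: ltW.
      by rewrite leeDl// mule_ge0//; apply: nneseries_ge0.
    apply: (@le_trans _ _ (q%:E * \sum_(j <oo) (((be ^+ j * h) `^ e)%:E *
        (b2e ((be ^+ j * h)%:E < M sp x) * sp x)))); last first.
      by rewrite leeDr// mule_ge0// lee_fin powR_ge0.
    have := le_exp_series be2 h0 e0 hM; rewrite qe.
    set T := \sum_(j <oo) _ => H.
    apply: (@le_trans _ _ (q%:E * T * sp x)); first by rewrite lee_wpmul2r.
    rewrite -muleA lee_wpmul2l//.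
    rewrite -nneseriesZr//.
      by under eq_eseriesr do rewrite -muleA.
    by move=> j; rewrite mule_ge0 ?b2e_ge0// lee_fin powR_ge0.
  have q0 : (0 <= q)%R by rewrite ltW// (lt_trans _ q1).
  have spS : \int[mu]_x sp x <= (2 * S)%:E by exact: (int_cutw_le BF b gs L'1 sL).
  rewrite intD; [|by nnm|by nnm].
  rewrite intZ ?lee_fin ?powR_ge0//.
  rewrite intZ ?lee_fin//; last by nnm.
  rewrite int_series; last by move=> j; nnm.
  apply: (@le_trans _ _ ((h `^ e)%:E * (2 * S)%:E + q%:E * \sum_(j <oo)
      (h `^ e * (2 * S))%:E * ((q * th) ^+ j)%:E)).
    apply: leeD; first by rewrite lee_wpmul2l// lee_fin powR_ge0.
    rewrite lee_wpmul2l ?lee_fin//; apply: lee_nneseries => [j _ _|j _].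
      by apply: int_ge0; nnm.
    rewrite intZ ?lee_fin ?powR_ge0//; last by nnm.
    have -> : \int[mu]_x (b2e ((be ^+ j * h)%:E < M sp x) * sp x) =
        (fine (I (be ^+ j * h)%R))%:E.
      rewrite fineK// /I [RHS]int_inde; apply: eq_integral => x _.
      by rewrite b2e_inde.
    rewrite -!EFinM lee_fin powRM ?exprn_ge0 ?(ltW be0) ?(ltW h0)//.
    have -> : ((be ^+ j) `^ e = q ^+ j)%R.
      by rewrite -qe powR_exprn// ltW.
    rewrite [((q * th) ^+ j)%R]exprMn.
    have := Ij j; set y := fine (I _) => yj.
    have c0 : (0 <= q ^+ j * h `^ e)%R by rewrite mulr_ge0 ?exprn_ge0 ?powR_ge0.
    apply: (le_trans (ler_wpM2l c0 yj)).
    by rewrite le_eqVlt; apply/orP; left; apply/eqP; ring.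
  rewrite nneseriesZl; last by move=> j _; rewrite lee_fin exprn_ge0//; case/andP: qth.
  rewrite geometric_eseries// -!EFinM -EFinD lee_fin /C3; lra.
have g1 := good_w1 BF.
have Sb : mu.-integrable setT (EFin \o (fun x => \1_(B b) x * s x)%R).
  apply/integrableP; split.
    apply/measurable_EFinP; apply: measurable_funM; last exact: gw_meas gs.
    by apply: measurable_indic; exact: mB.
  apply: le_lt_trans (gw_fin gs b); rewrite [leRHS]int_inde.
  rewrite le_eqVlt; apply/orP; left; apply/eqP; apply: eq_integral => x _ /=.
  rewrite ger0_norm ?EFinM// mulr_ge0 ?indicE//.
  by rewrite ltW// (gw_gt0 gs).
have f0 x : (0 <= \1_(B b) x * s x)%R.
  by rewrite mulr_ge0 ?indicE// ltW// (gw_gt0 gs).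
have nfb : nnm (fun x => inde (B b) x * (s x)%:E) by nnm; exact: mB.
have sM : {ae mu, forall x, inde (B b) x * (s x)%:E <= M sp x}.
  apply: filterS (Mx_ae_ge BF dense f0 Sb) => x; rewrite EFinM => /le_trans; apply.
  have -> : (fun y => (\1_(B b) y * s y)%:E) = (fun y => inde (B b) y * (s y)%:E).
    by apply/funext => y; rewrite EFinM.
  apply: (Mx_mono BF) => // y.
  apply: lee_wpmul2r; first by case: ns.
  have [By|nBy] := pselect (B b y).
    by rewrite inde_in//; exact: cutoff_ge1.
  by rewrite inde_out//; case: (nnm_cutoff BF b L'1).
have nse : nnm (fun x => (s x `^ (1 + e))%:E : \bar R).
  apply: nnm_EFin => [|x]; last exact: powR_ge0.
  exact: (measurableT_comp (measurable_powR _)) (gw_meas gs).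
apply: (@le_trans _ _ (\int[mu]_x (M sp x `^ e * sp x))).
  rewrite int_inde; apply: int_ae_le; [by nnm; exact: mB|by nnm|].
  apply: filterS sM => x; have [Bx|nBx] := pselect (B b x); last first.
    rewrite inde_out// !mul0e => _; rewrite mule_ge0 ?poweR_ge0//; by case: nsp.
  rewrite inde_in// !mul1e => sMx; have s0 := gw_gt0 gs x.
  have -> : (s x `^ (1 + e))%:E = (s x)%:E `^ e * (s x)%:E.
    rewrite poweR_EFin -EFinM addrC powRD ?powRr1 ?(ltW s0)//.
    by rewrite (gt_eqF s0) implybT.
  apply: lee_pmul; [exact: poweR_ge0|by case: ns| |].
    by apply: le_poweR => //; [exact: ltW|case: ns].
  rewrite /sp /cutw -[leLHS]mul1e; apply: lee_wpmul2r; first by case: ns.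
  exact: cutoff_ge1.
apply: (le_trans main); rewrite lee_fin le_eqVlt; apply/orP; left; apply/eqP.
have Sm0 : (0 < S / m)%R by rewrite divr_gt0.
have -> : h = (2 * K ^+ 2 * (S / m))%R by rewrite /h /height -/S -/m; ring.
rewrite powRM ?(ltW be0) ?(ltW Sm0)// [((S / m) `^ (1 + e))%R]powRD; last first.
  by rewrite (gt_eqF Sm0) implybT.
rewrite powRr1 ?(ltW Sm0)//.
by field; rewrite gt_eqF.
Qed.

(** The reverse Hoelder inequality for [s] is the comparison of means required
    by [Ap_power] for the exponent [1 + e], and an exponent above [1] increases
    [a]. *)
Lemma Ap_open a w s : Ap mu B a w s ->
  exists a' s', (a < a')%R /\ Ap mu B a' w s'.
Proof.
move=> A; have [e e0 [C C0 RH]] := Ap_reverse_holder A.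
have gs := ap_s A; have /andP[a0 a1] := ap_a A.
have g1 := good_w1 BF.
have gse : good (fun x => s x `^ (1 + e))%R.
  apply: good_weight_powR; [exact: gw_meas gs|exact: gw_gt0 gs|].
  by move=> n; apply: le_lt_trans (RH n) _; rewrite ltry.
have ge0 : (0 < 1 + e)%R by rewrite addr_gt0.
have D0 : (0 < 1 - a + (1 + e) * a)%R.
  by rewrite addr_gt0 ?mulr_gt0// subr_gt0.
exists ((1 + e) * a / (1 - a + (1 + e) * a))%R, (fun x => s x `^ (1 + e))%R.
split.
  have h : (0 < a * (e * (1 - a)))%R by rewrite !mulr_gt0// subr_gt0.
  by rewrite ltr_pdivlMr//; lra.
apply: (Ap_power (c' := ln C)) => // n.
have m0 : (0 < wr w1 n)%R by exact: (wr_gt0 BF).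
have S0 : (0 < wr s n)%R by exact: (wr_gt0 BF).
have Se0 : (0 < wr (fun x => s x `^ (1 + e))%R n)%R by exact: (wr_gt0 BF).
have Sm0 : (0 < wr s n / wr w1 n)%R by rewrite divr_gt0.
have p0 := powR_gt0 (1 + e) Sm0.
have := RH n; rewrite wrE// lee_fin => h.
have {}h := ler_wln Se0 h.
apply: (le_trans h).
rewrite lnM ?posrE ?mulr_gt0// lnM ?posrE// ln_powR ln_div ?posrE//.
by rewrite addrA.
Qed.

(** Here the exponent in [Ap_power] is below [1], and the comparison of means
    is Jensen's inequality, up to the factor [2] that comes from
    [y ^ g <= 1 + y]. *)
Lemma Ap_nest a w s (a' : R) : Ap mu B a w s -> (0 < a' < a)%R ->
  exists s', Ap mu B a' w s'.
Proof.
move=> A /andP[a'0 a'a].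
have gs := ap_s A; have /andP[a0 a1] := ap_a A.
have g1 := good_w1 BF.
have b'0 : (0 < 1 - a')%R by rewrite subr_gt0 (lt_trans a'a).
have b0 : (0 < 1 - a)%R by rewrite subr_gt0.
pose g := (a' * (1 - a) / (a * (1 - a')))%R.
have g0 : (0 < g)%R by rewrite divr_gt0// mulr_gt0.
have g1' : (g <= 1)%R by rewrite /g ler_pdivrMr ?mulr_gt0// mul1r; nra.
have a'E : (g * a / (1 - a + g * a) = a')%R.
  rewrite /g; field; rewrite !gt_eqF//=.
  by rewrite addr_gt0 ?mulr_gt0.
have nsg : nnm (fun x => (s x `^ g)%:E : \bar R).
  apply: nnm_EFin => [|x]; last exact: powR_ge0.
  exact: (measurableT_comp (measurable_powR _)) (gw_meas gs).
have ns := nnm_weight gs.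
have mean n : \int[mu]_(x in B n) (s x `^ g)%:E <=
    (2 * (wr w1 n * (wr s n / wr w1 n) `^ g))%:E.
  set m := wr w1 n; set S := wr s n.
  have m0 : (0 < m)%R by exact: (wr_gt0 BF).
  have S0 : (0 < S)%R by exact: (wr_gt0 BF).
  have Sm0 : (0 < S / m)%R by rewrite divr_gt0.
  set c := (S / m)%R in Sm0 *.
  apply: (@le_trans _ _ (\int[mu]_(x in B n) ((c `^ g)%:E * (1 + (c^-1)%:E * (s x)%:E)))).
    apply: int_in_le; [by []|by nnm; rewrite invr_ge0 ltW|exact: mB|].
    move=> x Bx; have s0 := gw_gt0 gs x.
    have -> : (c `^ g)%:E * (1 + (c^-1)%:E * (s x)%:E) =
        (c `^ g * (1 + c^-1 * s x))%:E by [].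
    rewrite lee_fin.
    have sE : (s x = c * (c^-1 * s x))%R by rewrite mulrA mulfV ?mul1r// gt_eqF.
    have y0 : (0 < c^-1 * s x)%R by rewrite mulr_gt0// invr_gt0.
    rewrite {1}sE powRM ?(ltW y0) ?(ltW Sm0)// ler_wpM2l ?powR_ge0//.
    have [y1|/ltW y1] := leP (c^-1 * s x)%R 1%R.
      apply: (@le_trans _ _ 1%R); last by rewrite lerDl ltW.
      by rewrite -(congr1 (@^~ g) (powR1 R)); apply: le_powR => //; exact: ltW.
    apply: (@le_trans _ _ (c^-1 * s x)%R); last by rewrite lerDr.
    exact: ler1_powR.
  rewrite int_inZ ?lee_fin ?powR_ge0//; [|by nnm; rewrite invr_ge0 ltW|exact: mB].
  rewrite int_inD; [|by nnm|by nnm; rewrite invr_ge0 ltW|exact: mB].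
  rewrite int_inZ ?lee_fin ?invr_ge0 ?(ltW Sm0)//; last exact: mB.
  rewrite (int_cst mu (c := 1)) ?lee01//; last exact: mB.
  rewrite mul1e (wr_w1 BF) wrE// -/m -/S.
  have -> : (c `^ g)%:E * (m%:E + (c^-1)%:E * S%:E) =
      (c `^ g * (m + c^-1 * S))%:E by [].
  rewrite lee_fin.
  rewrite le_eqVlt; apply/orP; left; apply/eqP.
  by rewrite /c; field; rewrite !gt_eqF.
have gsg : good (fun x => s x `^ g)%R.
  apply: good_weight_powR; [exact: gw_meas gs|exact: gw_gt0 gs|].
  by move=> n; apply: le_lt_trans (mean n) _; rewrite ltry.
exists (fun x => s x `^ g)%R; rewrite -a'E.
apply: (Ap_power (c' := ln 2)) => // n.
have m0 : (0 < wr w1 n)%R by exact: (wr_gt0 BF).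
have S0 : (0 < wr s n)%R by exact: (wr_gt0 BF).
have Se0 : (0 < wr (fun x => s x `^ g)%R n)%R by exact: (wr_gt0 BF).
have Sm0 : (0 < wr s n / wr w1 n)%R by rewrite divr_gt0.
have p0 := powR_gt0 g Sm0.
have := mean n; rewrite wrE// lee_fin => h.
have {}h := ler_wln Se0 h.
apply: (le_trans h).
rewrite lnM ?posrE ?mulr_gt0// lnM ?posrE// ln_powR ln_div ?posrE//.
by rewrite addrA.
Qed.

End reverse_holder.

(** * The Rubio de Francia iteration *)

Section rubio_de_francia.
Context {d : measure_display} {X : measurableType d} {R : realType}.
Variable mu : {measure set X -> \bar R}.
Local Open Scope ereal_scope.
Implicit Types f g : X -> \bar R.

(** The properties common to the maximal operator and to its dual on which the
    iteration relies. *)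
Record sublinear (T : (X -> \bar R) -> X -> \bar R) : Prop := Sublinear {
  sl_nnm : forall f, nnm f -> nnm (T f);
  sl_mono : forall f g, nnm f -> nnm g -> (forall x, f x <= g x) ->
    forall x, T f x <= T g x;
  sl_D : forall f g, nnm f -> nnm g ->
    forall x, T (fun y => f y + g y) x <= T f x + T g x;
  sl_Z : forall (c : R) f, nnm f -> (0 <= c)%R ->
    forall x, T (fun y => c%:E * f y) x <= c%:E * T f x;
  sl_series : forall f : nat -> X -> \bar R, (forall k, nnm (f k)) ->
    forall x, T (fun y => \sum_(k <oo) f k y) x <= \sum_(k <oo) T (f k) x }.

Variables (T : (X -> \bar R) -> X -> \bar R) (A : R).
Hypotheses (HT : sublinear T) (A1 : (1 <= A)%R).
Let A0 : (0 < A)%R. Proof. exact: lt_le_trans A1. Qed.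
Let c := ((4 * A)^-1)%R.
Let c0 : (0 < c)%R. Proof. by rewrite invr_gt0 mulr_gt0. Qed.

Definition rdf f x := \sum_(k <oo) ((((4 * A)^-1 ^+ k)%R)%:E * iter k T f x).

Lemma nnm_iter f k : nnm f -> nnm (iter k T f).
Proof. by move=> nf; elim: k => //= k ih; exact: sl_nnm. Qed.

Let ck0 k : 0 <= ((c ^+ k)%R)%:E.
Proof. by rewrite lee_fin exprn_ge0// ltW. Qed.

Let nterm f k : nnm f -> nnm (fun x => ((c ^+ k)%R)%:E * iter k T f x).
Proof. by move=> nf; apply: nnmM (nnm_iter k nf); exact: nnm_cst. Qed.

Lemma nnm_rdf f : nnm f -> nnm (rdf f).
Proof. by move=> nf; apply: nnm_series => k; exact: nterm. Qed.

Lemma rdf_ge f x : nnm f -> f x <= rdf f x.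
Proof.
move=> nf; apply: le_trans (nneseries_ge_term 0%N _).
  by rewrite expr0 mul1e.
by move=> k; case: (nterm k nf).
Qed.

Lemma rdf_stable f x : nnm f -> T (rdf f) x <= (4 * A)%:E * rdf f x.
Proof.
move=> nf; apply: le_trans (sl_series HT _ x) _; first by move=> k; exact: nterm.
apply: (@le_trans _ _ (\sum_(k <oo) ((4 * A)%:E *
    (((c ^+ k.+1)%R)%:E * iter k.+1 T f x)))).
  apply: lee_nneseries => [k _ _|k _]; first by case: (sl_nnm HT (nterm k nf)).
  apply: le_trans (sl_Z HT (nnm_iter k nf) _ _) _; first by rewrite exprn_ge0// ltW.
  by rewrite muleA -EFinM exprS mulrA mulfV ?mul1r// gt_eqF// mulr_gt0.
rewrite nneseriesZl; last by move=> k _; case: (nterm k.+1 nf).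
rewrite lee_wpmul2l ?lee_fin ?mulr_ge0 ?(ltW A0)//.
apply: (@nneseries_shift_le _ (fun k => ((c ^+ k)%R)%:E * iter k T f x)) => k.
by case: (nterm k nf).
Qed.

Lemma rdfD f g x : nnm f -> nnm g ->
  rdf (fun y => f y + g y) x <= rdf f x + rdf g x.
Proof.
move=> nf ng; have nfg := nnmD nf ng.
have it k y : iter k T (fun y => f y + g y) y <= iter k T f y + iter k T g y.
  elim: k y => //= k ih y; have nfk := nnm_iter k nf; have ngk := nnm_iter k ng.
  by apply: le_trans (sl_D HT nfk ngk y); apply: (sl_mono HT) => //;
    [exact: nnm_iter|exact: nnmD].
rewrite /rdf -nneseriesD; last 2 first.
- by move=> k _ _; case: (nterm k nf).
- by move=> k _ _; case: (nterm k ng).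
apply: lee_nneseries => [k _ _|k _]; first by case: (nterm k nfg).
rewrite -ge0_muleDr; last 2 first.
- by case: (nnm_iter k nf).
- by case: (nnm_iter k ng).
by rewrite lee_wpmul2l.
Qed.

(** The ratio [1 / (4 A)] is [1 / 2] times [1 / (2 A)]: the first factor sums
    the series, the second one compensates the norms of the iterates and leaves
    a summable sequence. *)
Lemma rdf_bounded (w : X -> R) (C q : R) f : measurable_fun setT w ->
  (forall x, 0 <= w x)%R -> (1 <= q)%R -> (0 <= C <= A)%R ->
  (forall g, nnm g -> \int[mu]_x (T g x `^ q * (w x)%:E) <=
     C%:E * \int[mu]_x (g x `^ q * (w x)%:E)) -> nnm f ->
  \int[mu]_x (rdf f x `^ q * (w x)%:E) <=
    (2 `^ q * 2)%:E * \int[mu]_x (f x `^ q * (w x)%:E).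
Proof.
move=> mw w0 q1 /andP[C0 CA] HC nf; have nw : nnm (fun x => (w x)%:E) by nnm.
have q0 : (0 < q)%R by exact: lt_le_trans q1.
pose a k x := (((2 * A)^-1 ^+ k)%R)%:E * iter k T f x.
have a2 k : (0 <= (2 * A)^-1 ^+ k)%R by rewrite exprn_ge0// invr_ge0 mulr_ge0 ?(ltW A0).
have na k : nnm (a k).
  by apply: nnmM (nnm_iter k nf); apply: nnm_cst; rewrite lee_fin.
have rE x : rdf f x = \sum_(k <oo) (((2^-1 ^+ k)%R)%:E * a k x).
  apply: eq_eseriesr => k _; rewrite /a muleA -EFinM -exprMn -invfM.
  by rewrite mulrA -natrM.
have h2 : (0 <= (2:R)^-1 < 1)%R by rewrite invr_ge0 ler0n invf_lt1// ltr1n.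
set I := \int[mu]_x (f x `^ q * (w x)%:E).
have I0 : 0 <= I by apply: int_ge0; nnm.
apply: (@le_trans _ _ (\int[mu]_x ((2 `^ q)%:E * \sum_(k <oo) (a k x `^ q * (w x)%:E)))).
  have nr := nnm_rdf nf.
  apply: int_le; [by nnm|by nnm|].
  move=> x; rewrite nneseriesZr; last 2 first.
  - by move=> k; exact: poweR_ge0.
  - by case: nw.
  rewrite muleA lee_wpmul2r//; first by case: nw.
  rewrite rE; have := @poweR_geometric_series R 2^-1%R q (fun k => a k x) h2 q0.
  have -> : ((1 - 2^-1)^-1 = 2 :> R)%R by field.
  by apply => k; case: (na k).
rewrite intZ ?lee_fin ?powR_ge0//; last by nnm.
rewrite EFinM -muleA lee_wpmul2l ?lee_fin ?powR_ge0//.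
rewrite int_series; last by move=> k; nnm.
have itI k : \int[mu]_x (iter k T f x `^ q * (w x)%:E) <= ((A `^ q) ^+ k)%:E * I.
  elim: k => [|k ih]; first by rewrite mul1e.
  apply: le_trans (HC _ (nnm_iter k nf)) _; rewrite exprS EFinM -muleA.
  apply: lee_pmul => //; [by have nk := nnm_iter k nf; apply: int_ge0; nnm|].
  by rewrite lee_fin (le_trans CA)// le1r_powR.
apply: (@le_trans _ _ (\sum_(k <oo) (((2^-1 ^+ k)%R)%:E * I))); last first.
  rewrite (nneseriesZr (a := fun k => ((2^-1 ^+ k)%R)%:E))//.
  rewrite (geometric_eseries h2).
  by have -> : ((1 - 2^-1)^-1 = 2 :> R)%R by field.
apply: lee_nneseries => [k _ _|k _]; first by apply: int_ge0; nnm.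
have nk := nnm_iter k nf; have k0 x : 0 <= iter k T f x by case: nk.
under eq_integral => x _ do rewrite /a poweRM ?lee_fin// poweR_EFin -muleA.
rewrite intZ ?lee_fin ?powR_ge0//; last by nnm.
apply: (@le_trans _ _ (((((2 * A)^-1 ^+ k) `^ q)%R)%:E * (((A `^ q) ^+ k)%:E * I))).
  by rewrite lee_wpmul2l// lee_fin powR_ge0.
rewrite muleA -EFinM lee_wpmul2r// lee_fin.
have -> : (((2 * A)^-1 ^+ k) `^ q * (A `^ q) ^+ k = (2^-1 ^+ k) `^ q :> R)%R.
  rewrite -(powR_mulrn k (powR_ge0 A q)) powRAC powR_mulrn ?(ltW A0)//.
  have Ak : (0 <= A ^+ k)%R by rewrite exprn_ge0// ltW.
  rewrite -powRM//; congr (powR _ _).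
  by rewrite -exprMn invfM -mulrA mulVf ?mulr1// gt_eqF.
have p1 : (2^-1 ^+ k <= 1 :> R)%R by rewrite exprn_ile1// invf_le1// ler1n.
have p0 : (0 < (2:R)^-1 ^+ k)%R by rewrite exprn_gt0.
by rewrite ge1r_powR// p0.
Qed.

End rubio_de_francia.

(** * Young's inequality, the dual maximal operator and A_1 weights *)

Section young.
Context {R : realType}.

(** Young's inequality with crude constants, scaled by [T]: whichever of [x]
    and [T y ^ (p' - 1)] is the larger, one of the two summands alone
    dominates. *)
Lemma young_scaled (x y T a : R) : 0 <= x -> 0 <= y -> 0 < T -> 0 < a < 1 ->
  x * y <= T `^ (1 - a^-1) * x `^ a^-1 + T * y `^ (1 - a)^-1.
Proof.
move=> x0 y0 T0 /andP[a0 a1]; have b0 : 0 < 1 - a by rewrite subr_gt0.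
have q1 : 1 < a^-1 by rewrite invf_gt1.
have q'1 : 1 < (1 - a)^-1 by rewrite invf_gt1// ltrBlDr ltrDl.
have [xy|yx] := leP x (T * y `^ ((1 - a)^-1 - 1)).
  apply: ler_wpDl; first by rewrite mulr_ge0 ?powR_ge0.
  rewrite -(mulr_powRB1 y0 (lt_trans ltr01 q'1)) mulrCA [leLHS]mulrC.
  by rewrite ler_wpM2l.
apply: ler_wpDr; first by rewrite mulr_ge0 ?powR_ge0// ltW.
have xT : 0 <= x / T by rewrite divr_ge0// ltW.
have yle : y <= (x / T) `^ (a^-1 - 1).
  have e0 : 0 < (1 - a)^-1 - 1 by rewrite subr_gt0.
  have -> : y = (y `^ ((1 - a)^-1 - 1)) `^ (a^-1 - 1).
    rewrite -powRrM (_ : _ * _ = 1) ?powRr1//.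
    by field; rewrite !gt_eqF.
  apply: le_powR; [by rewrite subr_ge0 ltW|exact: powR_ge0|].
  by rewrite ler_pdivlMr// mulrC ltW.
apply: (le_trans (ler_wpM2l x0 yle)).
rewrite powRM ?invr_ge0 ?(ltW T0)// mulrA mulr_powRB1 ?(lt_trans ltr01 q1)//.
rewrite mulrC ler_wpM2r ?powR_ge0//.
by rewrite -powR_inv1 ?(ltW T0)// -powRrM mulN1r opprB.
Qed.

Lemma eyoung_scaled (x y : \bar R) (T a : R) : (0 <= x)%E -> (0 <= y)%E ->
  0 < T -> 0 < a < 1 ->
  (x * y <= (T `^ (1 - a^-1))%:E * x `^ a^-1 + T%:E * y `^ (1 - a)^-1)%E.
Proof.
move=> x0 y0 T0 a01; have /andP[a0 a1] := a01.
have q0 : a^-1 != 0 by rewrite invr_neq0// gt_eqF.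
have q'0 : (1 - a)^-1 != 0 by rewrite invr_neq0// gt_eqF// subr_gt0.
have h1 : (0 <= (T `^ (1 - a^-1))%:E * x `^ a^-1)%E.
  by rewrite mule_ge0 ?poweR_ge0// lee_fin powR_ge0.
have h2 : (0 <= T%:E * y `^ (1 - a)^-1)%E.
  by rewrite mule_ge0 ?poweR_ge0// lee_fin ltW.
case: x x0 h1 => [x||//] x0 h1; last first.
  rewrite poweRyr// gt0_muley ?lte_fin ?powR_gt0//.
  by rewrite addye ?leey//; case: (_ * _)%E h2.
case: y y0 h2 => [y||//] y0 h2; last first.
  have -> : (T%:E * +oo `^ (1 - a)^-1 = +oo)%E.
    by rewrite poweRyr// gt0_muley ?lte_fin.
  by rewrite addey ?leey//; case: (_ * _)%E h1.
by rewrite !poweR_EFin -!EFinM -EFinD lee_fin young_scaled.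
Qed.

End young.

Section dual_maximal.
Context {d : measure_display} {X : measurableType d} {R : realType}.
Variable mu : {measure set X -> \bar R}.
Variables (B : nat -> set X) (r : nat -> R) (star : nat -> nat) (K : R).
Hypothesis BF : ball_family mu B r star K.
Local Notation mB := (bf_meas BF).
Local Notation M := (Mx mu B w1).
Local Notation good := (good_weight mu B).
Local Open Scope ereal_scope.

Lemma sublinear_Mx : sublinear M.
Proof.
have g1 := good_w1 BF; split.
- by move=> f nf; exact: (nnm_Mx BF).
- by move=> f g nf ng fg x; exact: (Mx_mono BF).
- by move=> f g nf ng x; exact: (Mx_subadditive BF).
- by move=> c f nf c0 x; exact: (MxZ BF).
- by move=> f nf x; exact: (Mx_series BF).
Qed.

(** The maximal operator conjugated with multiplication by [w]: if [h] is stable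
    under it, then [h w] is an A_1 weight. *)
Definition Mdual (w : X -> R) (h : X -> \bar R) x : \bar R :=
  M (fun y => h y * (w y)%:E) x * ((w x)^-1)%:E.

Lemma sublinear_Mdual w : good w -> sublinear (Mdual w).
Proof.
move=> gw; have S := sublinear_Mx; have nw := nnm_weight gw.
have niw := nnm_invw gw; have niw0 x : 0 <= ((w x)^-1)%:E by case: niw.
split.
- move=> f nf; rewrite /Mdual; apply: nnmM => //; apply: (sl_nnm S); by nnm.
- move=> f g nf ng fg x; rewrite lee_wpmul2r//; apply: (sl_mono S); [by nnm|by nnm|].
  by move=> y; rewrite lee_wpmul2r//; case: nw.
- move=> f g nf ng x.
  have nfw : nnm (fun y => f y * (w y)%:E) by nnm.
  have ngw : nnm (fun y => g y * (w y)%:E) by nnm.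
  rewrite /Mdual -ge0_muleDl; last 2 first.
  + by case: (sl_nnm S nfw).
  + by case: (sl_nnm S ngw).
  rewrite lee_wpmul2r//; apply: le_trans (sl_D S nfw ngw x).
  apply: (sl_mono S); [by nnm|by nnm|].
  by move=> y; rewrite ge0_muleDl//; [case: nf|case: ng].
- move=> c f nf c0 x; have nfw : nnm (fun y => f y * (w y)%:E) by nnm.
  rewrite /Mdual muleA lee_wpmul2r//; apply: le_trans (sl_Z S nfw c0 x).
  apply: (sl_mono S); [by nnm|by nnm|].
  by move=> y; rewrite muleA.
- move=> f nf x; have nfw k : nnm (fun y => f k y * (w y)%:E) by nnm.
  have nMf k : nnm (M (fun y => f k y * (w y)%:E)) by exact: (sl_nnm S).
  rewrite /Mdual nneseriesZr//; last by move=> k; case: (nMf k).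
  rewrite lee_wpmul2r//; apply: le_trans (sl_series S nfw x).
  apply: (sl_mono S); [by nnm|by nnm|].
  move=> y; rewrite nneseriesZr//; first by move=> k; case: (nf k).
  by case: nw.
Qed.

(** [M] is bounded on the Lebesgue space of exponent [p'] with weight [s], and
    [w ^ (1 - p') = s]. *)
Lemma Mdual_bounded a w s : Ap mu B a w s -> exists2 C : R, (0 < C)%R &
  forall h, nnm h -> \int[mu]_x (Mdual w h x `^ (1 - a)^-1 * (w x)%:E) <=
    C%:E * \int[mu]_x (h x `^ (1 - a)^-1 * (w x)%:E).
Proof.
move=> A; have [C C0 HC] := Ap_maximal BF (Ap_sym A).
have [/andP[a0 a1] gw gs ws _] := A; have b0 : (0 < 1 - a)%R by rewrite subr_gt0.
exists C => // h nh; have nw := nnm_weight gw; have niw := nnm_invw gw.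
have nhw : nnm (fun y => h y * (w y)%:E) by nnm.
have nM := sl_nnm sublinear_Mx nhw.
have lnE x : ln (s x) = (- a / (1 - a) * ln (w x))%R.
  by rewrite (Ap_ln_dual x (Ap_sym A)) subKr.
have e1 x : Mdual w h x `^ (1 - a)^-1 * (w x)%:E =
    M (fun y => h y * (w y)%:E) x `^ (1 - a)^-1 * (s x)%:E.
  have w0 := gw_gt0 gw x; have s0 := gw_gt0 gs x.
  rewrite /Mdual poweRM; [|by case: nM|by case: niw].
  rewrite -muleA; congr (_ * _); rewrite poweR_EFin -EFinM; congr EFin.
  rewrite powR_exp ?invr_gt0// lnV ?posrE// -[X in (_ * X)%R]exp_ln// -expRD.
  rewrite -[RHS]exp_ln// lnE; congr expR; field; by rewrite gt_eqF.
have e2 x : h x `^ (1 - a)^-1 * (w x)%:E =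
    (h x * (w x)%:E) `^ (1 - a)^-1 * (s x)%:E.
  have w0 := gw_gt0 gw x; have s0 := gw_gt0 gs x.
  rewrite poweRM; [|by case: nh|by case: nw].
  rewrite -muleA; congr (_ * _); rewrite poweR_EFin -EFinM; congr EFin.
  rewrite powR_exp// -[X in (_ * X)%R]exp_ln// -expRD.
  rewrite -[LHS]exp_ln// lnE; congr expR; field; by rewrite gt_eqF.
rewrite (eq_integral _ _ (fun x _ => e1 x)) (eq_integral _ _ (fun x _ => e2 x)).
exact: HC.
Qed.

Record A1w (k : R) (phi : X -> R) : Prop := A1Weight {
  a1_meas : measurable_fun setT phi;
  a1_gt0 : forall x, (0 < phi x)%R;
  a1_bound : {ae mu, forall x, M (fun y => (phi y)%:E) x <= (k * phi x)%:E} }.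

(** A function that is finite almost everywhere is changed on a null set only,
    which does not affect its means. *)
Lemma A1w_of_stable (k : R) (F : X -> \bar R) : nnm F -> (forall x, 0 < F x) ->
  {ae mu, forall x, F x < +oo} -> (forall x, M F x <= k%:E * F x) ->
  exists2 phi, A1w k phi & {ae mu, forall x, (phi x)%:E = F x}.
Proof.
move=> nF F0 Ffin HF.
pose Z := [set x | F x = +oo].
have mZ : measurable Z.
  rewrite (_ : Z = F @^-1` [set +oo]) //.
  by rewrite -[_ @^-1` _]setTI; apply: nF.1.
pose phi x := (fine (F x) + \1_Z x)%R.
have phiE x : F x < +oo -> (phi x)%:E = F x.
  move=> Fx; rewrite /phi indicE memNset ?addr0 ?fineK//.
    by rewrite ge0_fin_numE// ltW.
  by move=> Zx; move: Fx; rewrite Zx ltxx.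
have ae1 : {ae mu, forall x, (phi x)%:E = F x}.
  by apply: filterS Ffin => x; exact: phiE.
have mphi : measurable_fun setT phi.
  apply: measurable_funD; last exact: measurable_indic.
  by apply: measurableT_comp nF.1.
exists phi => //; split => //.
- move=> x; have [Fx|Fx] := eqVneq (F x) +oo.
    by rewrite /phi Fx/= add0r indicE mem_set.
  by rewrite -lte_fin phiE// lt_neqAle Fx leey.
- have avE n : av mu B w1 (fun y => (phi y)%:E) n = av mu B w1 F n.
    rewrite /av; congr (_ * _); under eq_integral do rewrite mule1.
    under [RHS]eq_integral do rewrite mule1.
    apply: ae_eq_integral; [exact: mB| | |].
    + by apply/measurable_EFinP; exact: measurable_funS mphi.
    + exact: measurable_funS nF.1.
    + by apply: filterS ae1 => x.
  have ME x : M (fun y => (phi y)%:E) x = M F x.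
    by congr ereal_sup; apply/seteqP; split => y [n _ <-]; exists n => //; rewrite avE.
  apply: filterS ae1 => x xE; rewrite ME EFinM xE; exact: HF.
Qed.

End dual_maximal.

(** * A distributional estimate for the pairs *)

Section extrapolation.
Context {d : measure_display} {X : measurableType d} {R : realType}.
Variable mu : {measure set X -> \bar R}.
Variables (B : nat -> set X) (r : nat -> R) (star : nat -> nat) (K : R).
Hypothesis BF : ball_family mu B r star K.
Local Notation mB := (bf_meas BF).
Local Notation M := (Mx mu B w1).
Local Notation good := (good_weight mu B).
Local Open Scope ereal_scope.

(** The hypothesis of the extrapolation theorem, for the weights that factor
    as [phi ^ (1 - p0) psi] with [phi] and [psi] in [A_1]. *)
Definition weighted_bound (k p0 D : R) (f g : X -> R) : Prop :=
  forall phi psi, A1w mu B k phi -> A1w mu B k psi ->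
  \int[mu]_x (g x `^ p0 * (phi x `^ (1 - p0) * psi x))%:E <=
  D%:E * \int[mu]_x (f x `^ p0 * (phi x `^ (1 - p0) * psi x))%:E.

Lemma measurable_powRc (f : X -> R) p : measurable_fun setT f ->
  measurable_fun setT (fun x => f x `^ p)%R.
Proof. exact: (measurableT_comp (measurable_powR p)). Qed.

(** The duality step of the argument: [Phi] and [Psi] stand for the outcomes of
    the two iterations, and Hoelder's inequality is replaced by the pointwise
    bound [g <= g ^ p0 phi ^ (1 - p0) + phi]. *)
Lemma weighted_bound_duality (k p0 D : R) (f g : X -> R) (Phi Psi : X -> \bar R) :
  (1 <= p0)%R -> (0 <= D)%R -> weighted_bound k p0 D f g ->
  measurable_fun setT f -> measurable_fun setT g ->
  (forall x, 0 <= f x)%R -> (forall x, 0 <= g x)%R ->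
  nnm Phi -> nnm Psi -> (forall x, 0 < Phi x) -> (forall x, 0 < Psi x) ->
  (forall x, M Phi x <= k%:E * Phi x) -> (forall x, M Psi x <= k%:E * Psi x) ->
  (forall x, (f x)%:E <= Phi x) ->
  \int[mu]_x ((g x)%:E * Psi x) <= (D + 1)%:E * \int[mu]_x (Phi x * Psi x).
Proof.
move=> p01 D0 H mf mg f0 g0 nP nQ P0 Q0 HP HQ fP.
set J := \int[mu]_x (Phi x * Psi x).
have J0 : 0 <= J by apply: int_ge0; nnm.
have D10 : (0 < D + 1)%R by rewrite ltr_wpDl.
have [->|Jy] := eqVneq J +oo; first by rewrite gt0_muley ?lte_fin// leey.
have {Jy}Jfin : J < +oo by rewrite lt_neqAle Jy leey.
have PQfin : {ae mu, forall x, Phi x * Psi x < +oo}.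
  have iPQ : mu.-integrable setT (fun x => Phi x * Psi x).
    apply/integrableP; split; first exact: (nnmM nP nQ).1.
    rewrite (eq_integral (fun x => Phi x * Psi x))// => x _.
    by rewrite gee0_abs//; case: (nnmM nP nQ).
  have := integrable_ae measurableT iPQ; apply: filterS => x /(_ Logic.I).
  by rewrite ge0_fin_numE//; case: (nnmM nP nQ).
have Pfin : {ae mu, forall x, Phi x < +oo}.
  apply: filterS PQfin => x; case: (Phi x) (P0 x) => [y||]//; rewrite ?ltry//.
  by rewrite gt0_mulye.
have Qfin : {ae mu, forall x, Psi x < +oo}.
  apply: filterS PQfin => x; case: (Psi x) (Q0 x) => [y||]//; rewrite ?ltry//.
  by rewrite gt0_muley.
have [phi A1P phiE] := A1w_of_stable BF nP P0 Pfin HP.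
have [psi A1Q psiE] := A1w_of_stable BF nQ Q0 Qfin HQ.
have nphi : nnm (fun x => (phi x)%:E : \bar R).
  by apply: nnm_EFin => [|x]; [exact: a1_meas A1P|rewrite ltW// (a1_gt0 A1P)].
have npsi : nnm (fun x => (psi x)%:E : \bar R).
  by apply: nnm_EFin => [|x]; [exact: a1_meas A1Q|rewrite ltW// (a1_gt0 A1Q)].
have nv (u : X -> R) : measurable_fun setT u -> (forall x, 0 <= u x)%R ->
    nnm (fun x => (u x `^ p0 * (phi x `^ (1 - p0) * psi x))%:E : \bar R).
  move=> mu0 u0; apply: nnm_EFin => [|x].
    apply: measurable_funM; first exact: measurable_powRc.
    apply: measurable_funM; last exact: a1_meas A1Q.
    exact: measurable_powRc (a1_meas A1P).
  by rewrite !mulr_ge0 ?powR_ge0// ltW// (a1_gt0 A1Q).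
have ng : nnm (fun x => (g x)%:E : \bar R) by exact: nnm_EFin.
have nf : nnm (fun x => (f x)%:E : \bar R) by exact: nnm_EFin.
have p0E : (1 - p0 = - (p0 - 1))%R by rewrite opprB.
have p010 : (0 <= p0 - 1)%R by rewrite subr_ge0.
apply: (@le_trans _ _ (\int[mu]_x ((g x `^ p0 * (phi x `^ (1 - p0) * psi x))%:E +
    Phi x * Psi x))).
  have nvg := nv _ mg g0.
  apply: int_ae_le; [by nnm|by nnm|].
  apply: filterS2 phiE psiE => x xP xQ; rewrite -xP -xQ -!EFinM -EFinD lee_fin.
  have ph0 := a1_gt0 A1P x; have ps0 := a1_gt0 A1Q x.
  rewrite mulrA -mulrDl ler_wpM2r// ?(ltW ps0)//.
  have [gp|/ltW pg] := leP (g x) (phi x).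
    by apply: ler_wpDl => //; rewrite mulr_ge0 ?powR_ge0.
  apply: ler_wpDr; first exact: ltW.
  have gx0 : (0 < g x)%R by exact: lt_le_trans pg.
  rewrite -(mulr_powRB1 (g0 x) (lt_le_trans ltr01 p01)) -mulrA ler_peMr//.
  rewrite p0E powRN ler_pdivlMr ?powR_gt0// mul1r.
  by apply: le_powR => //; exact: ltW.
rewrite intD; [|exact: nv|by nnm].
rewrite EFinD ge0_muleDl ?lee_fin// mul1e leeD2r//.
apply: le_trans (H _ _ A1P A1Q) _; rewrite lee_wpmul2l ?lee_fin//.
have nvf := nv _ mf f0.
apply: int_ae_le; [by []|by nnm|].
apply: filterS2 phiE psiE => x xP xQ; have := fP x; rewrite -xP -xQ lee_fin => fp.
have ph0 := a1_gt0 A1P x; have ps0 := a1_gt0 A1Q x.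
rewrite -EFinM lee_fin mulrA ler_wpM2r ?(ltW ps0)//.
have [fx0|fx0] := eqVneq (f x) 0%R.
  by rewrite fx0 powR0 ?mul0r ?(ltW ph0)// gt_eqF// (lt_le_trans ltr01).
rewrite p0E powRN ler_pdivrMr ?powR_gt0// mulr_powRB1 ?(ltW ph0)//; last first.
  exact: lt_le_trans ltr01 p01.
by apply: le_powR => //; rewrite (le_trans ler01).
Qed.

Variables (w s1 s2 : X -> R) (a1 a2 : R).
Hypotheses (Aw1 : Ap mu B a1 w s1) (Aw2 : Ap mu B a2 w s2).
Hypothesis wfin : \int[mu]_x (w x)%:E < +oo.

Let gw : good w := ap_w Aw1.
Let nw := nnm_weight gw.

Definition rdf_bounded2 (T : (X -> \bar R) -> X -> \bar R) (A q1 q2 : R) :=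
  [/\ sublinear T, (1 <= A)%R,
    (forall f, nnm f -> \int[mu]_x (rdf T A f x `^ q1 * (w x)%:E) <=
      (2 `^ q1 * 2)%:E * \int[mu]_x (f x `^ q1 * (w x)%:E)) &
    (forall f, nnm f -> \int[mu]_x (rdf T A f x `^ q2 * (w x)%:E) <=
      (2 `^ q2 * 2)%:E * \int[mu]_x (f x `^ q2 * (w x)%:E))].

Lemma rdf_bounded_exists : exists A : R,
  rdf_bounded2 M A a1^-1 a2^-1 /\
  rdf_bounded2 (Mdual mu B w) A (1 - a1)^-1 (1 - a2)^-1.
Proof.
have [C1 C10 H1] := Ap_maximal BF Aw1; have [C2 C20 H2] := Ap_maximal BF Aw2.
have [C3 C30 H3] := Mdual_bounded BF Aw1; have [C4 C40 H4] := Mdual_bounded BF Aw2.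
have /andP[a10 a11] := ap_a Aw1; have /andP[a20 a21] := ap_a Aw2.
pose A := (1 + C1 + C2 + C3 + C4)%R.
have q1 : (1 <= a1^-1)%R by rewrite invf_ge1// ltW.
have q2 : (1 <= a2^-1)%R by rewrite invf_ge1// ltW.
have q3 : (1 <= (1 - a1)^-1)%R.
  by rewrite invf_ge1 ?subr_gt0// lerBlDr lerDl ltW.
have q4 : (1 <= (1 - a2)^-1)%R.
  by rewrite invf_ge1 ?subr_gt0// lerBlDr lerDl ltW.
have mw := gw_meas gw; have w0 x : (0 <= w x)%R by rewrite ltW// (gw_gt0 gw).
have A1 : (1 <= A)%R by rewrite /A; lra.
exists A; split; split => //.
- exact: (sublinear_Mx BF).
- move=> f nf; apply: (rdf_bounded (sublinear_Mx BF) A1 mw w0 q1 _ H1 nf).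
  by rewrite /A; apply/andP; split; lra.
- move=> f nf; apply: (rdf_bounded (sublinear_Mx BF) A1 mw w0 q2 _ H2 nf).
  by rewrite /A; apply/andP; split; lra.
- exact: (sublinear_Mdual BF).
- move=> f nf; apply: (rdf_bounded (sublinear_Mdual BF gw) A1 mw w0 q3 _ H3 nf).
  by rewrite /A; apply/andP; split; lra.
- move=> f nf; apply: (rdf_bounded (sublinear_Mdual BF gw) A1 mw w0 q4 _ H4 nf).
  by rewrite /A; apply/andP; split; lra.
Qed.

Lemma absorb_quarter (x y z : R) :
  (x <= y + z + 1 / 4 * x -> z <= x / 4 -> x <= 2 * y)%R.
Proof. by lra. Qed.

Lemma opaque_value (x : \bar R) : exists y, x = y /\ True.
Proof. by exists x. Qed.

Lemma poweR_inde (E : set X) (x : X) (y : \bar R) q : (0 < q)%R -> 0 <= y ->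
  (inde E x * y) `^ q = inde E x * y `^ q.
Proof.
move=> q0 y0; have [Ex|Ex] := pselect (E x); first by rewrite inde_in// !mul1e.
by rewrite inde_out// !mul0e poweR0r// gt_eqF.
Qed.

Lemma int_poweR_shift (F : X -> \bar R) (q c : R) : (1 <= q)%R -> (0 <= c)%R ->
  nnm F -> \int[mu]_x ((F x + c%:E) `^ q * (w x)%:E) <=
    (2 `^ q)%:E * (\int[mu]_x (F x `^ q * (w x)%:E) +
       (c `^ q)%:E * \int[mu]_x (w x)%:E).
Proof.
move=> q1 c0 nF; have q0 : (0 < q)%R by exact: lt_le_trans q1.
rewrite -intZ ?lee_fin ?powR_ge0// -intD; [|by nnm|by nnm].
rewrite -intZ ?lee_fin ?powR_ge0//; last by nnm.
apply: int_le; [by nnm|by nnm|].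
move=> x; have w0 : 0 <= (w x)%:E by case: nw.
have F0 : 0 <= F x by case: nF.
rewrite -ge0_muleDl ?poweR_ge0 ?lee_fin ?powR_ge0// muleA lee_wpmul2r//.
by rewrite -poweR_EFin; apply: poweRD_le; rewrite ?lee_fin.
Qed.

Lemma young_integral (F G : X -> \bar R) (T a : R) : nnm F -> nnm G ->
  (0 < T)%R -> (0 < a < 1)%R ->
  \int[mu]_x (F x * (G x * (w x)%:E)) <=
  (T `^ (1 - a^-1))%:E * \int[mu]_x (F x `^ a^-1 * (w x)%:E) +
  T%:E * \int[mu]_x (G x `^ (1 - a)^-1 * (w x)%:E).
Proof.
move=> nF nG T0 a01; have T0' : 0 <= T%:E by rewrite lee_fin ltW.
rewrite -intZ ?lee_fin ?powR_ge0//; last by nnm.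
rewrite -intZ//; last by nnm.
rewrite -intD; [|by nnm|by nnm].
apply: int_le; [by nnm|by nnm|].
move=> x; have w0 : 0 <= (w x)%:E by case: nw.
have F0 : 0 <= F x by case: nF.
have G0 : 0 <= G x by case: nG.
rewrite [X in _ <= X + _]muleA [X in _ <= _ + X]muleA -ge0_muleDl; last 2 first.
- by rewrite mule_ge0 ?poweR_ge0// lee_fin powR_ge0.
- by rewrite mule_ge0 ?poweR_ge0.
by rewrite muleA lee_wpmul2r//; exact: eyoung_scaled.
Qed.

(** The distribution function of [g] is controlled by the two truncations of
    [f], as if [g] were the image of [f] under an operator of weak types
    [(1 / a1, 1 / a1)] and [(1 / a2, 1 / a2)]. The Rubio de Francia iterations
    are started at the truncations and at the level set of [g]; small positive
    constants are added to make them positive. *)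
Lemma distribution_bound (A p0 D : R) :
  rdf_bounded2 M A a1^-1 a2^-1 ->
  rdf_bounded2 (Mdual mu B w) A (1 - a1)^-1 (1 - a2)^-1 ->
  (1 <= p0)%R -> (0 <= D)%R -> exists2 C : R, (0 < C)%R & forall f g : X -> R,
  weighted_bound (4 * A) p0 D f g ->
  measurable_fun setT f -> measurable_fun setT g ->
  (forall x, 0 <= f x)%R -> (forall x, 0 <= g x)%R ->
  forall t : R, (0 < t)%R ->
  \int[mu]_(x in [set x | (t < g x)%R]) (w x)%:E <=
  C%:E * ((t `^ (- a1^-1))%:E * \int[mu]_(x in [set x | (t < f x)%R])
            (f x `^ a1^-1 * w x)%:E +
          (t `^ (- a2^-1))%:E * \int[mu]_(x in [set x | (f x <= t)%R])
            (f x `^ a2^-1 * w x)%:E).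
Proof.
move=> hM hN p01 D0; have [sM A1 _ _] := hM; have [sN _ _ _] := hN.
have /andP[a10 a11] := ap_a Aw1; have /andP[a20 a21] := ap_a Aw2.
set q1 := (a1^-1)%R in hM *; set q2 := (a2^-1)%R in hM *.
set r1 := ((1 - a1)^-1)%R in hN; set r2 := ((1 - a2)^-1)%R in hN.
have q11 : (1 <= q1)%R by rewrite /q1 invf_ge1// ltW.
have q21 : (1 <= q2)%R by rewrite /q2 invf_ge1// ltW.
have r11 : (1 <= r1)%R by rewrite /r1 invf_ge1 ?subr_gt0// lerBlDr lerDl ltW.
have r21 : (1 <= r2)%R by rewrite /r2 invf_ge1 ?subr_gt0// lerBlDr lerDl ltW.
have q10 : (0 < q1)%R by exact: lt_le_trans q11.
have q20 : (0 < q2)%R by exact: lt_le_trans q21.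
pose e1 := (2 `^ q1 * 2 : R)%R; pose e2 := (2 `^ q2 * 2 * 2 `^ q2 : R)%R.
pose e3 := (2 `^ r1 * 2 * (2 `^ r1 * 2) : R)%R.
pose e4 := (2 `^ r2 * 2 * (2 `^ r2 * 2) : R)%R.
have two0 : (0 < 2 :> R)%R by [].
have e10 : (0 < e1)%R by rewrite !mulr_gt0// powR_gt0.
have e20 : (0 < e2)%R by rewrite !mulr_gt0// powR_gt0.
have e30 : (0 < e3)%R by rewrite !mulr_gt0// powR_gt0.
have e40 : (0 < e4)%R by rewrite !mulr_gt0// powR_gt0.
have [e1E e2E e3E e4E] : [/\ e1 = (2 `^ q1 * 2)%R, e2 = (2 `^ q2 * 2 * 2 `^ q2)%R,
  e3 = (2 `^ r1 * 2 * (2 `^ r1 * 2))%R & e4 = (2 `^ r2 * 2 * (2 `^ r2 * 2))%R] by [].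
clearbody e1 e2 e3 e4.
have D10 : (0 < D + 1)%R by rewrite ltr_wpDl.
(* The level mass [W] of [g] also occurs on the right-hand side below; this value
   makes its coefficient a quarter of that on the left, so that it can be
   absorbed. *)
pose dl := ((4 * (D + 1) * (e3 + e4))^-1)%R.
have dl0 : (0 < dl)%R by rewrite invr_gt0 !mulr_gt0// addr_gt0.
have dlE : ((D + 1) * dl * (e3 + e4) = 1 / 4)%R.
  rewrite /dl; field; rewrite !gt_eqF//; exact: addr_gt0.
clearbody dl.
pose k1 := (2 * (D + 1) * (dl `^ (1 - q1) * e1))%R.
pose k2 := (2 * (D + 1) * (dl `^ (1 - q2) * e2))%R.
have k10 : (0 < k1)%R by rewrite !mulr_gt0// powR_gt0.
have k20 : (0 < k2)%R by rewrite !mulr_gt0// powR_gt0.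
have [k1E k2E] : k1 = (2 * (D + 1) * (dl `^ (1 - q1) * e1))%R /\
  k2 = (2 * (D + 1) * (dl `^ (1 - q2) * e2))%R by [].
clearbody k1 k2.
exists (k1 + k2)%R; first by rewrite addr_gt0.
move=> f g H mf mg f0 g0 t t0.
set E := [set x | (t < g x)%R]; set U := [set x | (t < f x)%R].
set V := [set x | (f x <= t)%R].
have mE : measurable E.
  rewrite (_ : E = [set x | t%:E < (g x)%:E]); last first.
    by apply/seteqP; split => x /=; rewrite lte_fin.
  exact: nnm_gt (nnm_EFin mg g0).
have mU : measurable U.
  rewrite (_ : U = [set x | t%:E < (f x)%:E]); last first.
    by apply/seteqP; split => x /=; rewrite lte_fin.
  exact: nnm_gt (nnm_EFin mf f0).
have VU : V = ~` U.
  by apply/seteqP; split => x; rewrite /V /U /= leNgt => /negP.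
have mV : measurable V by rewrite VU; exact: measurableC.
have nf : nnm (fun x => (f x)%:E : \bar R) by exact: nnm_EFin.
have ng : nnm (fun x => (g x)%:E : \bar R) by exact: nnm_EFin.
have := int_in_ge0 mu E nw; have := int_subset mu nw mE measurableT (@subsetT _ E).
have : \int[mu]_x (w x)%:E < +oo by exact: wfin.
have [WE WEd] := opaque_value (\int[mu]_(x in E) (w x)%:E).
have [Wt Wtd] := opaque_value (\int[mu]_x (w x)%:E).
rewrite WEd.1 Wtd.1 => Wty WEt WE0.
pose f1 x := inde U x * (f x)%:E; pose f2' x := inde V x * (f x)%:E.
have nf1 : nnm f1 by rewrite /f1; nnm.
have nf2' : nnm f2' by rewrite /f2'; nnm.
have -> : \int[mu]_(x in U) (f x `^ q1 * w x)%:E =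
    \int[mu]_x (f1 x `^ q1 * (w x)%:E).
  rewrite [LHS]int_inde; apply: eq_integral => x _.
  by rewrite /f1 poweR_inde ?lee_fin// -muleA poweR_EFin EFinM.
have -> : \int[mu]_(x in V) (f x `^ q2 * w x)%:E =
    \int[mu]_x (f2' x `^ q2 * (w x)%:E).
  rewrite [LHS]int_inde; apply: eq_integral => x _.
  by rewrite /f2' poweR_inde ?lee_fin// -muleA poweR_EFin EFinM.
have I10 : 0 <= \int[mu]_x (f1 x `^ q1 * (w x)%:E) by apply: int_ge0; nnm.
have I20 : 0 <= \int[mu]_x (f2' x `^ q2 * (w x)%:E) by apply: int_ge0; nnm.
have [I1 I1d] := opaque_value (\int[mu]_x (f1 x `^ q1 * (w x)%:E)).
have [I2 I2d] := opaque_value (\int[mu]_x (f2' x `^ q2 * (w x)%:E)).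
rewrite I1d.1 in I10 *; rewrite I2d.1 in I20 *.
have tq (q : R) : (0 < t `^ (- q))%R by rewrite powR_gt0.
have k120 : (0 < k1 + k2)%R by rewrite addr_gt0.
have nonneg (q : R) (I : \bar R) : 0 <= I -> 0 <= (t `^ (- q))%:E * I.
  by move=> I0'; apply: mule_ge0 => //; rewrite lee_fin; exact: ltW (tq q).
have [WE00|WEgt0] := leP WE 0.
  apply: (le_trans WE00); apply: mule_ge0; first by rewrite lee_fin; exact: ltW k120.
  exact: (adde_ge0 (nonneg q1 _ I10) (nonneg q2 _ I20)).
have [I1y|] := ltP I1 +oo; last first.
  rewrite leye_eq => /eqP ->; rewrite gt0_muley ?lte_fin// addye; last first.
    by have := nonneg q2 _ I20; case: (_ * _).
  by rewrite gt0_muley ?leey// lte_fin.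
have [I2y|] := ltP I2 +oo; last first.
  rewrite leye_eq => /eqP ->; rewrite [X in _ <= _ * (_ + X)]gt0_muley ?lte_fin//.
  rewrite addey; last by have := nonneg q1 _ I10; case: (_ * _).
  by rewrite gt0_muley ?leey// lte_fin.
have I1fin : I1 \is a fin_num by rewrite ge0_fin_numE.
have I2fin : I2 \is a fin_num by rewrite ge0_fin_numE.
have WEy : WE < +oo by exact: le_lt_trans WEt Wty.
have WEfin : WE \is a fin_num by rewrite ge0_fin_numE.
have Wt0' : 0 <= Wt by exact: le_trans WE0 WEt.
have Wtfin : Wt \is a fin_num by rewrite ge0_fin_numE.
have W0 : (0 < fine WE)%R by rewrite -lte_fin fineK.
set W := fine WE in W0.
have WWt : (W <= fine Wt)%R by exact: fine_le.
have Wt0 : (0 < fine Wt)%R by exact: lt_le_trans WWt.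
(* The constant [eta] then has the same integral against [w] as the indicator of
   [E]. *)
pose eta := (W / fine Wt)%R.
have eta0 : (0 < eta)%R by rewrite divr_gt0.
have eta1 : (eta <= 1)%R by rewrite ler_pdivrMr// mul1r.
(* The shift [z * t] added to [f] contributes [coef * z ^ q2], which is to be at
   most a quarter of [t * W]. *)
pose coef := ((D + 1) * ((dl * t) `^ (1 - q2) * e2 * t `^ q2) * fine Wt)%R.
have dt0 : (0 < dl * t)%R by rewrite mulr_gt0.
have coef0 : (0 < coef)%R by rewrite !mulr_gt0// powR_gt0.
pose z := Num.min 1%R (t * W / (4 * coef))%R.
have z0 : (0 < z)%R by rewrite lt_min ltr01 divr_gt0// mulr_gt0.
have z1 : (z <= 1)%R by rewrite ge_min lexx.
have coefE : coef = ((D + 1) * ((dl * t) `^ (1 - q2) * e2 * t `^ q2) * fine Wt)%R.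
  by [].
clearbody coef.
have zc : (coef * z `^ q2 <= t * W / 4)%R.
  apply: (@le_trans _ _ (coef * z)%R).
    by rewrite ler_wpM2l ?(ltW coef0)// ge1r_powR// z0.
  have : (z <= t * W / (4 * coef))%R by rewrite ge_min lexx orbT.
  move=> /(ler_wpM2l (ltW coef0)) /le_trans; apply.
  by rewrite le_eqVlt; apply/orP; left; apply/eqP; field; rewrite gt_eqF.
clearbody z.
have etaE : (eta * fine Wt = W)%R by rewrite /eta divfK// gt_eqF.
clearbody eta.
pose h x := inde E x + eta%:E.
have nh : nnm h by rewrite /h; nnm; exact: ltW.
pose f2 x := f2' x + (z * t)%:E.
have zt0 : (0 < z * t)%R by rewrite mulr_gt0.
have nf2 : nnm f2 by rewrite /f2; nnm; exact: ltW.
have nF : nnm (fun x => f1 x + f2 x) by nnm.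
pose Phi := rdf M A (fun x => f1 x + f2 x).
pose H2 := rdf (Mdual mu B w) A h.
pose Psi x := H2 x * (w x)%:E.
have nPhi : nnm Phi by exact: (nnm_rdf sM A1).
have nH2 : nnm H2 by exact: (nnm_rdf sN A1).
have nPsi : nnm Psi by rewrite /Psi; nnm.
have Phi_ge x : f1 x + f2 x <= Phi x by exact: (rdf_ge sM A1).
have H2_ge x : h x <= H2 x by exact: (rdf_ge sN A1).
have w0 x : (0 < w x)%R by exact: gw_gt0 gw x.
have Phi0 x : 0 < Phi x.
  apply: lt_le_trans (Phi_ge x); apply: (@lt_le_trans _ _ (z * t)%:E) => //.
  rewrite /f2 addeA leeDr// adde_ge0//; [by case: nf1|by case: nf2'].
have H20 x : 0 < H2 x.
  apply: lt_le_trans (H2_ge x); apply: (@lt_le_trans _ _ eta%:E) => //.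
  by rewrite /h leeDr// inde_ge0.
have Psi0 x : 0 < Psi x by rewrite mule_gt0// lte_fin.
have fPhi x : (f x)%:E <= Phi x.
  apply: le_trans (Phi_ge x); rewrite /f2 /f1 /f2'.
  have [Ux|Ux] := pselect (U x).
    rewrite (inde_in Ux) mul1e leeDl// adde_ge0 ?lee_fin ?(ltW zt0)//.
    exact: (nf2'.2 x).
  have Vx : V x by rewrite VU.
  rewrite (inde_out Ux) mul0e add0e (inde_in Vx) mul1e leeDl// lee_fin.
  exact: ltW zt0.
have MPhi x : M Phi x <= (4 * A)%:E * Phi x by exact: (rdf_stable sM A1).
have MPsi x : M Psi x <= (4 * A)%:E * Psi x.
  have := rdf_stable sN A1 x nh; rewrite -/H2 /Mdual.
  rewrite lee_pdivrMr//; by rewrite /Psi muleA.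
have main := weighted_bound_duality p01 D0 H mf mg f0 g0 nPhi nPsi Phi0 Psi0
  MPhi MPsi fPhi.
have lower : t%:E * WE <= \int[mu]_x ((g x)%:E * Psi x).
  rewrite -WEd.1 [X in _ * X]int_inde -intZ ?lee_fin ?(ltW t0)//; last by nnm.
  apply: int_le; [by nnm; exact: ltW|by nnm|].
  move=> x; have [Ex|Ex] := pselect (E x); last first.
    by rewrite inde_out// mul0e mule0 mule_ge0 ?lee_fin// ltW.
  rewrite inde_in// mul1e; apply: lee_pmul; rewrite ?lee_fin ?(ltW t0) ?(ltW (w0 x))//.
    exact: ltW.
  rewrite /Psi -[leLHS]mul1e lee_wpmul2r ?lee_fin ?(ltW (w0 x))//.
  apply: le_trans (H2_ge x); rewrite /h inde_in// leeDl// lee_fin; exact: ltW.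
have hr (q : R) : (1 <= q)%R ->
    \int[mu]_x (h x `^ q * (w x)%:E) <= (2 `^ q * 2 * W)%:E.
  move=> q1'; have nE : nnm (inde E : X -> \bar R) by nnm.
  apply: le_trans (int_poweR_shift q1' (ltW eta0) nE) _.
  rewrite -mulrA EFinM lee_wpmul2l ?lee_fin ?powR_ge0//.
  have -> : \int[mu]_x (inde E x `^ q * (w x)%:E) = WE.
    rewrite -WEd.1 [RHS]int_inde; apply: eq_integral => x _; congr (_ * _).
    rewrite -[inde E x]mule1 poweR_inde ?lee01 ?(lt_le_trans ltr01)//.
    by rewrite poweR1r.
  rewrite Wtd.1 -(fineK WEfin) -(fineK Wtfin) -EFinM -EFinD lee_fin -/W.
  have h1 : (eta `^ q * fine Wt <= W)%R.
    rewrite -[leRHS]etaE ler_wpM2r ?(ltW Wt0)//.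
    by apply: ge1r_powR => //; rewrite eta0.
  by rewrite mulr_natl mulr2n lerD2l.
have J1 : \int[mu]_x (Phi x * Psi x) <=
    \int[mu]_x (rdf M A f1 x * Psi x) + \int[mu]_x (rdf M A f2 x * Psi x).
  have n1 := nnm_rdf sM A1 nf1; have n2 := nnm_rdf sM A1 nf2.
  rewrite -intD; [|by nnm|by nnm]; apply: int_le; [by nnm|by nnm|].
  move=> x; rewrite -ge0_muleDl; last 2 first.
  - by case: n1.
  - by case: n2.
  rewrite lee_wpmul2r//; first by case: nPsi.
  exact: (rdfD sM A1).
have b1 : \int[mu]_x (rdf M A f1 x * Psi x) <=
    ((dl * t) `^ (1 - q1) * (e1 * fine I1) + dl * t * (e3 * W))%:E.
  have n1 := nnm_rdf sM A1 nf1; have [_ _ bM1 _] := hM; have [_ _ bN1 _] := hN.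
  apply: le_trans (young_integral n1 nH2 dt0 (ap_a Aw1)) _.
  rewrite EFinD; apply: leeD.
    rewrite EFinM lee_wpmul2l ?lee_fin ?powR_ge0//.
    by apply: le_trans (bM1 _ nf1) _; rewrite I1d.1 e1E [in leRHS]EFinM fineK.
  rewrite [in leRHS]EFinM lee_wpmul2l ?lee_fin ?(ltW dt0)//.
  apply: le_trans (bN1 _ nh) _; rewrite e3E -mulrA [in leRHS]EFinM.
    apply: lee_wpmul2l; first by rewrite lee_fin mulr_ge0 ?powR_ge0.
  exact: hr.
have b2 : \int[mu]_x (rdf M A f2 x * Psi x) <=
    ((dl * t) `^ (1 - q2) * (e2 * (fine I2 + (z * t) `^ q2 * fine Wt)) +
     dl * t * (e4 * W))%:E.
  have n2 := nnm_rdf sM A1 nf2; have [_ _ _ bM2] := hM; have [_ _ _ bN2] := hN.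
  apply: le_trans (young_integral n2 nH2 dt0 (ap_a Aw2)) _.
  rewrite EFinD; apply: leeD.
    rewrite EFinM lee_wpmul2l ?lee_fin ?powR_ge0//.
    apply: le_trans (bM2 _ nf2) _; rewrite e2E -mulrA [in leRHS]EFinM.
    apply: lee_wpmul2l; first by rewrite lee_fin mulr_ge0 ?powR_ge0.
    apply: le_trans (int_poweR_shift q21 (ltW zt0) nf2') _.
    by rewrite I2d.1 Wtd.1 -(fineK I2fin) -(fineK Wtfin).
  rewrite [in leRHS]EFinM lee_wpmul2l ?lee_fin ?(ltW dt0)//.
  apply: le_trans (bN2 _ nh) _; rewrite e4E -mulrA [in leRHS]EFinM.
    apply: lee_wpmul2l; first by rewrite lee_fin mulr_ge0 ?powR_ge0.
  exact: hr.
have X1 : (t * W <= (D + 1) *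
    (((dl * t) `^ (1 - q1) * (e1 * fine I1) + dl * t * (e3 * W)) +
     ((dl * t) `^ (1 - q2) * (e2 * (fine I2 + (z * t) `^ q2 * fine Wt)) +
      dl * t * (e4 * W))))%R.
  rewrite -lee_fin [in leLHS]EFinM (fineK WEfin); apply: (le_trans lower).
  apply: (le_trans main); rewrite [in leRHS]EFinM.
  apply: lee_wpmul2l; first by rewrite lee_fin; exact: ltW D10.
  by apply: (le_trans J1); rewrite [in leRHS]EFinD; exact: leeD b1 b2.
rewrite -(fineK WEfin) -(fineK I1fin) -(fineK I2fin) -/W.
have i10 : (0 <= fine I1)%R by exact: fine_ge0.
have i20 : (0 <= fine I2)%R by exact: fine_ge0.
move: X1 i10 i20 Wt0; set i1 := fine I1; set i2 := fine I2; set wt := fine Wt.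
move=> X1 i10 i20 wt0.
suff : (W <= (k1 + k2) * (t `^ (- q1) * i1 + t `^ (- q2) * i2))%R.
  by rewrite -lee_fin.
have zE : ((z * t) `^ q2 = z `^ q2 * t `^ q2)%R by rewrite powRM ?(ltW z0) ?(ltW t0).
have dE (q : R) : ((dl * t) `^ (1 - q) = dl `^ (1 - q) * (t * t `^ (- q)))%R.
  rewrite powRM ?(ltW dl0) ?(ltW t0)//; congr (_ * _)%R.
  by rewrite powRD ?powRr1 ?(ltW t0)// (gt_eqF t0) implybT.
have X2 : (t * W <= (D + 1) * ((dl * t) `^ (1 - q1) * e1 * i1 +
    (dl * t) `^ (1 - q2) * e2 * i2) + coef * z `^ q2 +
    ((D + 1) * dl * (e3 + e4)) * (t * W))%R.
  apply: (le_trans X1); rewrite zE coefE -/wt le_eqVlt; apply/orP; left.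
  by apply/eqP; ring.
rewrite dlE in X2.
have X3 : (t * W <= 2 * (D + 1) * ((dl * t) `^ (1 - q1) * e1 * i1 +
    (dl * t) `^ (1 - q2) * e2 * i2))%R.
  move: X2 zc; set Y := ((D + 1) * _)%R; set Z := (coef * _)%R => X2 zc.
  have -> : (2 * (D + 1) * ((dl * t) `^ (1 - q1) * e1 * i1 +
    (dl * t) `^ (1 - q2) * e2 * i2) = 2 * Y)%R by rewrite /Y; ring.
  exact: absorb_quarter X2 zc.
have X4 : (W <= k1 * (t `^ (- q1) * i1) + k2 * (t `^ (- q2) * i2))%R.
  rewrite -(ler_pM2l t0); apply: (le_trans X3); rewrite !dE k1E k2E.
  by rewrite le_eqVlt; apply/orP; left; apply/eqP; ring.
apply: (le_trans X4).
have y1 : (0 <= t `^ (- q1) * i1)%R by rewrite mulr_ge0 ?powR_ge0.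
have y2 : (0 <= t `^ (- q2) * i2)%R by rewrite mulr_ge0 ?powR_ge0.
move: (t `^ (- q1) * i1)%R (t `^ (- q2) * i2)%R y1 y2 => u v u0 v0.
have h1 : (0 <= k2 * u)%R by rewrite mulr_ge0// ltW.
have h2 : (0 <= k1 * v)%R by rewrite mulr_ge0// ltW.
by rewrite mulrDl !mulrDr lerD ?lerDl ?lerDr.
Qed.

End extrapolation.

(** * Dilations of Lebesgue measure *)

Section scaling.
Context {R : realType}.
Local Notation leb := (@lebesgue_measure R).
Local Open Scope ereal_scope.

Variables (c : R) (c0 : (0 < c)%R).
Let sc : measurableTypeR R -> measurableTypeR R := fun x => (c * x)%R.
Let msc : measurable_fun setT sc.
Proof. exact: measurable_funM. Qed.

(** By uniqueness of Lebesgue measure it suffices to compare the measures of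
    intervals. *)
Lemma lebesgue_measureZ (A : set R) : measurable A ->
  leb A = c%:E * pushforward leb sc A.
Proof.
move=> mA.
pose k : {nonneg R} := NngNum (ltW c0).
pose m : {measure set (measurableTypeR R) -> \bar R} :=
  mscale k (@pushforward _ _ _ _ _ leb sc).
rewrite -[RHS]/(m msc A).
apply: (@lebesgue_measure_unique R (m msc)) => //= _ [[a b]] _ <-.
rewrite /m /mscale/= /pushforward.
have -> : sc @^-1` `]a, b] = `](a / c)%R, (b / c)%R]%classic.
  apply/seteqP; split => x /=; rewrite !in_itv/= /sc ltr_pdivrMr// ler_pdivlMr//;
  by rewrite ![(x * c)%R]mulrC.
rewrite !lebesgue_measure_itv/= !lte_fin ltr_pM2r ?invr_gt0//.
case: ifP => _; last by rewrite mule0.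
by rewrite -!EFinB -EFinM -mulrBl mulrC divfK// gt_eqF.
Qed.

Lemma int_scale (h : measurableTypeR R -> \bar R) : nnm h ->
  \int[leb]_(t in `]0%R, +oo[) h (c * t)%R =
  (c^-1)%:E * \int[leb]_(t in `]0%R, +oo[) h t.
Proof.
move=> [mh h0].
have pre : sc @^-1` `]0%R, +oo[%classic = `]0%R, +oo[%classic.
  by apply/seteqP; split => x /=; rewrite !in_itv/= !andbT /sc pmulr_rgt0.
pose k : {nonneg R} := NngNum (ltW c0).
pose pm : {measure set (measurableTypeR R) -> \bar R} :=
  @pushforward _ _ _ _ _ leb sc.
pose m : {measure set (measurableTypeR R) -> \bar R} := mscale k (pm msc).
have -> : \int[leb]_(t in `]0%R, +oo[) h t = \int[m]_(t in `]0%R, +oo[) h t.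
  by apply: eq_measure_integral => A mA _; exact: lebesgue_measureZ.
rewrite (@ge0_integral_mscale _ _ _ (pm msc) _ _ k)//; last first.
  exact: measurable_funS mh.
rewrite (@ge0_integral_pushforward _ _ _ _ R sc msc leb)//; last first.
  exact: measurable_funS mh.
by rewrite pre muleA -EFinM mulVf ?mul1e// gt_eqF.
Qed.

End scaling.

(** * Interpolation of distribution functions *)

Section lorentz_interpolation.
Context {R : realType}.
Local Notation leb := (@lebesgue_measure R).
Local Notation TR := (measurableTypeR R).
Local Open Scope ereal_scope.
Let D : set TR := `]0%R, +oo[%classic.

Let mD : measurable D. Proof. exact: measurable_itv. Qed.

(** The integral in the [s]-th power of a Lorentz norm, for the distribution
    function [F]. *)
Definition dist_int (al s : R) (F : R -> R) : \bar R :=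
  \int[leb]_(t in `]0%R, +oo[) ((F t)%:E `^ al * (t `^ (s - 1))%:E).

Record distribution (F : R -> R) : Prop := Distribution {
  dst_ge0 : forall t, (0 <= F t)%R;
  dst_mono : {homo F : x y / (x <= y)%R >-> (y <= x)%R} }.

Lemma distribution_measurable F : distribution F ->
  measurable_fun setT (F : TR -> R).
Proof. by case=> _ mF; apply: nonincreasing_measurable. Qed.

Lemma distribution_scale F c : (0 < c)%R -> distribution F ->
  distribution (fun t => F (c * t)%R).
Proof.
move=> c0 [F0 Fm]; split => // x y xy; apply: Fm.
by rewrite ler_pM2l.
Qed.

Lemma nnm_dist al s F : distribution F ->
  nnm (fun t : TR => (F t)%:E `^ al * (t `^ (s - 1))%:E).
Proof.
move=> dF; apply: nnmM.
  by apply: nnmX; apply: nnm_EFin; [exact: distribution_measurable|exact: dst_ge0].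
by apply: nnm_EFin => [|t]; [exact: measurable_powR|exact: powR_ge0].
Qed.

Lemma dist_int_scale (al s c : R) F : (0 < c)%R -> distribution F ->
  dist_int al s (fun t => F (c * t)%R) = (c `^ (- s))%:E * dist_int al s F.
Proof.
move=> c0 dF; have nF := nnm_dist al s dF.
have := int_scale c0 nF.
have -> : \int[leb]_(t in `]0%R, +oo[) ((F (c * t))%:E `^ al * ((c * t) `^ (s - 1))%:E) =
    (c `^ (s - 1))%:E * dist_int al s (fun t => F (c * t)%R).
  rewrite -int_inZ//; last exact: nnm_dist (distribution_scale c0 dF).
  - apply: eq_integral => t; rewrite inE/= in_itv/= andbT => t0.
    by rewrite powRM ?(ltW c0) ?(ltW t0)// EFinM muleCA.
  - by rewrite lee_fin powR_ge0.
have cs0 : (0 < c `^ (s - 1))%R by rewrite powR_gt0.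
rewrite -/(dist_int al s F).
move: (dist_int al s F) (dist_int al s (fun t => F (c * t)%R)) => x y E.
have {E} : (c `^ (1 - s))%:E * ((c `^ (s - 1))%:E * y) =
    (c `^ (1 - s))%:E * ((c^-1)%:E * x) by rewrite E.
have cD (a b : R) : (c `^ a * c `^ b = c `^ (a + b))%R.
  by rewrite powRD// (gt_eqF c0) implybT.
rewrite !muleA -!EFinM cD -[X in (_ * X)%:E]powR_inv1 ?(ltW c0)// cD.
have -> : (1 - s + (s - 1) = 0)%R by ring.
have -> : (1 - s + - 1 = - s)%R by ring.
by rewrite powRr0 mul1e.
Qed.

Variables (q1 q2 de p s C : R).
Hypotheses (q10 : (0 < q1)%R) (q20 : (0 < q2)%R) (de0 : (0 < de)%R)
  (p1 : (1 <= p)%R) (s1 : (1 <= s)%R) (C0 : (0 < C)%R).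

(** The constant does not involve the exponent [q] of
    [lorentz_interpolation]: the grand norm is a supremum over exponents. *)
Definition lorentz_const : R := ((C + 1) `^ s * 2 `^ s *
  ((1 - 2 `^ (- de))^-1 `^ s * (2 `^ q1 `^ s + 2 `^ s) * (1 - 2 `^ (- (de / p)))^-1))%R.

Let rho := ((2:R) `^ (- de))%R.
Let th := ((2:R) `^ (- (de / p)))%R.

Let pow2_lt1 (x : R) : (0 < x)%R -> (0 < (2:R) `^ (- x) < 1)%R.
Proof.
move=> x0; rewrite powR_gt0//= powRN invf_lt1 ?powR_gt0//.
have : (1 `^ x < (2:R) `^ x)%R by apply: gt0_ltr_powR; rewrite ?nnegrE ?ltr1n.
by rewrite powR1.
Qed.

Let rho01 : (0 < rho < 1)%R. Proof. exact: pow2_lt1. Qed.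
Let th01 : (0 < th < 1)%R.
Proof. by apply: pow2_lt1; rewrite divr_gt0// (lt_le_trans _ p1). Qed.

Lemma lorentz_const_gt0 : (0 < lorentz_const)%R.
Proof.
have /andP[_ r1] := rho01; have /andP[_ t1] := th01.
rewrite /lorentz_const !mulr_gt0 ?addr_gt0 ?powR_gt0 ?invr_gt0 ?subr_gt0//.
by rewrite addr_gt0.
Qed.

Let pD (x y : R) : (2 `^ x * 2 `^ y = (2:R) `^ (x + y))%R.
Proof. by rewrite powRD// pnatr_eq0 implybT. Qed.

Let pX (x : R) (j : nat) : (((2:R) `^ x) ^+ j = 2 `^ (x * j%:R))%R.
Proof. by rewrite powRrM powR_mulrn// powR_ge0. Qed.

(** One of the two halves of the interpolation argument: the weights [be ^ j]
    of the dilates [F (c j * t)] are beaten by the dilation factors. *)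
Lemma half_interpolation (al be K : R) (c : nat -> R) (F : R -> R) :
  (0 < al)%R -> (al <= s)%R -> distribution F ->
  (forall j, (0 < c j)%R) -> (0 <= K)%R ->
  (forall j, ((rho^-1 ^+ j * be ^+ j) `^ al * c j `^ (- s) <= K * th ^+ j)%R) ->
  (0 <= be)%R ->
  \int[leb]_(t in D) ((\sum_(j <oo) ((be ^+ j)%:E * (F (c j * t))%:E)) `^ al *
    (t `^ (s - 1))%:E) <=
  ((1 - rho)^-1 `^ s * K * (1 - th)^-1)%:E * dist_int al s F.
Proof.
move=> al0 als dF c0 K0 H be0.
have /andP[r0 r1] := rho01; have /andP[t0 t1] := th01.
have nFc j : nnm (fun t : TR => (F (c j * t)%R)%:E : \bar R).
  by apply: nnm_EFin; [exact: distribution_measurable (distribution_scale (c0 j) dF)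
    |move=> t; exact: (dst_ge0 dF)].
have nts : nnm (fun t : TR => (t `^ (s - 1))%:E : \bar R).
  by apply: nnm_EFin => [|t]; [exact: measurable_powR|exact: powR_ge0].
have bj j : 0 <= ((be ^+ j)%R)%:E by rewrite lee_fin exprn_ge0.
pose k := ((1 - rho)^-1 `^ al)%R.
have k0 : (0 <= k)%R by rewrite powR_ge0.
have wj j : (0 <= (rho^-1 ^+ j * be ^+ j) `^ al)%R by rewrite powR_ge0.
apply: (@le_trans _ _ (\int[leb]_(t in D) (k%:E * \sum_(j <oo)
   (((rho^-1 ^+ j * be ^+ j) `^ al)%:E *
     ((F (c j * t)%R)%:E `^ al * (t `^ (s - 1))%:E))))).
  apply: int_in_le => //; [by nnm|by nnm|].
  move=> t _; have ts0 : 0 <= (t `^ (s - 1))%:E by rewrite lee_fin powR_ge0.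
  have -> : \sum_(j <oo) ((be ^+ j)%:E * (F (c j * t))%:E) =
      \sum_(j <oo) ((rho ^+ j)%:E *
        ((rho^-1 ^+ j * be ^+ j)%:E * (F (c j * t))%:E)).
    apply: eq_eseriesr => j _; rewrite [RHS]muleA; congr (_ * _).
    rewrite -EFinM; congr EFin.
    by rewrite mulrA -exprMn mulfV ?gt_eqF// expr1n mul1r.
  have w0 j : (0 <= rho^-1 ^+ j * be ^+ j)%R.
    by rewrite mulr_ge0 ?exprn_ge0 ?invr_ge0// ltW.
  have -> : \sum_(j <oo) (((rho^-1 ^+ j * be ^+ j) `^ al)%:E *
     ((F (c j * t)%R)%:E `^ al * (t `^ (s - 1))%:E)) =
     (\sum_(j <oo) (((rho^-1 ^+ j * be ^+ j) `^ al)%:E *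
       (F (c j * t)%R)%:E `^ al)) * (t `^ (s - 1))%:E.
    rewrite -nneseriesZr//; last first.
      by move=> j; rewrite mule_ge0 ?poweR_ge0 ?lee_fin.
    by apply: eq_eseriesr => j _; rewrite muleA.
  rewrite muleA lee_wpmul2r//.
  apply: le_trans (poweR_geometric_series _ _ _) _ => //.
  - by rewrite (ltW r0).
  - by move=> j; rewrite mule_ge0// lee_fin ?(dst_ge0 dF).
  rewrite lee_wpmul2l ?lee_fin//; apply: lee_nneseries => [j _ _|j _].
    exact: poweR_ge0.
  by rewrite poweRM ?lee_fin ?(dst_ge0 dF).
rewrite int_inZ ?lee_fin//; last by nnm.
rewrite int_in_series//; last by move=> j; nnm.
rewrite -mulrA [in leRHS]EFinM -muleA; apply: lee_pmul.
- by rewrite lee_fin.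
- by apply: nneseries_ge0 => j _ _; apply: int_in_ge0; nnm.
- rewrite lee_fin /k; apply: ler_powR => //.
  by rewrite invf_ge1 ?subr_gt0// lerBlDr lerDl ltW.
have I0 : 0 <= dist_int al s F by apply: int_in_ge0; exact: nnm_dist.
apply: (@le_trans _ _ (\sum_(j <oo) ((K * th ^+ j)%:E * dist_int al s F))).
  apply: lee_nneseries => [j _ _|j _]; first by apply: int_in_ge0; nnm.
  rewrite int_inZ; [|by rewrite lee_fin wj|by nnm|exact: mD].
  have := dist_int_scale al s (c0 j) dF; rewrite {1}/dist_int => ->.
  by rewrite muleA -EFinM lee_wpmul2r// lee_fin.
rewrite (nneseriesZr (a := fun j => (K * th ^+ j)%:E))//; last first.
  by move=> j; rewrite lee_fin mulr_ge0// exprn_ge0// ltW.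
under eq_eseriesr do rewrite EFinM.
rewrite nneseriesZl; last by move=> j _; rewrite lee_fin exprn_ge0// ltW.
rewrite geometric_eseries; last by rewrite (ltW t0).
by rewrite -EFinM.
Qed.

(** A dilation by [c] multiplies [dist_int] by [c ^ (- s)]. For exponents in
    the open interval between [q1] and [q2] these factors beat the weights
    [2 ^ (q1 j)] of the upward dilates, and the weights [2 ^ (- q2 j)] beat the
    factors of the downward ones. *)
Lemma lorentz_interpolation (q : R) (F G : R -> R) :
  (1 <= q <= p)%R -> (q1 + de + de <= q)%R -> (q + de + de <= q2)%R ->
  distribution F -> distribution G ->
  (forall t, (0 < t)%R -> (G t)%:E <= C%:E *
    ((2 `^ q1)%:E * \sum_(j <oo) (((2 `^ q1) ^+ j)%:E * (F (2 ^+ j * t))%:E) +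
     \sum_(j <oo) (((2 `^ (- q2)) ^+ j)%:E * (F (2^-1 ^+ j.+1 * t))%:E))) ->
  dist_int (s / q) s G <= lorentz_const%:E * dist_int (s / q) s F.
Proof.
move=> /andP[q_1 qp] qlo qhi dF dG HG.
have q0 : (0 < q)%R by exact: lt_le_trans q_1.
have p0 : (0 < p)%R by exact: lt_le_trans p1.
have s0 : (0 < s)%R by exact: lt_le_trans s1.
set al := (s / q)%R.
have al0 : (0 < al)%R by rewrite divr_gt0.
have als : (al <= s)%R by rewrite ler_pdivrMr// ler_peMr// ltW.
have alq : (al * q = s)%R by rewrite /al divfK// gt_eqF.
have alde : (de / p <= al * de)%R.
  rewrite mulrC ler_wpM2r ?(ltW de0)// /al ler_pdivlMr// mulrC ler_pdivrMr//.
  by apply: (le_trans qp); rewrite ler_peMl// ltW.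
have /andP[r0 r1] := rho01; have /andP[t0 t1] := th01.
have rV j : (rho^-1 ^+ j = 2 `^ (de * j%:R) :> R)%R.
  by rewrite /rho -powRN opprK pX.
have thj (x : R) j : (al * x <= - (al * de))%R ->
    (2 `^ (al * x * j%:R) <= th ^+ j :> R)%R.
  move=> hx; rewrite /th pX ler_powR ?ler1n//.
  by rewrite ler_wpM2r// (le_trans hx)// lerN2.
have H1 j : ((rho^-1 ^+ j * (2 `^ q1) ^+ j) `^ al * (2 ^+ j) `^ (- s) <=
    1 * th ^+ j :> R)%R.
  rewrite rV pX pD -powR_mulrn// -!powRrM pD mul1r.
  rewrite (_ : _ + _ = al * (de + q1 - q) * j%:R)%R; last by rewrite -alq; ring.
  apply: thj; rewrite -mulrN ler_wpM2l ?(ltW al0)//; lra.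
have H2 j : ((rho^-1 ^+ j * (2 `^ (- q2)) ^+ j) `^ al * (2^-1 ^+ j.+1) `^ (- s) <=
    2 `^ s * th ^+ j :> R)%R.
  have -> : (2^-1 ^+ j.+1 = 2 `^ (- j.+1%:R) :> R)%R.
    by rewrite powRN powR_mulrn// exprVn.
  rewrite rV pX pD -!powRrM pD.
  rewrite (_ : _ + _ = s + al * (de - q2 + q) * j%:R)%R; last first.
    by rewrite -alq -natr1; ring.
  rewrite -pD ler_wpM2l ?powR_ge0//.
  apply: thj; rewrite -mulrN ler_wpM2l ?(ltW al0)//; lra.
have two0 j : (0 < (2:R) ^+ j)%R by rewrite exprn_gt0.
have half0 j : (0 < (2:R)^-1 ^+ j.+1)%R by rewrite exprn_gt0.
have b1 := half_interpolation al0 als dF two0 ler01 H1 (powR_ge0 _ _).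
have b2 := half_interpolation al0 als dF half0 (powR_ge0 2 s) H2 (powR_ge0 _ _).
have nFc c : (0 < c)%R -> nnm (fun t : TR => (F (c * t)%R)%:E : \bar R).
  by move=> c0; apply: nnm_EFin; [exact: distribution_measurable (distribution_scale c0 dF)
    |move=> t; exact: (dst_ge0 dF)].
have nF1 j := nFc _ (two0 j); have nF2 j := nFc _ (half0 j).
have nG : nnm (fun t : TR => (G t)%:E : \bar R).
  by apply: nnm_EFin; [exact: distribution_measurable|exact: dst_ge0].
have nts : nnm (fun t : TR => (t `^ (s - 1))%:E : \bar R).
  by apply: nnm_EFin => [|t]; [exact: measurable_powR|exact: powR_ge0].
pose S1 t := \sum_(j <oo) (((2 `^ q1) ^+ j)%:E * (F (2 ^+ j * t))%:E).
pose S2 t := \sum_(j <oo) (((2 `^ (- q2)) ^+ j)%:E * (F (2^-1 ^+ j.+1 * t))%:E).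
have nS1 : nnm (S1 : TR -> \bar R).
  apply: nnm_series => j; apply: nnmM (nF1 j); apply: nnm_cst.
  by rewrite lee_fin exprn_ge0// powR_ge0.
have nS2 : nnm (S2 : TR -> \bar R).
  apply: nnm_series => j; apply: nnmM (nF2 j); apply: nnm_cst.
  by rewrite lee_fin exprn_ge0// powR_ge0.
pose k := ((C + 1) `^ s * 2 `^ s)%R.
have k0 : 0 <= k%:E by rewrite lee_fin mulr_ge0 ?powR_ge0.
apply: (@le_trans _ _ (\int[leb]_(t in D) (k%:E *
   ((2 `^ q1 `^ s)%:E * (S1 t `^ al * (t `^ (s - 1))%:E) +
    S2 t `^ al * (t `^ (s - 1))%:E)))).
  apply: int_in_le => //; [by nnm|by nnm|].
  move=> t; rewrite /D /= in_itv/= andbT => tpos.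
  have ts0 : 0 <= (t `^ (s - 1))%:E by rewrite lee_fin powR_ge0.
  have s10 : 0 <= S1 t by case: nS1.
  have s20 : 0 <= S2 t by case: nS2.
  rewrite muleA -ge0_muleDl ?mule_ge0 ?poweR_ge0 ?lee_fin ?powR_ge0//.
  rewrite muleA lee_wpmul2r//.
  have q1s : 0 <= (2 `^ q1)%:E * S1 t by rewrite mule_ge0// lee_fin powR_ge0.
  apply: (@le_trans _ _ ((C%:E * ((2 `^ q1)%:E * S1 t + S2 t)) `^ al)).
    rewrite -[(G t `^ al)%:E]poweR_EFin; apply: le_poweR; [exact: ltW|by rewrite lee_fin; exact: dst_ge0|exact: HG].
  rewrite poweRM ?lee_fin ?(ltW C0) ?adde_ge0// poweR_EFin /k EFinM -muleA.
  apply: lee_pmul; rewrite ?lee_fin ?powR_ge0 ?poweR_ge0//.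
    apply: (@le_trans _ _ ((C + 1) `^ al)%R).
      by apply: le_powR; [exact: ltW|exact: ltW|rewrite lerDl].
    by apply: ler_powR => //; rewrite lerDr ltW.
  apply: le_trans (poweRD_le al0 q1s s20) _.
  apply: lee_pmul; rewrite ?lee_fin ?powR_ge0 ?adde_ge0 ?poweR_ge0//.
    by apply: ler_powR => //; rewrite ler1n.
  rewrite leeD2r// poweRM ?lee_fin ?powR_ge0// poweR_EFin lee_wpmul2r ?poweR_ge0//.
  rewrite lee_fin; apply: ler_powR => //.
  rewrite -[leLHS](powRr0 2); apply: ler_powR; rewrite ?ler1n//; exact: ltW.
rewrite int_inZ//; last by nnm.
rewrite int_inD//; [|by nnm|by nnm].
rewrite int_inZ ?lee_fin ?powR_ge0//; last by nnm.
rewrite /lorentz_const -/k [in leRHS]EFinM -muleA lee_wpmul2l//.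
apply: (@le_trans _ _ ((2 `^ q1 `^ s)%:E * (((1 - rho)^-1 `^ s * 1 * (1 - th)^-1)%:E *
   dist_int al s F) + ((1 - rho)^-1 `^ s * 2 `^ s * (1 - th)^-1)%:E * dist_int al s F)).
  by apply: leeD => //; apply: lee_wpmul2l => //; rewrite lee_fin powR_ge0.
have I0 : 0 <= dist_int al s F by apply: int_in_ge0; exact: nnm_dist.
have c1 : (0 <= (1 - rho)^-1 `^ s)%R by rewrite powR_ge0.
have c2 : (0 <= (1 - th)^-1)%R by rewrite invr_ge0 subr_ge0 ltW.
rewrite muleA -ge0_muleDl; last 2 first.
- by rewrite -EFinM lee_fin !mulr_ge0 ?powR_ge0.
- by rewrite lee_fin !mulr_ge0 ?powR_ge0.
rewrite lee_wpmul2r// -EFinM -EFinD lee_fin le_eqVlt; apply/orP; left; apply/eqP.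
rewrite -/rho -/th; ring.
Qed.

End lorentz_interpolation.

(** * Countable families of balls in a space of homogeneous type *)

Section geometry.
Context {R : realType} {d : measure_display} {X : measurableType d}.
Variables (rho : X -> X -> R) (mu : {measure set X -> \bar R}).
Variables (kap : R) (dou : R).
Hypotheses (kap1 : 1 <= kap) (qm : is_quasi_metric rho kap).
Hypothesis mball : forall x r, 0 < r -> measurable (qball rho x r).
Hypothesis pball : forall x r, 0 < r -> (0 < mu (qball rho x r))%E.
Hypothesis dou1 : 1 <= dou.
Hypothesis doubling : forall x r, 0 < r ->
  (mu (qball rho x (2 * r)) <= dou%:E * mu (qball rho x r))%E.
Variables (x0 : X) (r0 : R).
Hypotheses (r00 : 0 < r0) (fin0 : (mu (qball rho x0 r0) < +oo)%E).

Let kap0 : 0 < kap. Proof. exact: lt_le_trans kap1. Qed.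
Let tri := qm_triangle qm.
Let sym := qm_sym qm.
Let rho0 := qm_ge0 qm.

Lemma qball_sub x y r s : kap * (rho y x + r) <= s ->
  qball rho x r `<=` qball rho y s.
Proof.
move=> h z xz; apply: le_lt_trans (tri y z x) _.
by apply: lt_le_trans h; rewrite ltr_pM2l// ltrD2l.
Qed.

Lemma qball_le x r s : r <= s -> qball rho x r `<=` qball rho x s.
Proof. by move=> rs z; rewrite /qball/= => /lt_le_trans; apply. Qed.

Lemma qball_center x r : 0 < r -> qball rho x r x.
Proof. by move=> r0'; rewrite /qball/=; have [_ ->] := qm_eq0 qm x x. Qed.

Lemma measure_qball_le x y r s : 0 < r -> 0 < s -> kap * (rho y x + r) <= s ->
  (mu (qball rho x r) <= mu (qball rho y s))%E.
Proof.
move=> r1 s1 h; apply: le_measure; rewrite ?inE; [exact: mball|exact: mball|].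
exact: qball_sub.
Qed.

Lemma doubling_iter k x r : 0 < r ->
  (mu (qball rho x (2 ^+ k * r)) <= (dou ^+ k)%:E * mu (qball rho x r))%E.
Proof.
move=> r1; elim: k => [|k ih]; first by rewrite !mul1r mul1e.
rewrite exprS -mulrA; apply: le_trans (doubling _ _) _.
  by rewrite mulr_gt0// exprn_gt0.
rewrite exprS EFinM -muleA lee_wpmul2l// lee_fin.
exact: le_trans dou1.
Qed.

Lemma doubling_dilation c : 0 < c -> exists2 k : R, 1 <= k & forall x r, 0 < r ->
  (mu (qball rho x (c * r)) <= k%:E * mu (qball rho x r))%E.
Proof.
move=> c0; have [n cn] := archi_exp c (lexx (2 : R)).
exists (dou ^+ n) => [|x r r1]; first exact: exprn_ege1.
apply: le_trans (doubling_iter n x r1).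
apply: le_measure; rewrite ?inE; [apply: mball|apply: mball|apply: qball_le].
- exact: mulr_gt0.
- by rewrite mulr_gt0// exprn_gt0.
- by rewrite ler_wpM2r// ltW.
Qed.

Lemma qball_fin x r : 0 < r -> (mu (qball rho x r) < +oo)%E.
Proof.
move=> r1; set s := kap * (rho x0 x + r).
have s0 : 0 < s by rewrite mulr_gt0// ltr_wpDl.
have [k k1 H] := doubling_dilation (divr_gt0 s0 r00).
apply: le_lt_trans (measure_qball_le r1 s0 (lexx s)) _.
have := H x0 r0 r00; rewrite divfK ?gt_eqF// => /le_lt_trans; apply.
rewrite lte_mul_pinfty// ?lee_fin; first exact: le_trans k1.
Qed.

(** A maximal separated set in a ball is finite, because the balls of half the
    radius around its points are disjoint and of comparable measure. *)
Lemma finite_net a T : 0 < a -> 0 < T -> exists s : seq X,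
  forall y, rho x0 y < T -> exists2 i, (i < size s)%N & rho (nth x0 s i) y < a.
Proof.
move=> a0 T0.
pose sep (s : seq X) := (forall i, (i < size s)%N -> rho x0 (nth x0 s i) < T) /\
  (forall i j, (i < j < size s)%N -> a <= rho (nth x0 s i) (nth x0 s j)).
pose P k := `[< exists s, size s = k /\ sep s >].
pose e := a / (2 * kap).
have e0 : 0 < e by rewrite divr_gt0// mulr_gt0.
pose S := kap * (T + e).
have S0 : 0 < S by rewrite mulr_gt0// addr_gt0.
pose S' := kap * (T + S).
have S'0 : 0 < S' by rewrite mulr_gt0// addr_gt0.
have [k k1 H] := doubling_dilation (divr_gt0 S'0 e0).
have k0 : 0 < k by exact: lt_le_trans k1.
have m0 := pball x0 S0; have mfin := qball_fin x0 S0.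
have mE : mu (qball rho x0 S) = (fine (mu (qball rho x0 S)))%:E.
  by rewrite fineK// ge0_fin_numE.
set m := fine (mu (qball rho x0 S)) in mE.
have {}m0 : 0 < m by rewrite -lte_fin -mE.
have bound n : P n -> (n <= Num.bound k)%N.
  move=> /asboolP[s [<- [sT ss]]].
  pose F i := qball rho (nth x0 s i) e.
  have mF i : measurable (F i) by exact: mball.
  have n1 : nnm (fun _ : X => 1%E : \bar R) by nnm.
  have tF : trivIset [set` iota 0 (size s)] F.
    suff dis i j z : (i < j < size s)%N -> F i z -> F j z -> False.
      move=> i j /=; rewrite !mem_iota !add0n /= => si sj [z [iz jz]].
      have [ij|ji|//] := ltngtP i j.
        by exfalso; apply: (dis i j z) => //; rewrite ij.
      by exfalso; apply: (dis j i z) => //; rewrite ji.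
    move=> ij; rewrite /F /qball /= => iz jz.
    have := ss _ _ ij; apply/negP; rewrite -ltNge.
    apply: le_lt_trans (tri _ _ z) _; rewrite (sym z).
    have : kap * (rho (nth x0 s i) z + rho (nth x0 s j) z) < kap * (e + e).
      by rewrite ltr_pM2l// ltrD.
    by move=> /lt_le_trans; apply; rewrite /e le_eqVlt; apply/orP; left;
      apply/eqP; field; rewrite gt_eqF.
  have sub i : (i < size s)%N -> F i `<=` qball rho x0 S.
    move=> si; apply: qball_sub; rewrite /S ler_wpM2l ?(ltW kap0)// lerD2r.
    exact: ltW (sT _ si).
  have h := @int_trivIset_le _ _ _ mu (fun=> 1%E) F (iota 0 (size s))
    (qball rho x0 S) n1 mF (iota_uniq _ _) tF (mball _ S0).
  have {h} : (\sum_(i <- iota 0 (size s)) mu (F i) <= mu (qball rho x0 S))%E.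
    have E (A : set X) : measurable A -> mu A = (\int[mu]_(x in A) 1)%E.
      by move=> mA; rewrite int_cst ?mul1e// lee01.
    rewrite (E _ (mball _ S0)); under eq_bigr do rewrite (E _ (mF _)).
    by apply: h => i; rewrite mem_iota add0n => /andP[_]; exact: sub.
  have low i : (i < size s)%N -> ((k^-1 * m)%:E <= mu (F i))%E.
    move=> si; rewrite EFinM -mE lee_pdivrMl//.
    apply: le_trans (H _ _ e0); rewrite divfK ?gt_eqF//.
    apply: measure_qball_le => //; rewrite /S' ler_wpM2l ?(ltW kap0)// lerD2r.
    by rewrite sym ltW// sT.
  have : (\sum_(i <- iota 0 (size s)) (k^-1 * m)%:E <=
      \sum_(i <- iota 0 (size s)) mu (F i))%E.
    rewrite big_seq [leRHS]big_seq; apply: lee_sum => i.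
    by rewrite mem_iota add0n => /andP[_]; exact: low.
  move=> /le_trans/[apply]; rewrite mE sumEFin lee_fin big_const_seq count_predT size_iota.
  rewrite iter_addr_0 -mulr_natr mulrAC -[leRHS]mul1r ler_pM2r//.
  rewrite ler_pdivrMl// mulr1 => sk.
  have := le_lt_trans sk (archi_boundP (ltW k0)); rewrite ltr_nat; exact: ltnW.
have P0 : P 0%N.
  by apply/asboolP; exists [::]; split => //; split => // i j /andP[].
have [n /asboolP[s [sn [sT ss]]] nmax] := ex_maxnP (ex_intro P 0%N P0) bound.
exists s => y yT; apply: contrapT => /forall2NP far.
have : P n.+1.
  apply/asboolP; exists (rcons s y); split; first by rewrite size_rcons sn.
  split => [i|i j]; rewrite size_rcons !nth_rcons ltnS.
    by rewrite leq_eqVlt => /orP[/eqP ->|is_]; [rewrite ltnn eqxx|rewrite is_; exact: sT].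
  move=> /andP[ij]; rewrite leq_eqVlt => /orP[/eqP js|js].
    rewrite js ltnn eqxx -js ij leNgt; apply/negP => h.
    by case: (far i); [rewrite -js ij|apply].
  by rewrite js (ltn_trans ij js); apply: ss; rewrite ij.
by move=> /nmax; rewrite ltnn.
Qed.

(** Countably many balls: the radii are the positive rationals and the centres
    of the balls of radius [a] form a net at scale [a / (2 kap)]. *)
Lemma countable_balls : exists (cs : nat -> X) (rs : nat -> R),
  (forall n, 0 < rs n) /\ forall x r, 0 < r ->
    exists n, [/\ r < rs n, rs n < 2 * r & rho (cs n) x < rs n / (2 * kap)].
Proof.
pose rad (t : nat * nat * nat * nat) : R := t.1.1.1.+1%:R / t.1.1.2.+1%:R.
have rad0 t : 0 < rad t by rewrite divr_gt0.
have k20 : 0 < 2 * kap by rewrite mulr_gt0.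
have /choice[net netP] : forall t, exists s : seq X, forall y, rho x0 y < t.1.2.+1%:R ->
    exists2 i, (i < size s)%N & rho (nth x0 s i) y < rad t / (2 * kap).
  by move=> t; apply: finite_net; rewrite ?divr_gt0.
pose dec n : nat * nat * nat * nat := odflt (0, 0, 0, 0)%N (unpickle n).
have decK t : dec (pickle t) = t by rewrite /dec pickleK.
pose norm (t : nat * nat * nat * nat) : nat * nat * nat * nat := (t.1, 0%N).
exists (fun n => nth x0 (net (norm (dec n))) (dec n).2), (fun n => rad (dec n)).
split=> // x r r1.
pose l := Num.bound r^-1.
have lr : (l.+1%:R)^-1 < r.
  rewrite invf_plt ?posrE//; apply: lt_trans (_ : l%:R < _); last by rewrite ltr_nat.
  by apply: archi_boundP; rewrite invr_ge0 ltW.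
have ex : exists m : nat, r < m.+1%:R / l.+1%:R.
  exists (Num.bound (r * l.+1%:R)); rewrite ltr_pdivlMr//.
  apply: lt_trans (archi_boundP _) _; first by rewrite mulr_ge0// ltW.
  by rewrite ltr_nat.
have [m rm mmin] := ex_minnP ex.
have m2 : m.+1%:R / l.+1%:R < 2 * r.
  have : m%:R / l.+1%:R <= r.
    case: m rm mmin => [_ _|m _ mmin]; first by rewrite mul0r ltW.
    by rewrite leNgt; apply/negP => /mmin; rewrite ltnn.
  move=> h; rewrite -(natr1 m) mulrDl mul1r.
  by apply: lt_le_trans (_ : r + r <= _); [exact: ler_ltD|lra].
pose N := Num.bound (rho x0 x).
have xN : rho x0 x < N.+1%:R.
  apply: lt_trans (_ : N%:R < _); last by rewrite ltr_nat.
  exact: archi_boundP.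
have [i _ ix] := netP (m, l, N, 0%N) x xN.
exists (pickle (m, l, N, i)); rewrite decK.
by split.
Qed.

Definition small_balls (B : nat -> set X) := forall x e, 0 < e ->
  exists n, B n x /\ B n `<=` qball rho x e.

Definition covers_balls (B : nat -> set X) (K : R) := forall x t, 0 < t ->
  exists n, qball rho x t `<=` B n /\ (mu (B n) <= K%:E * mu (qball rho x t))%E.

(** A ball meeting [B n] whose radius is at most twice that of [B n] lies within
    distance [5 kap ^ 3 rs n] of the centre of [B n], up to one more use of the
    triangle inequality; the dilation factor [10 kap ^ 3] leaves room for the
    distance between the centres of [B n] and [B (star n)]. *)
Lemma ball_family_exists : exists (B : nat -> set X) (r : nat -> R)
    (star : nat -> nat) (K : R),
  [/\ ball_family mu B r star K, (forall n, qballs rho (B n)),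
      small_balls B & covers_balls B K].
Proof.
have [cs [rs [rs0 HE]]] := countable_balls.
pose B n := qball rho (cs n) (rs n).
have k3 : 1 <= kap ^+ 3 by exact: exprn_ege1.
have /choice[star starP] : forall n, exists m, [/\ 10 * kap ^+ 3 * rs n < rs m,
    rs m < 2 * (10 * kap ^+ 3 * rs n) & rho (cs m) (cs n) < rs m / (2 * kap)].
  by move=> n; apply: HE; rewrite !mulr_gt0// exprn_gt0.
have c10 : 0 < 40 * kap ^+ 4 by rewrite mulr_gt0// exprn_gt0.
have c20 : 0 < 8 * kap ^+ 2 by rewrite mulr_gt0// exprn_gt0.
have [K1 K11 H1] := doubling_dilation c10.
have [K2 K21 H2] := doubling_dilation c20.
have inv2k s : 0 < s -> kap * (s / (2 * kap)) = s / 2.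
  by move=> _; field; rewrite gt_eqF.
have inv_le s : 0 < s -> s / (2 * kap) <= s.
  move=> s0; rewrite ler_pdivrMr ?mulr_gt0// ler_peMr ?(ltW s0)//.
  have := kap1; lra.
have cover x t : 0 < t -> exists n, qball rho x t `<=` B n /\
    (mu (B n) <= K2%:E * mu (qball rho x t))%E.
  move=> t0; have [|n [n1 n2 n3]] := HE x (2 * kap * t); first by rewrite !mulr_gt0.
  exists n; split.
    apply: qball_sub; apply: (@le_trans _ _ (kap * (rs n / (2 * kap) + t))).
      by rewrite ler_wpM2l ?(ltW kap0)// lerD2r ltW.
    rewrite mulrDr inv2k//; lra.
  apply: le_trans (H2 x t t0); apply: measure_qball_le => //; first exact: mulr_gt0.
  apply: (@le_trans _ _ (kap * (rs n + rs n))).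
    rewrite ler_wpM2l ?(ltW kap0)// lerD2r sym ltW//.
    exact: lt_le_trans n3 (inv_le _ (rs0 n)).
  have h := ler_wpM2l (ltW kap0) (ltW n2).
  by rewrite mulrDr; rewrite expr2; nra.
exists B, rs, star, (Num.max K1 K2); split.
- split.
  + by move=> n; exact: mball.
  + by move=> n; exact: pball.
  + by move=> n; exact: qball_fin.
  + exact: rs0.
  + move=> n; have [s1 _ _] := starP n; apply: le_lt_trans s1.
    by rewrite ler_wpM2r ?(ltW (rs0 n))//; lra.
  + move=> m n [z [mz nz]] rmn y my.
    have [s1 _ s3] := starP n.
    have zy : rho z y < kap * (4 * rs n).
      apply: le_lt_trans (tri z y (cs m)) _; rewrite ltr_pM2l// (sym z).
      have h1 : rho (cs m) z < rs m by exact: mz.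
      have h2 : rho (cs m) y < rs m by exact: my.
      lra.
    have ny : rho (cs n) y < kap * (rs n + kap * (4 * rs n)).
      apply: le_lt_trans (tri (cs n) y z) _; rewrite ltr_pM2l//.
      have h1 : rho (cs n) z < rs n by exact: nz.
      lra.
    rewrite /B /qball /=; apply: le_lt_trans (tri _ _ (cs n)) _.
    apply: (@lt_le_trans _ _ (kap * (rs (star n) / (2 * kap) +
        kap * (rs n + kap * (4 * rs n))))).
      by rewrite ltr_pM2l// ltrD.
    rewrite mulrDr inv2k//.
    have h : kap * (kap * (rs n + kap * (4 * rs n))) <= 5 * kap ^+ 3 * rs n.
      have h2 : kap ^+ 2 * rs n <= kap ^+ 3 * rs n.
        by rewrite ler_wpM2r ?(ltW (rs0 n))// [leRHS]exprS ler_peMl// exprn_ge0// ltW.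
      rewrite (_ : kap * _ = kap ^+ 2 * rs n + 4 * (kap ^+ 3 * rs n)); last by ring.
      lra.
    lra.
  + move=> n; have [_ s2 s3] := starP n.
    apply: (@le_trans _ _ (K1%:E * mu (B n))%E); last first.
      by rewrite lee_wpmul2r// lee_fin le_max lexx.
    apply: le_trans (H1 _ _ (rs0 n)); apply: measure_qball_le => //.
      exact: mulr_gt0.
    apply: (@le_trans _ _ (kap * (rs (star n) + rs (star n)))).
      rewrite ler_wpM2l ?(ltW kap0)// lerD2r sym ltW//.
      exact: lt_le_trans s3 (inv_le _ (rs0 _)).
    have h := ler_wpM2l (ltW kap0) (ltW s2).
    rewrite mulrDr (_ : 40 * _ * _ = 2 * (kap * (2 * (10 * kap ^+ 3 * rs n)))).
      lra.
    by ring.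
  + move=> x y; have t0 : 0 < rho x y + 1 by rewrite ltr_wpDl.
    have [n [sub _]] := cover x _ t0.
    exists n; split; apply: sub; first exact: qball_center.
    by rewrite /qball/= ltrDl.
- by move=> n; exists (cs n), (rs n).
- move=> x e e0; have e'0 : 0 < e / (4 * kap) by rewrite divr_gt0// mulr_gt0.
  have [n [_ n2 n3]] := HE x _ e'0; exists n; split.
    exact: lt_le_trans n3 (inv_le _ (rs0 n)).
  apply: qball_sub; apply: (@le_trans _ _ (kap * (rs n + rs n))).
    rewrite ler_wpM2l ?(ltW kap0)// lerD2r sym ltW//.
    exact: lt_le_trans n3 (inv_le _ (rs0 n)).
  have h := ler_wpM2l (ltW kap0) (ltW n2).
  rewrite mulrDr; apply: (@le_trans _ _ (2 * (kap * (2 * (e / (4 * kap)))))); first lra.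
  by rewrite le_eqVlt; apply/orP; left; apply/eqP; field; rewrite gt_eqF.
- move=> x t t0; have [n [sub le]] := cover x t t0; exists n; split => //.
  by apply: (le_trans le); rewrite lee_wpmul2r// lee_fin le_max lexx orbT.
Qed.

End geometry.

(** * Products of A_1 weights *)

Section factorization.
Context {R : realType} {d : measure_display} {X : measurableType d}.
Variables (rho : X -> X -> R) (mu : {measure set X -> \bar R}).
Variables (B : nat -> set X) (r : nat -> R) (star : nat -> nat) (K : R).
Hypothesis BF : ball_family mu B r star K.
Hypothesis mball : forall x t, (0 < t)%R -> measurable (qball rho x t).
Hypothesis pball : forall x t, (0 < t)%R -> (0 < mu (qball rho x t))%E.
Hypothesis Bball : forall n, qballs rho (B n).
Hypothesis cov : covers_balls rho mu B K.
Local Notation A1w := (A1w mu B).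
Local Notation wr := (wr mu B).
Local Open Scope ereal_scope.

Let mB := bf_meas BF.
Let K1 : (1 <= K)%R. Proof. exact: ball_family_K_ge1 BF. Qed.
Let K0 : (0 < K)%R. Proof. exact: lt_le_trans K1. Qed.

Lemma ae_set_exists (A : set X) (P : X -> Prop) : measurable A -> 0 < mu A ->
  {ae mu, forall x, A x -> P x} -> exists2 x, A x & P x.
Proof.
move=> mA A0 [N [mN N0 AN]]; apply: contrapT => H.
have : mu A <= mu N.
  apply: le_measure; rewrite ?inE// => x Ax; apply: AN => /= HP.
  by apply: H; exists x => //; exact: HP.
by rewrite N0 leNgt A0.
Qed.

Lemma A1w_av_le k phi n : A1w k phi ->
  {ae mu, forall x, B n x -> av mu B w1 (fun y => (phi y)%:E) n <= (k * phi x)%:E}.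
Proof.
move=> [_ _ H]; apply: filterS H => x Hx Bx; apply: le_trans Hx; exact: Mx_ge.
Qed.

Lemma av_w1E phi n : av mu B w1 (fun y => (phi y)%:E) n =
  ((wr w1 n)^-1)%:E * \int[mu]_(x in B n) (phi x)%:E.
Proof. by congr (_ * _); apply: eq_integral => x _; rewrite mule1. Qed.

Lemma A1w_good k phi : A1w k phi -> good_weight mu B phi.
Proof.
move=> A1; have [mp p0 _] := A1; split => // n.
have [x _] := ae_set_exists (mB n) (bf_gt0 BF n) (A1w_av_le n A1).
rewrite av_w1E => H; have W := wr_gt0 BF n (good_w1 BF).
rewrite -(@lte_pmul2l _ (((wr w1 n)^-1)%:E)) ?lte_fin ?invr_gt0//.
by rewrite gt0_muley ?lte_fin ?invr_gt0//; exact: le_lt_trans H (ltry _).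
Qed.

(** The defining property of A_1 in its localised form: on [B n] the weight is
    essentially bounded below by its mean. *)
Lemma A1w_mean_le k phi n : A1w k phi ->
  {ae mu, forall x, B n x -> (wr phi n / wr w1 n <= k * phi x)%R}.
Proof.
move=> A1; have g := A1w_good A1; apply: filterS (A1w_av_le n A1) => x + Bx.
by move=> /(_ Bx); rewrite av_w1E wrE// -EFinM mulrC lee_fin.
Qed.

(** Every ball is contained in a member of the family of comparable measure,
    so averages over balls are controlled by averages over the family. *)
Lemma qball_cover x t : (0 < t)%R -> exists n m,
  [/\ qball rho x t `<=` B n, mu (qball rho x t) = m%:E, (0 < m)%R &
      (wr w1 n <= K * m)%R].
Proof.
move=> t0; have [n [sub le]] := cov x t0.
have fin : mu (qball rho x t) < +oo.
  apply: le_lt_trans (bf_fin BF n); apply: le_measure; rewrite ?inE//; exact: mball.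
have E : mu (qball rho x t) = (fine (mu (qball rho x t)))%:E.
  by rewrite fineK// ge0_fin_numE ?fin.
exists n, (fine (mu (qball rho x t))); split => //.
- by rewrite -lte_fin -E pball.
- by rewrite -lee_fin EFinM -E -(wr_w1 BF).
Qed.

Lemma avgE (Q : set X) m f : mu Q = m%:E -> (0 < m)%R ->
  avg mu Q f = (m^-1)%:E * \int[mu]_(x in Q) (f x)%:E.
Proof. by move=> mE m0; rewrite /avg mE inver gt_eqF. Qed.

Lemma avg_dominated (Q : set X) m n (c : R) (h u : X -> R) :
  measurable Q -> Q `<=` B n -> mu Q = m%:E -> (0 < m)%R -> (wr w1 n <= K * m)%R ->
  (0 <= c)%R -> good_weight mu B u -> measurable_fun setT h ->
  (forall x, (0 <= h x)%R) ->
  {ae mu, forall x, Q x -> (h x <= c * u x)%R} ->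
  avg mu Q h <= (c * (K * (wr u n / wr w1 n)))%:E.
Proof.
move=> mQ QB mE m0 mn c0 gu mh h0 hu; rewrite (avgE _ mE m0).
have nu := nnm_weight gu; have nh := nnm_EFin mh h0.
have W := wr_gt0 BF n (good_w1 BF).
have uW := wr_gt0 BF n gu.
apply: (@le_trans _ _ ((m^-1)%:E * (c%:E * (wr u n)%:E))).
  apply: lee_wpmul2l; first by rewrite lee_fin invr_ge0 ltW.
  rewrite -wrE//.
  apply: (@le_trans _ _ (\int[mu]_(x in Q) (c%:E * (u x)%:E))).
    apply: ae_ge0_le_integral => //.
    - by move=> x _; case: nh.
    - exact: measurable_funS nh.1.
    - by move=> x _; rewrite mule_ge0 ?lee_fin// ltW// (gw_gt0 gu).
    - by apply: measurable_funS (_ : measurable_fun setT _) => //; apply: (nnmM _ nu).1; exact: nnm_cst.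
  rewrite int_inZ ?lee_fin// lee_wpmul2l ?lee_fin//.
  exact: int_subset.
rewrite -!EFinM lee_fin mulrCA ler_wpM2l// mulrCA [leLHS]mulrC ler_wpM2l ?(ltW uW)//.
by rewrite ler_pdivlMr// mulrC ler_pdivrMr// .
Qed.

Section power.
Variables (k p0 : R) (phi psi : X -> R).
Hypotheses (k0 : (0 < k)%R) (p01 : (1 <= p0)%R) (Aphi : A1w k phi) (Apsi : A1w k psi).
Let v x := (phi x `^ (1 - p0) * psi x)%R.

Let gphi : good_weight mu B phi. Proof. exact: A1w_good Aphi. Qed.
Let gpsi : good_weight mu B psi. Proof. exact: A1w_good Apsi. Qed.

Let v_gt0 x : (0 < v x)%R.
Proof. by rewrite mulr_gt0 ?powR_gt0 ?(a1_gt0 Aphi) ?(a1_gt0 Apsi). Qed.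

Let v_meas : measurable_fun setT v.
Proof.
apply: measurable_funM; last exact: a1_meas Apsi.
exact: (measurableT_comp (measurable_powR _) (a1_meas Aphi)).
Qed.

Let v_le n : {ae mu, forall x, B n x ->
  (v x <= (wr phi n / wr w1 n / k) `^ (1 - p0) * psi x)%R}.
Proof.
apply: filterS (A1w_mean_le n Aphi) => x H Bx.
have c0 : (0 < wr phi n / wr w1 n / k)%R.
  by rewrite !divr_gt0// (wr_gt0 BF)//; exact: good_w1 BF.
rewrite ler_wpM2r ?(ltW (a1_gt0 Apsi _))//.
rewrite -[(1 - p0)%R]opprB !powRN lef_pV2 ?posrE ?powR_gt0 ?(a1_gt0 Aphi)//.
apply: le_powR; rewrite ?subr_ge0 ?(ltW c0)//.
by rewrite ler_pdivrMr// [leRHS]mulrC H.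
Qed.

Lemma factored_is_weight : is_weight rho mu v.
Proof.
split => //; first by apply: aeW.
move=> _ [x [t [t0 ->]]]; have [n [m [sub mE m0 mn]]] := qball_cover x t0.
have nv : nnm (fun x => (v x)%:E) by apply: nnm_EFin => // y; exact: ltW.
apply/integrableP; split; first by apply: measurable_funS nv.1.
have : avg mu (qball rho x t) v < +oo.
  apply: le_lt_trans (ltry _).
  apply: (avg_dominated (mball x t0) sub mE m0 mn
    (powR_ge0 (wr phi n / wr w1 n / k) (1 - p0)) gpsi v_meas).
    by move=> y; exact: ltW.
  by apply: filterS (v_le n) => y H /sub; exact: H.
rewrite (avgE _ mE m0) => H.
under eq_integral do rewrite gee0_abs ?lee_fin ?(ltW (v_gt0 _))//.
rewrite -(@lte_pmul2l _ (m^-1)%:E) ?lte_fin ?invr_gt0//.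
by rewrite gt0_muley ?lte_fin ?invr_gt0.
Qed.


Lemma A1w_constant_ge1 C : A1_bound rho mu psi C -> (1 <= C)%R.
Proof.
move=> H; have W := wr_gt0 BF 0%N (good_w1 BF); have pW := wr_gt0 BF 0%N gpsi.
have {}H : {ae mu, forall x, B 0%N x -> (wr psi 0%N / wr w1 0%N <= C * psi x)%R}.
  apply: filterS H => x Hx Bx; rewrite -lee_fin; apply: le_trans Hx.
  apply: ereal_sup_ubound; exists (B 0%N); first by split.
  rewrite (avgE _ (wr_w1 BF 0%N) W) mulrC EFinM -wrE//; congr (_ * _).
  by apply: eq_integral => y _; rewrite ger0_norm// ltW// (a1_gt0 Apsi).
have C0 : (0 < C)%R.
  have [x _ Hx] := ae_set_exists (mB 0%N) (bf_gt0 BF 0%N) H.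
  rewrite -(pmulr_lgt0 _ (a1_gt0 Apsi x)); apply: lt_le_trans Hx.
  by rewrite divr_gt0.
have np := nnm_weight gpsi.
have : \int[mu]_(x in B 0%N) ((wr psi 0%N / wr w1 0%N)%:E) <=
    \int[mu]_(x in B 0%N) (C%:E * (psi x)%:E).
  apply: ae_ge0_le_integral => //.
  - by move=> x _; rewrite lee_fin ltW// divr_gt0.
  - by move=> x _; rewrite mule_ge0// lee_fin ltW// (a1_gt0 Apsi).
  - apply: measurable_funS (_ : measurable_fun setT _) => //.
    by apply: (nnmM _ np).1; apply: nnm_cst; rewrite lee_fin ltW.
rewrite int_cst ?lee_fin ?(ltW (divr_gt0 _ _))// int_inZ ?lee_fin ?(ltW C0)//.
rewrite wrE// (wr_w1 BF) -!EFinM lee_fin divfK ?gt_eqF//.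
by rewrite -{1}[wr psi 0%N]mul1r ler_pM2r.
Qed.

Lemma A1w_A1_bound : A1_bound rho mu psi (K * k).
Proof.
apply: filterS (a1_bound Apsi) => x Hx; apply: ge_ereal_sup => _ [_ [[y [t [t0 ->]]] Qx] <-].
have [n [m [sub mE m0 mn]]] := qball_cover y t0.
have W := wr_gt0 BF n (good_w1 BF).
have mpsi : measurable_fun setT (fun y => `|psi y|%R).
  by apply: measurableT_comp => //; exact: a1_meas Apsi.
apply: (@le_trans _ _ (1 * (K * (wr psi n / wr w1 n)))%:E).
  apply: (avg_dominated (mball y t0) sub mE m0 mn ler01 gpsi mpsi) => //.
  by apply: aeW => z Qz; rewrite mul1r ger0_norm// ltW// (a1_gt0 Apsi).
rewrite mul1r -mulrA lee_fin ler_wpM2l ?(ltW K0)// -lee_fin.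
apply: le_trans Hx; apply: le_trans (Mx_ge _ _ _ (sub _ Qx)).
by rewrite av_w1E wrE// -EFinM mulrC.
Qed.

(** The easy direction of the factorization of Muckenhoupt weights: a quotient
    of A_1 weights is in A_p0. Over a ball contained in [B n] the first factor
    is compared with its mean over [B n], which leaves a linear average in
    each of the two factors of the constant. *)
Lemma factored_in_Ap : in_Ap rho mu p0 v /\ exists c,
  [/\ Ap_const rho mu p0 v = c%:E, (0 < c)%R & (c <= (K * k) `^ p0)%R].
Proof.
have Kk : (0 < K * k)%R by rewrite mulr_gt0.
have [p0E|/eqP p0N1] := eqVneq p0 1%R.
  have vE : v = psi by apply/funext => x; rewrite /v p0E subrr powRr0 mul1r.
  have wv := factored_is_weight; rewrite vE p0E in wv *.
  have AB := A1w_A1_bound.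
  split; first by split => //; rewrite eqxx; exists (K * k)%R.
  rewrite /Ap_const eqxx powRr1 ?(ltW Kk)//.
  have le : ereal_inf [set C%:E | C in A1_bound rho mu psi] <= (K * k)%:E.
    by apply: ereal_inf_lbound; exists (K * k)%R.
  have ge : 1%:E <= ereal_inf [set C%:E | C in A1_bound rho mu psi].
    by apply: le_ereal_inf_tmp => _ [C /A1w_constant_ge1 C1 <-]; rewrite lee_fin.
  have fE : ereal_inf [set C%:E | C in A1_bound rho mu psi] \is a fin_num.
    by rewrite fin_numE; apply/andP; split; apply/eqP => E;
      move: le ge; rewrite E//= leeNy_eq.
  exists (fine (ereal_inf [set C%:E | C in A1_bound rho mu psi])); split.
  - by rewrite fineK.
  - by apply: lt_le_trans ltr01 _; rewrite -lee_fin fineK.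
  - by rewrite -lee_fin fineK.
have p0gt1 : (1 < p0)%R by rewrite lt_neqAle p01 andbT eq_sym; apply/eqP.
have d0 : (0 < p0 - 1)%R by rewrite subr_gt0.
have cE : (1 - conj_exp p0 = - (p0 - 1)^-1)%R.
  by rewrite /conj_exp; field; rewrite gt_eqF.
pose e := (p0 - 1)^-1%R.
have e0 : (0 < e)%R by rewrite invr_gt0.
have phi0 := a1_gt0 Aphi; have psi0 := a1_gt0 Apsi.
pose v' x := (v x `^ (1 - conj_exp p0))%R.
have mv' : measurable_fun setT v'.
  exact: (measurableT_comp (measurable_powR _) v_meas).
have v'0 x : (0 < v' x)%R by rewrite powR_gt0.
have v'E x : (v' x = phi x * psi x `^ (- e))%R.
  rewrite /v' cE -/e /v powRM ?powR_ge0 ?(ltW (psi0 _))// -powRrM.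
  have -> : ((1 - p0) * - e = 1)%R by rewrite /e; field; rewrite gt_eqF.
  by rewrite powRr1// ltW.
have v'_le n : {ae mu, forall x, B n x ->
    (v' x <= (wr psi n / wr w1 n / k) `^ (- e) * phi x)%R}.
  apply: filterS (A1w_mean_le n Apsi) => x H Bx.
  have c0 : (0 < wr psi n / wr w1 n / k)%R.
    by rewrite !divr_gt0// (wr_gt0 BF)//; exact: good_w1 BF.
  rewrite v'E mulrC ler_wpM2r ?(ltW (phi0 _))// !powRN lef_pV2 ?posrE ?powR_gt0//.
  apply: le_powR; rewrite ?(ltW e0) ?(ltW c0)//.
  by rewrite ler_pdivrMr// [leRHS]mulrC H.
pose S := [set avg mu Q v * avg mu Q v' `^ (p0 - 1) | Q in qballs rho].
have SE : Ap_const rho mu p0 v = ereal_sup S.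
  by rewrite /Ap_const (negbTE (introN eqP p0N1)).
have Sle : ereal_sup S <= ((K * k) `^ p0)%:E.
  apply: ge_ereal_sup => _ [_ [x [t [t0 ->]]] <-].
  have [n [m [sub mE m0 mn]]] := qball_cover x t0.
  have W := wr_gt0 BF n (good_w1 BF).
  set a := (wr phi n / wr w1 n)%R; set b := (wr psi n / wr w1 n)%R.
  have a0 : (0 < a)%R by rewrite divr_gt0// (wr_gt0 BF).
  have b0 : (0 < b)%R by rewrite divr_gt0// (wr_gt0 BF).
  have H1 : avg mu (qball rho x t) v <= ((a / k) `^ (1 - p0) * (K * b))%:E.
    apply: (avg_dominated (mball x t0) sub mE m0 mn (powR_ge0 _ _) gpsi v_meas) => //.
      by move=> y; exact: ltW.
    by apply: filterS (v_le n) => y H /sub; exact: H.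
  have H2 : avg mu (qball rho x t) v' <= ((b / k) `^ (- e) * (K * a))%:E.
    apply: (avg_dominated (mball x t0) sub mE m0 mn (powR_ge0 _ _) gphi mv') => //.
      by move=> y; exact: ltW.
    by apply: filterS (v'_le n) => y H /sub; exact: H.
  have A0 h : (forall x, 0 < h x)%R -> 0 <= avg mu (qball rho x t) h.
    move=> h0; rewrite (avgE _ mE m0) mule_ge0 ?lee_fin ?invr_ge0 ?(ltW m0)//.
    by apply: integral_ge0 => y _; rewrite lee_fin ltW.
  apply: (@le_trans _ _ (((a / k) `^ (1 - p0) * (K * b))%:E *
      ((b / k) `^ (- e) * (K * a))%:E `^ (p0 - 1))).
    apply: lee_pmul => //; [exact: A0|exact: poweR_ge0|].
    by apply: le_poweR => //; [exact: ltW|exact: A0].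
  rewrite poweR_EFin -EFinM lee_fin.
  rewrite [((_ * (K * a)) `^ _)%R]powRM ?powR_ge0 ?(ltW (mulr_gt0 K0 a0))// -powRrM.
  have -> : (- e * (p0 - 1) = - 1)%R by rewrite /e; field; rewrite gt_eqF.
  rewrite powR_inv1 ?(ltW (divr_gt0 b0 k0))// -[(1 - p0)%R]opprB powRN.
  have -> : (K * a = K * k * (a / k))%R by field; rewrite gt_eqF.
  rewrite [((_ * _ * (a / k)) `^ _)%R]powRM ?(ltW Kk) ?(ltW (divr_gt0 a0 k0))//.
  have ak0 : (0 < (a / k) `^ (p0 - 1))%R by rewrite powR_gt0// divr_gt0.
  have -> : ((K * k) `^ p0 = (K * k) `^ (p0 - 1) * (K * k))%R.
    by rewrite -{3}(powRr1 (ltW Kk)) -powRD ?subrK// (gt_eqF Kk) implybT.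
  rewrite le_eqVlt; apply/orP; left; apply/eqP; field.
  by rewrite !gt_eqF.
have Spos : 0 < ereal_sup S.
  have [x [t [t0 BE]]] := Bball 0%N.
  have W := wr_gt0 BF 0%N (good_w1 BF).
  have A0 (h : X -> R) : measurable_fun setT h -> (forall x, 0 < h x)%R -> 0 < avg mu (B 0%N) h.
    move=> mh h0; rewrite (avgE _ (wr_w1 BF 0%N) W) mule_gt0 ?lte_fin ?invr_gt0//.
    by apply: int_in_gt0 => //; exact: bf_gt0 BF 0%N.
  apply: (@lt_le_trans _ _ (avg mu (B 0%N) v * avg mu (B 0%N) v' `^ (p0 - 1))).
    by rewrite mule_gt0 ?poweR_gt0// A0.
  by apply: ereal_sup_ubound; exists (B 0%N).
have Sfin : ereal_sup S \is a fin_num.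
  by rewrite ge0_fin_numE ?(ltW Spos)//; exact: le_lt_trans Sle (ltry _).
split.
  split; first exact: factored_is_weight.
  by rewrite (negbTE (introN eqP p0N1)) SE -ge0_fin_numE ?(ltW Spos).
exists (fine (ereal_sup S)); split.
- by rewrite SE fineK.
- by rewrite -lte_fin fineK.
- by rewrite -lee_fin fineK.
Qed.

End power.
End factorization.

(** * From the space of homogeneous type to the family of balls *)

Section reduction.
Context {R : realType} {d : measure_display} {X : measurableType d}.
Variables (rho : X -> X -> R) (mu : {measure set X -> \bar R}).
Local Open Scope ereal_scope.

(** A weight is only positive almost everywhere; it is modified on a null set
    so that quotients and logarithms make sense everywhere. *)
Definition normalize (w : X -> R) (x : X) : R :=
  if (0 < w x)%R then w x else 1%R.

Lemma normalize_gt0 w x : (0 < normalize w x)%R.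
Proof. by rewrite /normalize; case: ifPn. Qed.

Lemma measurable_normalize w : measurable_fun setT w ->
  measurable_fun setT (normalize w).
Proof.
move=> mw; apply: measurable_fun_if => //.
- exact: measurable_fun_ltr.
- exact: measurable_funS mw.
Qed.

Lemma normalize_ae w : {ae mu, forall x, (0 < w x)%R} ->
  {ae mu, forall x, normalize w x = w x}.
Proof. by apply: filterS => x wx; rewrite /normalize wx. Qed.

Lemma int_normalize (phi : R -> R) (w : X -> R) (A : set X) : measurable A ->
  measurable_fun setT w -> measurable_fun setT phi ->
  {ae mu, forall x, (0 < w x)%R} ->
  \int[mu]_(x in A) (phi (normalize w x))%:E = \int[mu]_(x in A) (phi (w x))%:E.
Proof.
move=> mA mw mphi aw; apply: ae_eq_integral => //.
- apply/measurable_EFinP; apply: measurable_funS (_ : measurable_fun setT _) => //.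
  by apply: (measurableT_comp mphi); exact: measurable_normalize.
- apply/measurable_EFinP; apply: measurable_funS (_ : measurable_fun setT _) => //.
  exact: (measurableT_comp mphi).
- by apply: filterS (normalize_ae aw) => x ->.
Qed.

(** This is where density of the continuous functions enters the geometry:
    a nonzero continuous integrable function is bounded below on some ball,
    which is then of finite measure. *)
Lemma finite_ball_exists (w : X -> R) (x0 : X) : continuous_dense_L1 rho mu ->
  (forall x r, (0 < r)%R -> measurable (qball rho x r)) ->
  (forall x r, (0 < r)%R -> 0 < mu (qball rho x r)) ->
  measurable_fun setT w -> (forall x, (0 < w x)%R) -> \int[mu]_x (w x)%:E < +oo ->
  exists x r, (0 < r)%R /\ mu (qball rho x r) < +oo.
Proof.
move=> hd mb pb mw w0 wfin.
have nw : nnm (fun x => (w x)%:E) by apply: nnm_EFin => // x; exact: ltW.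
have wi : mu.-integrable setT (EFin \o w).
  apply/integrableP; split; first exact: nw.1.
  rewrite (eq_integral (fun x => (w x)%:E))// => x _.
  by rewrite /= ger0_norm// ltW.
have I0 : 0 < \int[mu]_x (w x)%:E.
  apply: int_in_gt0 => //; apply: lt_le_trans (pb x0 1%R ltr01) _.
  by apply: le_measure; rewrite ?inE//; exact: mb.
have IE : \int[mu]_x (w x)%:E = (fine (\int[mu]_x (w x)%:E))%:E.
  by rewrite fineK// ge0_fin_numE ?(ltW I0).
have e0 : (0 < fine (\int[mu]_x (w x)%:E)%E)%R by rewrite -lte_fin -IE.
have [h [ch hi hl]] := hd w wi _ e0.
have [x hx] : exists x, h x != 0%R.
  apply: contrapT => /forallNP H; move: hl; rewrite -IE.
  rewrite (_ : \int[mu]_x _ = \int[mu]_x (w x)%:E) ?ltxx//.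
  apply: eq_integral => y _; have /negP/negPn/eqP -> := H y.
  by rewrite subr0 ger0_norm// ltW.
have c0 : (0 < `|h x| / 2)%R by rewrite divr_gt0// normr_gt0.
have [r r0 hr] := ch x _ c0.
exists x, r; split => //.
have mQ := mb x r r0.
have /integrableP[mh hfin] := hi.
have nh : nnm (fun y => `|(h y)%:E|).
  by split => [|y]; [exact: (measurableT_comp _ mh)|exact: abse_ge0].
have : \int[mu]_(y in qball rho x r) (`|h x| / 2)%:E < +oo.
  apply: le_lt_trans hfin; apply: (@le_trans _ _ (\int[mu]_(y in qball rho x r) `|(h y)%:E|)).
    apply: int_in_le => //.
    move=> y Qy; rewrite abse_EFin lee_fin.
    have := hr y Qy; have := ler_normB (h x - h y)%R (- h y)%R; rewrite opprK subrK normrN.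
    lra.
  exact: int_subset.
rewrite int_cst ?lee_fin ?(ltW c0)// => H.
rewrite -(@lte_pmul2l _ (`|h x| / 2)%:E)//.
by rewrite gt0_muley// lte_fin.
Qed.

Lemma dense_bcontinuous_of_dense B : small_balls rho B ->
  continuous_dense_L1 rho mu -> dense_bcontinuous mu B.
Proof.
move=> sB hd f fi e e0; have [h [ch hi hl]] := hd f fi e e0.
exists h; split => // x c c0; have [r r0 hr] := ch x c c0.
by have [n [Bx sub]] := sB x r r0; exists n; split => // y /sub; exact: hr.
Qed.

Section muckenhoupt.
Variables (B : nat -> set X) (r : nat -> R) (star : nat -> nat) (K : R).
Hypothesis BF : ball_family mu B r star K.
Hypothesis Bball : forall n, qballs rho (B n).

Lemma Ap_of_in_Ap p w : (1 < p)%R -> in_Ap rho mu p w ->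
  Ap mu B p^-1 (normalize w) (fun x => normalize w x `^ (1 - conj_exp p))%R.
Proof.
move=> p1 [[aw mw iw]].
have p0 : (0 < p)%R by exact: lt_trans p1.
have d0 : (0 < p - 1)%R by rewrite subr_gt0.
have cE : (1 - conj_exp p = - (p - 1)^-1)%R.
  by rewrite /conj_exp; field; rewrite gt_eqF.
have a1 : (p^-1 < 1)%R by rewrite invf_lt1.
rewrite (gt_eqF p1) => Afin.
set u := normalize w; set s := (fun x => _).
have u0 x : (0 < u x)%R by exact: normalize_gt0.
have mu_u : measurable_fun setT u by exact: measurable_normalize.
have mB := bf_meas BF.
have intu n : \int[mu]_(x in B n) (u x)%:E = \int[mu]_(x in B n) (w x)%:E.
  by apply: (int_normalize (phi := id)).
have ints n : \int[mu]_(x in B n) (s x)%:E =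
    \int[mu]_(x in B n) (w x `^ (1 - conj_exp p))%:E.
  by apply: (int_normalize (phi := fun y => (y `^ (1 - conj_exp p))%R)).
have gu : good_weight mu B u.
  split => // n; have /integrableP[_] := iw _ (Bball n); apply: le_lt_trans.
  rewrite -(int_normalize (phi := fun y => `|y|%R))//.
  by under [leRHS]eq_integral do rewrite ger0_norm ?(ltW (u0 _))//.
have ms : measurable_fun setT s.
  exact: (measurableT_comp (measurable_powR _) mu_u).
have s0 x : (0 < s x)%R by exact: powR_gt0.
pose a n := avg mu (B n) w * avg mu (B n) (fun x => w x `^ (1 - conj_exp p))%R `^ (p - 1).
have aV n : a n <= Ap_const rho mu p w.
  rewrite /Ap_const (gt_eqF p1); apply: ereal_sup_ubound.
  by exists (B n) => //; exact: Bball.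
have aE n : a n = (wr mu B u n / wr mu B w1 n)%:E *
    (((wr mu B w1 n)^-1)%:E * \int[mu]_(x in B n) (s x)%:E) `^ (p - 1).
  have W := wr_gt0 BF n (good_w1 BF).
  rewrite /a !(avgE _ (wr_w1 BF n) W) -(intu n) -(ints n) (wrE n gu).
  by rewrite -EFinM mulrC.
have gs : good_weight mu B s.
  split => // n; rewrite ltey; apply/eqP => E.
  have W := wr_gt0 BF n (good_w1 BF); have U := wr_gt0 BF n gu.
  have := aV n; rewrite aE E gt0_muley ?lte_fin ?invr_gt0// (poweRyr (lt0r_neq0 d0)).
  rewrite gt0_muley ?lte_fin ?divr_gt0// leye_eq => /eqP VE.
  by rewrite VE in Afin.
have {}aE n : a n = (wr mu B u n / wr mu B w1 n *
    ((wr mu B w1 n)^-1 * wr mu B s n) `^ (p - 1))%:E.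
  by rewrite aE (wrE _ gs).
have V0 : 0 < Ap_const rho mu p w.
  apply: lt_le_trans (aV 0%N); rewrite aE lte_fin.
  by rewrite mulr_gt0 ?powR_gt0 ?divr_gt0 ?mulr_gt0 ?invr_gt0// (wr_gt0 BF)//; exact: good_w1 BF.
have VE : Ap_const rho mu p w = (fine (Ap_const rho mu p w))%:E.
  by rewrite fineK// ge0_fin_numE// ltW.
set V := fine _ in VE; have {}V0 : (0 < V)%R by rewrite -lte_fin -VE.
split => //.
- by rewrite invr_gt0 p0.
- move=> x; rewrite /s ln_powR cE; field; rewrite !gt_eqF//.
exists (p^-1 * ln V)%R => n.
have W := wr_gt0 BF n (good_w1 BF); have U := wr_gt0 BF n gu; have S := wr_gt0 BF n gs.
have := aV n; rewrite aE VE lee_fin.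
rewrite -ler_ln ?posrE// ?mulr_gt0 ?powR_gt0 ?divr_gt0 ?mulr_gt0 ?invr_gt0//.
rewrite !lnM ?posrE ?mulr_gt0 ?powR_gt0 ?divr_gt0 ?mulr_gt0 ?invr_gt0//.
rewrite ln_powR lnM ?posrE ?invr_gt0// !lnV ?posrE//.
set lW := ln _; set lS := ln (wr _ _ s _); set lm := ln (wr _ _ w1 _) => H.
have {}H : (p^-1 * (lW - lm + (p - 1) * (- lm + lS)) <= p^-1 * ln V)%R.
  by rewrite ler_wpM2l// invr_ge0 ltW.
have -> : (p^-1 * lW + (1 - p^-1) * lS =
    p^-1 * (lW - lm + (p - 1) * (- lm + lS)) + lm)%R.
  by field; rewrite gt_eqF.
by rewrite lerD2r.
Qed.

End muckenhoupt.

Section distribution.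
Variable w : X -> R.
Hypotheses (mw : measurable_fun setT w) (w0 : forall x, (0 < w x)%R).
Hypothesis wfin : \int[mu]_x (w x)%:E < +oo.

Definition wdist (f : X -> R) (t : R) : R :=
  fine (\int[mu]_(x in [set x | (t < f x)%R]) (w x)%:E).

Let nw : nnm (fun x => (w x)%:E).
Proof. by apply: nnm_EFin => // x; exact: ltW. Qed.

Lemma measurable_superlevel (f : X -> R) t : measurable_fun setT f ->
  measurable [set x : X | (t < f x)%R].
Proof.
move=> /measurable_EFinP mf; rewrite -[X in measurable X]setTI.
exact: (@emeasurable_fun_o_infty _ _ _ _ _ measurableT mf t%:E).
Qed.

Lemma wdistE (f : X -> R) t : measurable_fun setT f ->
  \int[mu]_(x in [set x | (t < f x)%R]) (w x)%:E = (wdist f t)%:E.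
Proof.
move=> mf; rewrite /wdist fineK// ge0_fin_numE; last exact: int_in_ge0.
apply: le_lt_trans wfin; apply: int_subset => //; exact: measurable_superlevel.
Qed.

Lemma distribution_wdist (f : X -> R) : measurable_fun setT f -> distribution (wdist f).
Proof.
move=> mf; split => [t|s t st]; first by rewrite fine_ge0// int_in_ge0.
rewrite -lee_fin -!wdistE//; apply: int_subset => //; try exact: measurable_superlevel.
by move=> x /=; exact: le_lt_trans.
Qed.

Lemma wdist_le (f : X -> R) t : measurable_fun setT f ->
  (wdist f t)%:E <= \int[mu]_x (w x)%:E.
Proof.
by move=> mf; rewrite -wdistE//; apply: int_subset => //; exact: measurable_superlevel.
Qed.

Let b2eE (f : X -> R) t x : b2e (R := R) (t%:E < (f x)%:E) = inde (R := R) [set x | (t < f x)%R] x.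
Proof.
rewrite /b2e lte_fin; case: ifPn => h; first by rewrite inde_in.
by rewrite inde_out//; exact/negP.
Qed.

(** The layer cake formula over dyadic heights, upwards from [t]. *)
Lemma int_upper_dyadic_le (f : X -> R) (t q : R) : (0 < t)%R -> (0 < q)%R ->
  measurable_fun setT f -> (forall x, 0 <= f x)%R ->
  (t `^ (- q))%:E * \int[mu]_(x in [set x | (t < f x)%R]) (f x `^ q * w x)%:E <=
  (2 `^ q)%:E * \sum_(j <oo) (((2 `^ q) ^+ j)%:E * (wdist f (2 ^+ j * t))%:E).
Proof.
move=> t0 q0 mf f0.
have mA s := measurable_superlevel s mf.
have nA s : nnm (inde [set x | (s < f x)%R]) by exact: nnm_inde.
pose c j : \bar R := ((2 ^+ j * t) `^ q)%:E.
have c0 j : 0 <= c j by rewrite lee_fin powR_ge0.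
have nS : nnm (fun x => \sum_(j <oo) (c j * (inde [set x | (2 ^+ j * t < f x)%R] x * (w x)%:E))).
  by apply: nnm_series => j; apply: nnmM; [exact: nnm_cst|exact: nnmM].
have nfq : nnm (fun x => (f x `^ q * w x)%:E).
  apply: nnm_EFin => [|x]; last by rewrite mulr_ge0 ?powR_ge0 ?(ltW (w0 _)).
  by apply: measurable_funM => //; exact: (measurableT_comp (measurable_powR _) mf).
apply: (@le_trans _ _ ((t `^ (- q))%:E * ((2 `^ q)%:E * \sum_(j <oo) (c j * (wdist f (2 ^+ j * t))%:E)))).
  apply: lee_wpmul2l; first by rewrite lee_fin powR_ge0.
  have -> : \sum_(j <oo) (c j * (wdist f (2 ^+ j * t))%:E) =
      \int[mu]_x (\sum_(j <oo) (c j * (inde [set x | (2 ^+ j * t < f x)%R] x * (w x)%:E))).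
    rewrite int_series => [|j]; last by apply: nnmM; [exact: nnm_cst|exact: nnmM].
    apply: eq_eseriesr => j _; rewrite intZ//; last exact: nnmM.
    by rewrite -wdistE// [in LHS]int_inde.
  rewrite -intZ ?lee_fin ?powR_ge0//.
  rewrite [leLHS]int_inde; apply: int_le.
  - exact: nnmM.
  - by apply: nnmM nS; apply: nnm_cst; rewrite lee_fin powR_ge0.
  move=> x; have wx0 : 0 <= (w x)%:E by case: nw.
  have [tx|tx] := ltP t (f x); last first.
    rewrite inde_out ?mul0e; last by rewrite /= ltNge tx.
    by rewrite mule_ge0 ?lee_fin ?powR_ge0//; case: nS.
  rewrite inde_in// mul1e EFinM.
  have := @le_dyadic_series R t q (f x)%:E t0 q0; rewrite lte_fin => /(_ tx) H.
  apply: le_trans (lee_wpmul2r wx0 H) _.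
  rewrite -muleA lee_wpmul2l ?lee_fin ?powR_ge0//.
  rewrite -nneseriesZr//; last by move=> j; rewrite mule_ge0 ?lee_fin ?powR_ge0// b2e_ge0.
  by under eq_eseriesr do rewrite b2eE -muleA.
rewrite muleCA lee_wpmul2l ?lee_fin ?powR_ge0//.
have d0 s : 0 <= (wdist f s)%:E by rewrite lee_fin (dst_ge0 (distribution_wdist mf)).
rewrite -nneseriesZl; last by move=> j _; exact: mule_ge0.
apply: lee_nneseries => j _.
  by move=> _; apply: mule_ge0; [rewrite lee_fin powR_ge0|exact: mule_ge0].
rewrite muleA lee_wpmul2r// /c -EFinM lee_fin.
rewrite powRM ?exprn_ge0 ?(ltW t0)// mulrCA -powRD; last by rewrite (gt_eqF t0) implybT.
by rewrite addNr powRr0 mulr1 powR_exprn.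
Qed.

(** The layer cake formula over dyadic heights, downwards from [t]. *)
Lemma int_lower_dyadic_le (f : X -> R) (t q : R) : (0 < t)%R -> (0 < q)%R ->
  measurable_fun setT f -> (forall x, 0 <= f x)%R ->
  (t `^ (- q))%:E * \int[mu]_(x in [set x | (f x <= t)%R]) (f x `^ q * w x)%:E <=
  \sum_(j <oo) (((2 `^ (- q)) ^+ j)%:E * (wdist f (2^-1 ^+ j.+1 * t))%:E).
Proof.
move=> t0 q0 mf f0.
have mA s := measurable_superlevel s mf.
have nA s : nnm (inde [set x | (s < f x)%R]) by exact: nnm_inde.
have mAc : measurable [set x | (f x <= t)%R].
  rewrite (_ : [set x | (f x <= t)%R] = ~` [set x | (t < f x)%R]); first exact: measurableC.
  by apply/seteqP; split => x /=; rewrite leNgt => /negP.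
pose c j : \bar R := ((t / 2 ^+ j) `^ q)%:E.
have c0 j : 0 <= c j by rewrite lee_fin powR_ge0.
have E j : (t / 2 ^+ j.+1 = 2^-1 ^+ j.+1 * t)%R by rewrite exprVn mulrC.
have nS : nnm (fun x => \sum_(j <oo) (c j * (inde [set x | (2^-1 ^+ j.+1 * t < f x)%R] x * (w x)%:E))).
  by apply: nnm_series => j; apply: nnmM; [exact: nnm_cst|exact: nnmM].
have nfq : nnm (fun x => (f x `^ q * w x)%:E).
  apply: nnm_EFin => [|x]; last by rewrite mulr_ge0 ?powR_ge0 ?(ltW (w0 _)).
  by apply: measurable_funM => //; exact: (measurableT_comp (measurable_powR _) mf).
apply: (@le_trans _ _ ((t `^ (- q))%:E * (\sum_(j <oo) (c j * (wdist f (2^-1 ^+ j.+1 * t))%:E)))).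
  apply: lee_wpmul2l; first by rewrite lee_fin powR_ge0.
  have -> : \sum_(j <oo) (c j * (wdist f (2^-1 ^+ j.+1 * t))%:E) =
      \int[mu]_x (\sum_(j <oo) (c j * (inde [set x | (2^-1 ^+ j.+1 * t < f x)%R] x * (w x)%:E))).
    rewrite int_series => [|j]; last by apply: nnmM; [exact: nnm_cst|exact: nnmM].
    apply: eq_eseriesr => j _; rewrite intZ//; last exact: nnmM.
    by rewrite -wdistE// [in LHS]int_inde.
  rewrite [leLHS]int_inde; apply: int_le => //.
    by apply: nnmM nfq; exact: nnm_inde.
  move=> x; have wx0 : 0 <= (w x)%:E by case: nw.
  have [xt|xt] := leP (f x) t; last first.
    rewrite inde_out ?mul0e; last by rewrite /= leNgt xt.
    by case: nS.
  rewrite inde_in// mul1e EFinM.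
  have H : (0 <= f x <= t)%R by rewrite f0.
  apply: le_trans (lee_wpmul2r wx0 (le_dyadic_series_down t0 q0 H)) _.
  rewrite -nneseriesZr//; last by move=> j; rewrite mule_ge0 ?lee_fin ?powR_ge0// b2e_ge0.
  by under eq_eseriesr do rewrite b2eE E -muleA.
have d0 s : 0 <= (wdist f s)%:E by rewrite lee_fin (dst_ge0 (distribution_wdist mf)).
rewrite -nneseriesZl; last by move=> j _; exact: mule_ge0.
apply: lee_nneseries => j _.
  by move=> _; apply: mule_ge0; [rewrite lee_fin powR_ge0|exact: mule_ge0].
rewrite muleA lee_wpmul2r// /c -EFinM lee_fin.
have hj : (0 <= (2:R)^-1 ^+ j)%R by rewrite exprn_ge0// invr_ge0.
rewrite -exprVn powRM ?(ltW t0)// mulrA -powRD; last by rewrite (gt_eqF t0) implybT.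
have h2 : (0 <= (2:R)^-1)%R by rewrite invr_ge0.
by rewrite addNr powRr0 mul1r (powR_exprn q j h2) -powR_inv1// -powRrM mulN1r.
Qed.

Lemma lorentz_normE q s (f : X -> R) : measurable_fun setT f -> (forall x, 0 <= f x)%R ->
  lorentz_norm mu q s w f = (s%:E * dist_int (s / q) s (wdist f)) `^ s^-1.
Proof.
move=> mf f0; rewrite /lorentz_norm; congr ((_ * _) `^ _).
apply: eq_integral => t _; congr (_ `^ _ * _).
rewrite -wdistE// /wmeas; congr (integral _ _ _).
by apply/seteqP; split => x /=; rewrite ger0_norm.
Qed.

End distribution.

Lemma lorentz_norm_normalize q s (w f : X -> R) :
  measurable_fun setT w -> {ae mu, forall x, (0 < w x)%R} -> measurable_fun setT f ->
  lorentz_norm mu q s (normalize w) f = lorentz_norm mu q s w f.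
Proof.
move=> mw aw mf.
have E t : wmeas mu (normalize w) [set x | (t < `|f x|)%R] =
    wmeas mu w [set x | (t < `|f x|)%R].
  apply: (int_normalize (phi := id)) => //; apply: measurable_superlevel.
  exact: measurableT_comp.
by rewrite /lorentz_norm; under eq_integral do rewrite E.
Qed.

End reduction.

(** * Grand Lorentz norms *)

Section grand_lorentz.
Context {R : realType} {d : measure_display} {X : measurableType d}.
Variables (mu : {measure set X -> \bar R}) (w : X -> R).
Hypotheses (mw : measurable_fun setT w) (w0 : forall x, (0 < w x)%R).
Hypothesis wfin : (\int[mu]_x (w x)%:E < +oo)%E.
Local Notation wdist := (wdist mu w).
Local Open Scope ereal_scope.

(** The distributional estimate in the form consumed by the interpolation
    argument: only values of the two distribution functions occur. *)
Definition dyadic_bound (q1 q2 C : R) (f g : X -> R) : Prop :=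
  forall t, (0 < t)%R -> (wdist g t)%:E <= C%:E *
    ((2 `^ q1)%:E * \sum_(j <oo) (((2 `^ q1) ^+ j)%:E * (wdist f (2 ^+ j * t))%:E) +
     \sum_(j <oo) (((2 `^ (- q2)) ^+ j)%:E * (wdist f (2^-1 ^+ j.+1 * t))%:E)).

Lemma lorentz_norm_ge0 q s (f : X -> R) : 0 <= lorentz_norm mu q s w f.
Proof. exact: poweR_ge0. Qed.

Lemma dist_int_ge0 al s F : distribution F -> 0 <= dist_int (R := R) al s F.
Proof. by move=> dF; apply: int_in_ge0; exact: nnm_dist. Qed.

Lemma lorentz_norm_le q q' s c (f g : X -> R) : (1 <= s)%R -> (0 <= c)%R ->
  measurable_fun setT f -> measurable_fun setT g ->
  (forall x, 0 <= f x)%R -> (forall x, 0 <= g x)%R ->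
  dist_int (s / q) s (wdist g) <= c%:E * dist_int (s / q') s (wdist f) ->
  lorentz_norm mu q s w g <= (c `^ s^-1)%:E * lorentz_norm mu q' s w f.
Proof.
move=> s1 c0 mf mg f0 g0 H; have s0 : (0 < s)%R by exact: lt_le_trans s1.
have dF := distribution_wdist mw w0 wfin mf.
have dG := distribution_wdist mw w0 wfin mg.
rewrite !lorentz_normE// -poweR_EFin -poweRM ?lee_fin//; last first.
  by rewrite mule_ge0 ?dist_int_ge0// lee_fin ltW.
apply: le_poweR; first by rewrite invr_ge0 ltW.
  by rewrite mule_ge0 ?dist_int_ge0// lee_fin ltW.
by rewrite muleCA lee_wpmul2l// lee_fin ltW.
Qed.

(** The distribution function of [g] is at most the total weight [W], whence
    [G ^ al <= (W + 1) ^ s G ^ be] for [be <= al <= s]. *)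
Lemma lorentz_norm_embed q q' s (g : X -> R) : (1 <= s)%R -> (1 <= q <= q')%R ->
  measurable_fun setT g -> (forall x, 0 <= g x)%R ->
  lorentz_norm mu q s w g <=
    (fine (\int[mu]_x (w x)%:E) + 1)%:E * lorentz_norm mu q' s w g.
Proof.
move=> s1 /andP[q1 qq'] mg g0; have s0 : (0 < s)%R by exact: lt_le_trans s1.
have q0 : (0 < q)%R by exact: lt_le_trans q1.
have q'0 : (0 < q')%R by exact: lt_le_trans qq'.
have nw : nnm (fun x => (w x)%:E) by apply: nnm_EFin => // x; exact: ltW.
have WE : \int[mu]_x (w x)%:E = (fine (\int[mu]_x (w x)%:E))%:E.
  by rewrite fineK// ge0_fin_numE// int_ge0.
set W := fine _ in WE *.
have W0 : (0 <= W)%R by rewrite -lee_fin -WE int_ge0.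
have dG := distribution_wdist mw w0 wfin mg.
have -> : (W + 1 = ((W + 1) `^ s) `^ s^-1)%R.
  by rewrite -powRrM divff ?gt_eqF// powRr1// addr_ge0.
apply: lorentz_norm_le => //; first exact: powR_ge0.
rewrite -int_inZ ?lee_fin ?powR_ge0//; last exact: nnm_dist.
have nG := nnm_dist (s / q') s dG; have nG' := nnm_dist (s / q) s dG.
apply: int_in_le => //; first by apply: nnmM nG; apply: nnm_cst; rewrite lee_fin powR_ge0.
move=> t _; rewrite muleA lee_wpmul2r ?lee_fin ?powR_ge0//.
have G0 := dst_ge0 dG t.
have GW : (wdist g t <= W)%R by rewrite -lee_fin -WE; exact: wdist_le.
have [->|GN0] := eqVneq (wdist g t) 0%R.
  by rewrite powR0 ?gt_eqF ?divr_gt0// mulr_ge0 ?powR_ge0.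
have e0 : (0 <= s / q - s / q')%R.
  by rewrite subr_ge0 ler_wpM2l ?(ltW s0)// lef_pV2.
have -> : (s / q = s / q - s / q' + s / q')%R by rewrite subrK.
rewrite powRD; last by rewrite GN0 implybT.
rewrite ler_wpM2r ?powR_ge0//.
apply: (@le_trans _ _ ((W + 1) `^ (s / q - s / q'))%R).
  by apply: le_powR => //; rewrite (le_trans GW)// lerDl.
apply: ler_powR; first by rewrite lerDr.
apply: (@le_trans _ _ (s / q)%R); first by rewrite gerBl divr_ge0 ?(ltW s0) ?(ltW q'0).
by rewrite ler_pdivrMr// ler_peMr ?(ltW s0).
Qed.

(** For the exponents [p - eps] close to [p] the interpolation inequality holds
    with a single constant; the others are reduced to one of these. *)
Lemma grand_lorentz_bound (q1 q2 C p s theta : R) : (1 < q1)%R -> (q1 < p)%R ->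
  (p < q2)%R -> (1 <= s)%R -> (0 < theta)%R -> (0 < C)%R ->
  exists2 L : R, (0 < L)%R & forall f g : X -> R,
    measurable_fun setT f -> measurable_fun setT g ->
    (forall x, 0 <= f x)%R -> (forall x, 0 <= g x)%R ->
    dyadic_bound q1 q2 C f g ->
    grand_lorentz_norm mu p s theta w g <=
      L%:E * grand_lorentz_norm mu p s theta w f.
Proof.
move=> q11 q1p pq2 s1 th0 C0.
have s0 : (0 < s)%R by exact: lt_le_trans s1.
pose de : R := Num.min ((p - q1) / 4)%R ((q2 - p) / 2)%R.
have de0 : (0 < de)%R by rewrite lt_min !divr_gt0 ?subr_gt0.
have de1 : (de <= (p - q1) / 4)%R by rewrite ge_min lexx.
have de2 : (de <= (q2 - p) / 2)%R by rewrite ge_min lexx orbT.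
have p1 : (1 <= p)%R by lra.
have q10 : (0 < q1)%R by lra.
pose e0 := ((p - q1) / 2)%R.
have e00 : (0 < e0)%R by rewrite /e0; lra.
have e0p : (e0 < p - 1)%R by rewrite /e0; lra.
pose L0 := lorentz_const q1 de p s C.
have L00 : (0 < L0)%R by exact: lorentz_const_gt0.
pose W := (fine (\int[mu]_x (w x)%:E) + 1)%R.
have W1 : (0 < W)%R.
  rewrite /W ltr_wpDl// fine_ge0// integral_ge0// => x _.
  by rewrite lee_fin ltW.
pose L1 := (L0 `^ s^-1)%R.
have L10 : (0 < L1)%R by rewrite powR_gt0.
pose c := (e0 `^ (theta / (p - e0)))%R.
have c0 : (0 < c)%R by rewrite powR_gt0.
exists (L1 + p `^ theta * W * L1 / c)%R.
  by rewrite ltr_wpDr// !mulr_ge0 ?powR_ge0 ?invr_ge0// ltW.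
move=> f g mf mg f0 g0 H.
have dF := distribution_wdist mw w0 wfin mf.
have dG := distribution_wdist mw w0 wfin mg.
set Gf := grand_lorentz_norm mu p s theta w f.
have near_p q : (p - e0 <= q <= p)%R ->
    lorentz_norm mu q s w g <= L1%:E * lorentz_norm mu q s w f.
  move=> /andP[ql qp]; apply: lorentz_norm_le => //; first exact: ltW.
  apply: (lorentz_interpolation q10 de0 p1 s1 C0 _ _ _ dF dG H).
  - by rewrite qp andbT; rewrite /e0 in ql; lra.
  - by rewrite /e0 in ql; lra.
  - lra.
have Gf_ge e : (0 < e < p - 1)%R ->
    (e `^ (theta / (p - e)))%:E * lorentz_norm mu (p - e) s w f <= Gf.
  by move=> he; apply: ereal_sup_ubound; exists e.
have Gf0 : 0 <= Gf.
  apply: le_trans (Gf_ge e0 _); last by rewrite e00.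
  by rewrite mule_ge0 ?lorentz_norm_ge0// lee_fin powR_ge0.
have K0 : (0 <= p `^ theta * W * L1 / c)%R.
  by rewrite !mulr_ge0 ?powR_ge0 ?invr_ge0// ltW.
apply: ge_ereal_sup => _ [e /= he <-]; have /andP[e_0 ep] := he.
rewrite EFinD ge0_muleDl ?lee_fin ?(ltW L10)//.
have [ee0|ee0] := leP e e0.
  apply: (@le_trans _ _ (L1%:E * Gf)); last first.
    by rewrite leeDl// mule_ge0.
  apply: (@le_trans _ _ (L1%:E * ((e `^ (theta / (p - e)))%:E *
    lorentz_norm mu (p - e) s w f))).
    rewrite muleCA lee_wpmul2l ?lee_fin ?powR_ge0//; apply: near_p; lra.
  by rewrite lee_wpmul2l ?lee_fin ?(ltW L10)// Gf_ge.
apply: (@le_trans _ _ ((p `^ theta * W * L1 / c)%:E * Gf)); last first.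
  by rewrite leeDr// mule_ge0// lee_fin ltW.
apply: (@le_trans _ _ ((p `^ theta)%:E * (W%:E * (L1%:E * lorentz_norm mu (p - e0) s w f)))).
  apply: lee_pmul; rewrite ?lee_fin ?powR_ge0 ?lorentz_norm_ge0//.
    have pe1 : (1 < p - e)%R by lra.
    apply: (@le_trans _ _ (p `^ (theta / (p - e)))%R).
      apply: le_powR; rewrite ?(ltW e_0)//; last by lra.
      by rewrite divr_ge0 ?(ltW th0)//; lra.
    apply: ler_powR => //; rewrite ler_pdivrMr; last by lra.
    by rewrite ler_peMr ?(ltW th0)// ltW.
  apply: (@le_trans _ _ (W%:E * lorentz_norm mu (p - e0) s w g)).
    by apply: lorentz_norm_embed => //; apply/andP; split; lra.
  rewrite lee_wpmul2l ?lee_fin ?(ltW W1)//; apply: near_p; lra.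
have -> : (p `^ theta * W * L1 / c)%:E * Gf =
    (p `^ theta)%:E * (W%:E * (L1%:E * ((c^-1)%:E * Gf))).
  by rewrite !muleA -!EFinM.
do 3 (rewrite lee_wpmul2l ?lee_fin ?powR_ge0 ?(ltW W1) ?(ltW L10)//).
have := Gf_ge e0 _; rewrite e00 e0p => /(_ isT) Hf.
rewrite -[leLHS]mul1e -(mulVf (lt0r_neq0 c0)) EFinM -muleA.
by rewrite lee_wpmul2l// lee_fin invr_ge0 ltW.
Qed.

End grand_lorentz.

Section extrapolation.
Context {R : realType} {d : measure_display} {X : measurableType d}.
Variables (rho : X -> X -> R) (mu : {measure set X -> \bar R}).
Local Open Scope ereal_scope.

(** The constants of all the weights [phi ^ (1 - p0) psi] are at most
    [(K * k) ^ p0], so that monotonicity of [N] gives one bound for all of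
    them. *)
Lemma weighted_bound_of_Ap B r star K p0 C0 k (N : R -> R) (f g : X -> R) :
  ball_family mu B r star K ->
  (forall x t, (0 < t)%R -> measurable (qball rho x t)) ->
  (forall x t, (0 < t)%R -> 0 < mu (qball rho x t)) ->
  (forall n, qballs rho (B n)) -> covers_balls rho mu B K ->
  (0 < k)%R -> (1 <= p0)%R -> (0 < C0)%R ->
  (forall t, 0 < t -> 0 < N t)%R -> (forall t u, 0 < t -> t <= u -> N t <= N u)%R ->
  (forall v, in_Ap rho mu p0 v ->
    (\int[mu]_x (g x `^ p0 * v x)%:E) `^ p0^-1 <=
    (C0 * N (fine (Ap_const rho mu p0 v)))%:E *
      (\int[mu]_x (f x `^ p0 * v x)%:E) `^ p0^-1) ->
  weighted_bound mu B k p0 ((C0 * N ((K * k) `^ p0)) `^ p0)%R f g.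
Proof.
move=> BF mb pb Bb cov k0 p01 C00 N0 Nm H phi psi Aphi Apsi.
have p00 : (0 < p0)%R by exact: lt_le_trans p01.
have [vA [c [cE c0 cle]]] := factored_in_Ap BF mb pb Bb cov k0 p01 Aphi Apsi.
have := H _ vA; rewrite cE /=.
set I := \int[mu]_x _; set J := \int[mu]_x _ => HIJ.
have v0 x : (0 <= phi x `^ (1 - p0) * psi x)%R.
  by rewrite mulr_ge0 ?powR_ge0// ltW// (a1_gt0 Apsi).
have I0 : 0 <= I by apply: integral_ge0 => x _; rewrite lee_fin mulr_ge0 ?powR_ge0.
have J0 : 0 <= J by apply: integral_ge0 => x _; rewrite lee_fin mulr_ge0 ?powR_ge0.
have T0 : (0 <= C0 * N ((K * k) `^ p0))%R.
  by rewrite mulr_ge0 ?(ltW C00)// ltW// N0// (lt_le_trans c0).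
apply: (poweRV_le_mul p00 T0 I0 J0); apply: le_trans HIJ _.
rewrite lee_wpmul2r ?poweR_ge0// lee_fin.
by rewrite ler_wpM2l ?(ltW C00)// Nm.
Qed.

End extrapolation.

(** * The extrapolation theorem *)

Theorem theorem5p1 (R : realType) (d : measure_display) (X : measurableType d)
  (rho : X -> X -> R) (mu : {measure set X -> \bar R})
  (hX : homogeneous_type rho mu) (hdense : continuous_dense_L1 rho mu)
  (F : set ((X -> R) * (X -> R)))
  (hF : forall f g, F (f, g) ->
    [/\ measurable_fun setT f, measurable_fun setT g,
        (forall x, 0 <= f x) & (forall x, 0 <= g x)])
  (p0 : R) (hp0 : 1 <= p0)
  (C0 : R) (hC0 : 0 < C0)
  (N : R -> R) (hN_pos : forall t, 0 < t -> 0 < N t)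
  (hN_mono : forall t u, 0 < t -> t <= u -> N t <= N u)
  (hyp : forall v, in_Ap rho mu p0 v -> forall f g, F (f, g) ->
    ((\int[mu]_x (g x `^ p0 * v x)%:E) `^ (p0^-1)%R
      <= (C0 * N (fine (Ap_const rho mu p0 v)))%:E
         * (\int[mu]_x (f x `^ p0 * v x)%:E) `^ (p0^-1)%R)%E) :
  forall p s theta : R, 1 < p -> 1 <= s -> 0 < theta ->
  forall w : X -> R, mu.-integrable setT (EFin \o w) -> in_Ap rho mu p w ->
  exists2 C : R, 0 < C & forall f g, F (f, g) ->
    (grand_lorentz_norm mu p s theta w g
      <= C%:E * grand_lorentz_norm mu p s theta w f)%E.
Proof.
move=> p s theta p1 s1 th0 w wint wAp.
have [[kap0 kap00 qm0] mb pb [D0 hD0]] := hX.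
have [[x0]|noX] := pselect (inhabited X); last first.
  exists 1 => // f g _; rewrite mul1e (_ : g = f)//.
  by apply/funext => x; case: noX; exists.
have [[aw mw _] _] := wAp.
pose u := normalize w.
have mu_u : measurable_fun setT u by exact: measurable_normalize.
have u0 x : 0 < u x by exact: normalize_gt0.
have ufin : (\int[mu]_x (u x)%:E < +oo)%E.
  have /integrableP[_] := wint; apply: le_lt_trans.
  rewrite -(int_normalize (phi := fun y => `|y|) measurableT mw _ aw)//.
  under [leRHS]eq_integral do rewrite ger0_norm ?(ltW (u0 _))//.
  by [].
have qm : is_quasi_metric rho (Num.max 1 kap0).
  have [q1 q2 q3 q4] := qm0; split => // x y z; apply: le_trans (q4 x y z) _.
  by rewrite ler_wpM2r ?addr_ge0// le_max lexx orbT.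
have dbl x r : 0 < r ->
    (mu (qball rho x (2 * r)) <= (Num.max 1 D0)%:E * mu (qball rho x r))%E.
  move=> r0; apply: le_trans (hD0 x r r0) _.
  by rewrite lee_wpmul2r// lee_fin le_max lexx orbT.
have [xb [rb [rb0 fb]]] := finite_ball_exists x0 hdense mb pb mu_u u0 ufin.
have max1 (t : R) : 1 <= Num.max 1 t by rewrite le_max lexx.
have [B [r [star [K [BF Bb sB cov]]]]] :=
  ball_family_exists (max1 kap0) qm mb pb (max1 D0) dbl rb0 fb.
have dens := dense_bcontinuous_of_dense sB hdense.
have Apu := Ap_of_in_Ap BF Bb p1 wAp.
have p00 : 0 < p by exact: lt_trans p1.
have [a1 [s1' [ap Ap1]]] := Ap_open BF dens Apu.
(* The weight [u] is now in the classes of exponents [q1 = a1^-1 < p] and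
   [q2 = 2 p]. *)
have [s2' Ap2] : exists s', Ap mu B (p^-1 / 2) u s'.
  apply: (Ap_nest BF Apu); rewrite divr_gt0 ?invr_gt0//=.
  by rewrite ltr_pdivrMr// ltr_pMr ?invr_gt0// ltr1n.
have [A [bM bD]] := rdf_bounded_exists BF Ap1 Ap2.
have A1 : 1 <= A by case: bM.
have k0 : 0 < 4 * A by rewrite mulr_gt0// (lt_le_trans ltr01).
have D0' : 0 <= (C0 * N ((K * (4 * A)) `^ p0)) `^ p0 by exact: powR_ge0.
have [C C00 dist] := distribution_bound BF Ap1 Ap2 ufin bM bD hp0 D0'.
have /andP[a10 a11] := ap_a Ap1.
have q11 : 1 < a1^-1 by rewrite invf_gt1.
have q1p : a1^-1 < p by rewrite invf_plt ?posrE.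
have pq2 : p < (p^-1 / 2)^-1 by rewrite invf_div -mulrC invrK ltr_pMr// ltr1n.
have [L L0 grand] := grand_lorentz_bound mu_u u0 ufin q11 q1p pq2 s1 th0 C00.
exists L => // f g Ffg; have [mf mg f0 g0] := hF _ _ Ffg.
have normE h : measurable_fun setT h ->
    grand_lorentz_norm mu p s theta w h = grand_lorentz_norm mu p s theta u h.
  move=> mh; congr ereal_sup; apply/seteqP; split => _ [e he <-]; exists e => //.
    by rewrite lorentz_norm_normalize.
  by rewrite lorentz_norm_normalize.
rewrite !normE//; apply: grand => // t t0.
have wb := weighted_bound_of_Ap BF mb pb Bb cov k0 hp0 hC0 hN_pos hN_mono
  (fun v vA => hyp v vA f g Ffg).
rewrite -(wdistE mu_u u0 ufin)//.
apply: (le_trans (dist f g wb mf mg f0 g0 t t0)).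
rewrite lee_wpmul2l ?lee_fin ?(ltW C00)//; apply: leeD.
  by apply: int_upper_dyadic_le => //; rewrite invr_gt0.
by apply: int_lower_dyadic_le => //; rewrite invr_gt0 divr_gt0 ?invr_gt0.
Qed.
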